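(* Let $K\subset K(x)$ be a simple transcendental field extension and $\nu$ a valuation of $K(x)$ with $\nu(x)>0$ whose restriction $\nu_K$ to $K$ has rank $1$. Let $\mathbf Q=\{Q_i\}_{i\in\bar\Lambda}$ be the well ordered set produced by the recursive procedure described in the context (the procedure stops after at most $\omega\times\omega$ steps, so $\bar\Lambda$ has order type at most $\omega\times\omega$). Then $\mathbf Q$ is a complete set of key polynomials for $\nu$. In other words, for every $\beta\in\Gamma$ the $R_{\nu_K}$-module $\mathbf P_\beta\cap K[x]$ is generated as an additive group by all the monomials in the $Q_i$, multiplied by elements of $K$, of value $\beta$ or higher. In particular, $\bigoplus_{\beta\in\Gamma}\mathbf P_\beta/\mathbf P_{\beta+}=G_{\nu_K}[\mathrm{in}_\nu\mathbf Q]^*$.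
   Context: Setting. $\Gamma$ and $\Gamma_0$ are the value groups of $\nu$ and $\nu_K$; $R_{\nu_K}$ is the valuation ring of $\nu_K$; $\tilde\Gamma_0=\Gamma_0\otimes_{\mathbb Z}\mathbb Q$, with a fixed ordered embedding into $\mathbb R$; values are compared in $\Gamma\otimes\mathbb Q$. $\mathbb N$ = positive integers, $\mathbb N_0=\mathbb N\cup\{0\}$. $\mathbf P_\beta=\{y\in K(x):\nu(y)\ge\beta\}\cup\{0\}$, $\mathbf P_{\beta+}=\{y\in K(x):\nu(y)>\beta\}\cup\{0\}$, $G_\nu=\bigoplus_{\beta\in\Gamma}\mathbf P_\beta/\mathbf P_{\beta+}$; $\mathrm{in}_\nu y$ is the class of $y$ in degree $\nu(y)$; $G_{\nu_K}$ is the analogous algebra for $(K,\nu_K)$. For a set $\mathbf Q$ of polynomials, $\mathrm{in}_\nu\mathbf Q=\{\mathrm{in}_\nu Q:Q\in\mathbf Q\}$. For a graded domain $G$, $G^*=\{g/h: g,h\in G,\ h\ne0 \text{ homogeneous}\}$. Index sets. $\Lambda$ is a countable well ordered set with least element $0$; $i+1$ is the successor of $i$, etc. $(\alpha_i)_{i\in\Lambda}$ are positive integers, $\alpha_0=1$. An index $i$ is inessential if $i+\omega\in\Lambda$ and $\alpha_{i+t}=1$ for all $t\in\mathbb N_0$. For non-maximal $i$, $i+$ denotes $i+\omega$ if $i$ is inessential, and $i+1$ otherwise. Pre-key polynomials: monic $Q_i\in K[x]$ $(i\in\Lambda)$, $Q_0=x$, with $\deg_x Q_i=\alpha_i\deg_x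 Q_{i_0}$ for all non-maximal $i\ge1$ and $i_0<i$ with $i_0+=i$. Put $\beta_i=\nu(Q_i)$, $\bar\alpha_i=\deg_xQ_i$, $\mathbf Q_i=\{Q_q\}_{q<i}$. Standard expansions. An $\ell$-standard monomial is $c\prod_{i\le\ell}Q_i^{\gamma_i}$, $c\in K$, $\gamma_i\in\mathbb N_0$ almost all $0$, with $\gamma_i<\alpha_{i+}$ for $i<\ell$ and, for each inessential $i$, at most one $j<i+$ with $j+=i+$ and $\gamma_j\neq0$ (here $i+$ is computed in $\{q\in\Lambda:q\le\ell\}$). It is $Q_\ell$-free if $\gamma_\ell=0$. A standard monomial is one that is $\ell$-standard for some $\ell\in\Lambda$. A $Q_\ell$-free $\ell$-standard expansion is a finite sum of $Q_\ell$-free $\ell$-standard monomials whose $\nu$-value is the minimum of the values of the monomials; it is homogeneous if all its monomials have the same value. An $\ell$-standard expansion of $g\in K[x]$ is $g=\sum_jc_jQ_\ell^j$ with each $c_j$ a $Q_\ell$-free $\ell$-standard expansion. Set of key polynomials for $\nu$: a set of pre-key polynomials such that (a) $\beta_i\in\tilde\Gamma_0$ for $i\ne\max\Lambda$; (b) if $i\ge1$ has an immediate predecessor, the $(i-1)$-standard expansion of $Q_i$ has the form $Q_i=Q_{i-1}^{\alpha_i}+\sum_{j<\alpha_i}\big(\sum_\gamma c_{j,\gamma}M_\gamma\big)Q_{i-1}^j$ where the $c_{j,\gamma}M_\gamma$ are $Q_{i-1}$-free $(i-1)$-standard monomials ($c_{j,\gamma}\in K$, $M_\gamma$ a product of powers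 of elements of $\mathbf Q_{i-1}$; elements of $K$ if $i=1$), all the monomials appearing have the same $\nu$-value, and $(\mathrm{in}_\nu Q_{i-1})^{\alpha_i}+\sum_{j}\big(\sum_\gamma \mathrm{in}_{\nu_K}c_{j,\gamma}\,\mathrm{in}_\nu M_\gamma\big)(\mathrm{in}_\nu Q_{i-1})^j=0$ is the minimal algebraic relation of $\mathrm{in}_\nu Q_{i-1}$ over $G_{\nu_K}[\mathrm{in}_\nu\mathbf Q_{i-1}]^*$; (c) if $i\ge1$ has no immediate predecessor, there is $i_0$ with $i_0+=i$, and for every such $i_0$ there is an $i_0$-standard expansion $Q_i=\sum_{j=0}^{\alpha_i}c_{j,i_0}Q_{i_0}^j$; every such expansion satisfies $\nu(Q_i)>\min_j\nu(c_{j,i_0}Q_{i_0}^j)$, and $Q_i$ has the smallest degree among polynomials with this property for all $i_0$ with $i_0+=i$; if $\{\beta_{i'}:i'<i\}$ is bounded in $\tilde\Gamma_0$ (in particular if $i\ne\max\Lambda$) then $c_{\alpha_i,i_0}=1$ and $\min_j\nu(c_{j,i_0}Q_{i_0}^j)=\alpha_i\beta_{i_0}=\nu(c_{0,i_0})$; (d) if for some $n$ the set $\{i:\deg_x Q_i=n\}$ is infinite, then $\{\nu(Q_i):\deg_x Q_i=n\}$ is cofinal in $\{\nu(f): f\in K[x]\text{ monic},\deg_x f=n\}$. Completeness. A set $\{Q_i\}_{i\in\Lambda}$ of key polynomials is complete for $\nu$ if for every $\beta\in\Gamma$ the additive group $\mathbf P_\beta\cap K[x]$ is generated by standard monomials $a\prod_{j=1}^sQ_{i_j}^{\gamma_j}$,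 $a\in K$, with $\sum_j\gamma_j\nu(Q_{i_j})+\nu_K(a)\ge\beta$. Truncations. Each $f\in K[x]$ has a unique $Q_i$-expansion $f=\sum_jd_{j,i}Q_i^j$ with $\deg_x d_{j,i}<\deg_x Q_i$; put $\nu_i(f)=\min_j\{\nu(d_{j,i})+j\beta_i\}$. The recursive procedure. Start with $\Lambda=\{0\}$, $Q_0=x$. Suppose a set $\{Q_i\}_{i\in\Lambda}$ of key polynomials has been constructed (after infinitely many steps, take the union of the sets obtained so far). If it is complete, put $\bar\Lambda:=\Lambda$ and stop. Otherwise replace it by the larger set $\{Q_i\}_{i\in\Lambda_+}$ of key polynomials defined as follows, and repeat. (A) $\Lambda$ has a maximal element $\ell$. By non-completeness there is $h\in K[x]$ with $\nu_\ell(h)<\nu(h)$, and then $\mathrm{in}_\nu Q_\ell$ is integral over $G_{\nu_K}[\mathrm{in}_\nu\mathbf Q_\ell]$. Let $\bar Q_\ell$ be a variable, let $g_{1,\ell}=\bar Q_\ell^{\alpha_{\ell+1}}+\sum_{j<\alpha_{\ell+1}}\big(\sum_\gamma\bar c_{j,\gamma}\,\mathrm{in}_\nu M_\gamma\big)\bar Q_\ell^j$ be the minimal polynomial of $\mathrm{in}_\nu Q_\ell$ over $G_{\nu_K}[\mathrm{in}_\nu\mathbf Q_\ell]$, written as an $\ell$-standard expansion ($\bar c_{j,\gamma}$ homogeneous in $G_{\nu_K}$, $M_\gamma$ a product of powers of elements of $\mathbf Q_\ell$ giving $Q_\ell$-free $\ell$-standard monomials); its degree defines $\alpha_{\ell+1}$.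 If $\alpha_{\ell+1}>1$: choose $c_{j,\gamma}\in K$ with $\mathrm{in}_{\nu_K}c_{j,\gamma}=\bar c_{j,\gamma}$ and put $Q_{\ell+1}=Q_\ell^{\alpha_{\ell+1}}+\sum_{j<\alpha_{\ell+1}}\big(\sum_\gamma c_{j,\gamma}M_\gamma\big)Q_\ell^j$, $\Lambda_+=\Lambda\cup\{\ell+1\}$. If $\alpha_{\ell+1}=1$: let $T=\{Q_\ell+w: w\in K[x],\ \deg_xw<\bar\alpha_\ell\}$. Case 1: $\nu(T)$ has a maximal element. Let $Q'=Q_\ell+w\in T$ attain it. Write $w=\sum_{t=0}^sz_{\ell+t}+\tilde w$, $s\in\mathbb N_0$, with each $z_{\ell+t}$ a homogeneous $Q_\ell$-free $\ell$-standard expansion, $\beta_\ell=\nu(z_\ell)<\nu(z_{\ell+1})<\dots<\nu(z_{\ell+s})<\nu(Q')$, and $\tilde w$ a $Q_\ell$-free $\ell$-standard expansion all of whose terms have value $\ge\nu(Q')$. Put $\Lambda_+=\Lambda\cup\{\ell+1,\dots,\ell+s+1\}$, $\alpha_i=1$ and $Q_i=Q_\ell+z_\ell+\dots+z_{i-1}$ for $\ell+1\le i\le\ell+s+1$. Case 2: $\nu(T)$ has no maximal element. Choose $\tilde Q_{\ell+t}=Q_\ell+\tilde w_t\in T$ $(t\in\mathbb N_0)$ with $\nu(\tilde Q_{\ell+t})$ strictly increasing and cofinal in $\nu(T)$. Define recursively homogeneous $Q_\ell$-free $\ell$-standard expansions $z_{\ell+q}$ $(q\in\mathbb N_0)$ of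 strictly increasing values, and partial sums $w_t$ $(t\ge-1)$ of their series, starting from $z_{\ell-1}=w_{-1}=0$: once $w_{t_0}=\sum_{q=0}^{q_0}z_{\ell+q}$ is defined, with $\nu(z_{\ell+q})<\nu(\tilde Q_{\ell+t_0})$ for all $q\le q_0$, write $\tilde w_{t_0+1}-w_{t_0}=\sum_{q=q_0+1}^{q_1}z_{\ell+q}+w'_{t_0+1}$ with each $z_{\ell+q}$ a homogeneous $Q_\ell$-free $\ell$-standard expansion, $\nu(z_{\ell+q_0+1})<\dots<\nu(z_{\ell+q_1})<\nu(\tilde Q_{\ell+t_0+1})$, and $w'_{t_0+1}$ a $Q_\ell$-free $\ell$-standard expansion all of whose terms have value $\ge\nu(\tilde Q_{\ell+t_0+1})$; put $w_{t_0+1}=w_{t_0}+\sum_{q=q_0+1}^{q_1}z_{\ell+q}$. Then put $\alpha_{\ell+t}=1$, $Q_{\ell+t}=Q_\ell+z_\ell+\dots+z_{\ell+t-1}$ for $t\in\mathbb N$, and $\Lambda_+=\Lambda\cup\{\ell+t\}_{t\in\mathbb N}$. (B) $\Lambda$ has no maximal element. By non-completeness the degrees of the $Q_i$ are bounded, so there is $\ell\in\Lambda$ such that every $i\in\Lambda$ with $i>\ell$ is of the form $\ell+t$ with $t\in\mathbb N$, and $\alpha_{\ell+t}=1$ for all $t\in\mathbb N$; moreover there is a monic $h\in K[x]$ with $\nu_{\ell+t}(h)<\nu(h)$ for all $t\in\mathbb N$. Let $Q_{\ell+\omega}$ be such a monic polynomial $h$ of smallest degree, let $\alpha_{\ell+\omega}$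 be the degree in $Q_{\ell+t}$ of its $Q_{\ell+t}$-expansion, and put $\Lambda_+=\Lambda\cup\{\ell+\omega\}$.
   Formalization: The procedure is assumed never to get stuck: each set reached is complete or one of (A), (B) applies. Otherwise the claim can fail: if the values of a limit sequence are unbounded, deg Q_{l+ω} need not be a multiple of deg Q_l, and then standard monomials do not generate. *)

(* Defs.v *)
From HB Require Import structures.
From mathcomp Require Import all_boot all_order all_algebra.
From mathcomp Require Import finmap generic_quotient.
From mathcomp Require Import boolp classical_sets cardinality.

Set Implicit Arguments.
Unset Strict Implicit.
Unset Printing Implicit Defensive.
Import Order.TTheory GRing.Theory.

Local Open Scope classical_set_scope.
Local Open Scope ring_scope.
Local Open Scope quotient_scope.

Notation "x %:F" := (@FracField.tofrac _ x) : ring_scope.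

Record ordGroupType := OrdGroup {
  ordgroup_sort :> porderZmodType;
  ler_total_group : total (<=%R : rel ordgroup_sort);
  ler_translate : forall x y z : ordgroup_sort, x <= y -> z + x <= z + y }.

(* A (Krull) valuation of F with value group Gam, whose value at 0 is +oo.
   The function is total, but its value at 0 is irrelevant: 0 is handled
   separately, as in [vge] and [vgt].  Surjectivity says that Gam is exactly
   the value group of the valuation. *)
Record valuation (F : fieldType) (Gam : ordGroupType) := Valuation {
  vfun :> F -> Gam;
  vfunM : forall x y, x != 0 -> y != 0 -> vfun (x * y) = vfun x + vfun y;
  vfunD : forall x y, x != 0 -> y != 0 -> x + y != 0 ->
            Num.min (vfun x) (vfun y) <= vfun (x + y);
  vfun_surj : forall b, exists2 x, x != 0 & vfun x = b }.

Section GradedAlgebra.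
Variables (F : fieldType) (Gam : ordGroupType) (v : valuation F Gam).
Implicit Types (b c : Gam) (x y : F).

Definition vge b : set F := [set y | y = 0 \/ b <= v y].
Definition vgt b : set F := [set y | y = 0 \/ b < v y].

Lemma ordgroup_comparable b c : (b >=< c)%R.
Proof. exact: ler_total_group. Qed.

Lemma ltr_translate b c d : b < c -> d + b < d + c.
Proof.
rewrite !lt_neqAle => /andP[bc /ler_translate le]; rewrite le andbT.
by apply: contra_neq bc => /addrI.
Qed.

Lemma vgt_vge b y : vgt b y -> vge b y.
Proof. by case=> [->|/ltW ?]; [left|right]. Qed.

Lemma vge0 b : vge b 0. Proof. by left. Qed.
Lemma vgt0 b : vgt b 0. Proof. by left. Qed.

Lemma vfun1 : v 1 = 0.
Proof.
have := vfunM v (oner_neq0 F) (oner_neq0 F); rewrite mulr1.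
by rewrite -{1}[v 1]addr0 => /addrI.
Qed.

Lemma vfunN y : y != 0 -> v (- y) = v y.
Proof.
move=> y0; have n0 : (-1 : F) != 0 by rewrite oppr_eq0 oner_neq0.
rewrite -mulN1r vfunM //; suff -> : v (-1) = 0 by rewrite add0r.
have := vfunM v n0 n0; rewrite mulN1r opprK vfun1 => e.
have [h|h|//] := comparable_ltgtP (ordgroup_comparable (v (-1)) 0).
  by have := ltr_translate (v (-1)) h; rewrite -e addr0 => /(lt_trans h); rewrite ltxx.
by have := ltr_translate (v (-1)) h; rewrite -e addr0 => /(lt_trans h); rewrite ltxx.
Qed.

Lemma vgeD b x y : vge b x -> vge b y -> vge b (x + y).
Proof.
case: (eqVneq x 0) => [->|x0]; first by rewrite add0r.
case: (eqVneq y 0) => [->|y0]; first by rewrite addr0.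
case=> [/eqP|hx]; first by rewrite (negPf x0).
case=> [/eqP|hy]; first by rewrite (negPf y0).
case: (eqVneq (x + y) 0) => [->|s0]; first by left.
right; apply: (le_trans _ (vfunD v x0 y0 s0)).
by rewrite comparable_le_min ?hx ?hy //; apply: ordgroup_comparable.
Qed.

Lemma vgtD b x y : vgt b x -> vgt b y -> vgt b (x + y).
Proof.
case: (eqVneq x 0) => [->|x0]; first by rewrite add0r.
case: (eqVneq y 0) => [->|y0]; first by rewrite addr0.
case=> [/eqP|hx]; first by rewrite (negPf x0).
case=> [/eqP|hy]; first by rewrite (negPf y0).
case: (eqVneq (x + y) 0) => [->|s0]; first by left.
right; apply: (lt_le_trans _ (vfunD v x0 y0 s0)).
by rewrite comparable_lt_min ?hx ?hy //; apply: ordgroup_comparable.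
Qed.

Lemma vgeN b y : vge b y -> vge b (- y).
Proof.
case: (eqVneq y 0) => [->|y0]; first by rewrite oppr0.
by case=> [/eqP|h]; [rewrite (negPf y0)|right; rewrite vfunN].
Qed.

Lemma vgtN b y : vgt b y -> vgt b (- y).
Proof.
case: (eqVneq y 0) => [->|y0]; first by rewrite oppr0.
by case=> [/eqP|h]; [rewrite (negPf y0)|right; rewrite vfunN].
Qed.

Lemma vgeM b c x y : vge b x -> vge c y -> vge (b + c) (x * y).
Proof.
case: (eqVneq x 0) => [->|x0]; first by rewrite mul0r; left.
case: (eqVneq y 0) => [->|y0]; first by rewrite mulr0; left.
case=> [/eqP|hx]; first by rewrite (negPf x0).
case=> [/eqP|hy]; first by rewrite (negPf y0).
right; rewrite vfunM //; apply: (le_trans (ler_translate _ hy)).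
by rewrite ![_ + v y]addrC; apply: ler_translate.
Qed.

Lemma vgtM b c x y : vgt b x -> vge c y -> vgt (b + c) (x * y).
Proof.
case: (eqVneq x 0) => [->|x0]; first by rewrite mul0r; left.
case: (eqVneq y 0) => [->|y0]; first by rewrite mulr0; left.
case=> [/eqP|hx]; first by rewrite (negPf x0).
case=> [/eqP|hy]; first by rewrite (negPf y0).
right; rewrite vfunM //; apply: (le_lt_trans (ler_translate _ hy)).
by rewrite ![_ + v y]addrC; apply: ltr_translate.
Qed.

(* The graded algebra, the direct sum of the vge b / vgt b.  An element is
   represented by a finite formal sum of homogeneous terms (b, y) with y in
   vge b; two formal sums are identified when, in every degree c, the sums of
   their terms of degree c agree modulo vgt c. *)
Definition grterm := {p : Gam * F | `[< vge p.1 p.2 >]}.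
Definition grsum := seq grterm.

Definition GrTerm b y (h : vge b y) : grterm :=
  exist (fun p : Gam * F => `[< vge p.1 p.2 >]) (b, y) (asboolT h).

Definition grcoef (s : grsum) c : F :=
  \sum_(p <- s | (val p).1 == c) (val p).2.

Definition grequiv : rel grsum :=
  fun s t => `[< forall c, vgt c (grcoef s c - grcoef t c) >].

Lemma grequiv_refl : reflexive grequiv.
Proof. by move=> s; apply/asboolP => c; rewrite subrr; left. Qed.

Lemma grequiv_sym : symmetric grequiv.
Proof.
have h s t : grequiv s t -> grequiv t s.
  by move=> /asboolP e; apply/asboolP => c; rewrite -opprB; apply: vgtN.
by move=> s t; apply/idP/idP; apply: h.
Qed.

Lemma grequiv_trans : transitive grequiv.
Proof.
move=> t s u /asboolP e1 /asboolP e2; apply/asboolP => c.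
by rewrite -(subrKA (grcoef t c)); apply: vgtD.
Qed.

Canonical grequiv_equiv :=
  EquivRel grequiv grequiv_refl grequiv_sym grequiv_trans.

Definition gr := {eq_quot grequiv}.
HB.instance Definition _ : EqQuotient _ grequiv gr := EqQuotient.on gr.
HB.instance Definition _ := Choice.on gr.

Lemma grP (s t : grsum) :
  reflect (forall c, vgt c (grcoef s c - grcoef t c)) (\pi_gr s == \pi_gr t).
Proof. by rewrite eqmodE; apply: asboolP. Qed.

Lemma gr_eq (s t : grsum) : grcoef s =1 grcoef t -> \pi_gr s = \pi_gr t.
Proof. by move=> e; apply/eqP/grP => c; rewrite e subrr; left. Qed.

Definition gropp_term (p : grterm) : grterm :=
  GrTerm (vgeN (asboolW (valP p))).
Definition grmul_term (p q : grterm) : grterm :=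
  GrTerm (vgeM (asboolW (valP p)) (asboolW (valP q))).
Lemma vge01 : vge 0 1. Proof. by right; rewrite vfun1. Qed.

Definition gradd_sum (s t : grsum) : grsum := s ++ t.
Definition gropp_sum (s : grsum) : grsum := map gropp_term s.
Definition grmul_sum (s t : grsum) : grsum :=
  [seq grmul_term p q | p <- s, q <- t].
Definition grone_sum : grsum := [:: GrTerm vge01].

Lemma grcoef_vge s c : vge c (grcoef s c).
Proof.
apply: (big_ind (vge c)) => [|x y|p /eqP <-]; [exact: vge0|exact: vgeD|].
exact/asboolP/(valP p).
Qed.

Lemma grcoef_nil c : grcoef [::] c = 0. Proof. by rewrite /grcoef big_nil. Qed.

Lemma grcoefD s t c : grcoef (gradd_sum s t) c = grcoef s c + grcoef t c.
Proof. by rewrite /grcoef big_cat. Qed.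

Lemma grcoefN s c : grcoef (gropp_sum s) c = - grcoef s c.
Proof. by rewrite /grcoef big_map sumrN. Qed.

Lemma grcoefM s t c : grcoef (grmul_sum s t) c =
  \sum_(p <- s) \sum_(q <- t | (val p).1 + (val q).1 == c) (val p).2 * (val q).2.
Proof.
rewrite /grcoef big_mkcond big_allpairs_dep.
by apply: eq_bigr => p _; rewrite [RHS]big_mkcond.
Qed.

Lemma grcoefMl s t c : grcoef (grmul_sum s t) c =
  \sum_(p <- s) (val p).2 * grcoef t (c - (val p).1).
Proof.
rewrite grcoefM; apply: eq_bigr => p _; rewrite mulr_sumr.
by apply: eq_bigl => q; rewrite [in RHS]eq_sym subr_eq eq_sym addrC.
Qed.

Lemma grcoefMC s t c : grcoef (grmul_sum s t) c = grcoef (grmul_sum t s) c.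
Proof.
rewrite !grcoefM; under eq_bigr do rewrite big_mkcond.
rewrite exchange_big; apply: eq_bigr => q _ /=; rewrite -big_mkcond.
by apply: eq_big => p; rewrite addrC // mulrC.
Qed.

Lemma grcoef1 s c : grcoef (grmul_sum grone_sum s) c = grcoef s c.
Proof. by rewrite grcoefMl big_seq1 /= mul1r subr0. Qed.

Lemma grcoefMA s t u c :
  grcoef (grmul_sum s (grmul_sum t u)) c = grcoef (grmul_sum (grmul_sum s t) u) c.
Proof.
rewrite [LHS]grcoefMl [RHS]grcoefMl big_allpairs_dep; apply: eq_bigr => p _.
rewrite grcoefMl mulr_sumr; apply: eq_bigr => q _ /=.
by rewrite mulrA opprD addrA.
Qed.

Lemma grcoefMDl s t u c : grcoef (grmul_sum (gradd_sum s t) u) c =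
  grcoef (gradd_sum (grmul_sum s u) (grmul_sum t u)) c.
Proof. by rewrite grcoefD !grcoefMl big_cat. Qed.

Definition gr_add := lift_op2 gr gradd_sum.
Definition gr_opp := lift_op1 gr gropp_sum.
Definition gr_mul := lift_op2 gr grmul_sum.

Lemma grequiv_repr s c : vgt c (grcoef s c - grcoef (repr (\pi_gr s)) c).
Proof. by move: c; apply/grP; rewrite reprK. Qed.

Lemma pi_gr_add : {morph \pi_gr : s t / gradd_sum s t >-> gr_add s t}.
Proof.
move=> s t; unlock gr_add; apply/eqP/grP => c; rewrite !grcoefD opprD addrACA.
by apply: vgtD; apply: grequiv_repr.
Qed.
Canonical pi_gr_add_morph := PiMorph2 pi_gr_add.

Lemma pi_gr_opp : {morph \pi_gr : s / gropp_sum s >-> gr_opp s}.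
Proof.
move=> s; unlock gr_opp; apply/eqP/grP => c; rewrite !grcoefN -opprD.
by apply/vgtN/grequiv_repr.
Qed.
Canonical pi_gr_opp_morph := PiMorph1 pi_gr_opp.

Lemma grmul_sum_equiv s t t' : (forall c, vgt c (grcoef t c - grcoef t' c)) ->
  forall c, vgt c (grcoef (grmul_sum s t) c - grcoef (grmul_sum s t') c).
Proof.
move=> e c; rewrite !grcoefMl -sumrB.
apply: (big_ind (vgt c)) => [|x y|p _]; [exact: vgt0|exact: vgtD|].
rewrite -mulrBr mulrC -[c in vgt c](subrK (val p).1); apply: vgtM => //.
exact/asboolP/(valP p).
Qed.

Lemma pi_gr_mul : {morph \pi_gr : s t / grmul_sum s t >-> gr_mul s t}.
Proof.
move=> s t; unlock gr_mul; apply/eqP/grP => c.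
rewrite -(subrKA (grcoef (grmul_sum s (repr (\pi_gr t))) c)); apply: vgtD.
  by apply: grmul_sum_equiv; apply: grequiv_repr.
rewrite grcoefMC [X in _ - X]grcoefMC.
by apply: grmul_sum_equiv; apply: grequiv_repr.
Qed.
Canonical pi_gr_mul_morph := PiMorph2 pi_gr_mul.

Lemma gr_addA : associative gr_add.
Proof.
elim/quotW=> s; elim/quotW=> t; elim/quotW=> u; rewrite !piE.
by rewrite /gradd_sum catA.
Qed.

Lemma gr_addC : commutative gr_add.
Proof.
elim/quotW=> s; elim/quotW=> t; rewrite !piE.
by apply: gr_eq => c; rewrite !grcoefD addrC.
Qed.

Lemma gr_add0 : left_id (\pi_gr [::]) gr_add.
Proof. by elim/quotW=> s; rewrite !piE. Qed.

Lemma gr_addN : left_inverse (\pi_gr [::]) gr_opp gr_add.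
Proof.
elim/quotW=> s; rewrite !piE.
by apply: gr_eq => c; rewrite grcoefD grcoefN addNr grcoef_nil.
Qed.

HB.instance Definition _ :=
  GRing.isZmodule.Build gr gr_addA gr_addC gr_add0 gr_addN.

Lemma gr_mulA : associative gr_mul.
Proof.
elim/quotW=> s; elim/quotW=> t; elim/quotW=> u; rewrite !piE.
by apply: gr_eq => c; rewrite grcoefMA.
Qed.

Lemma gr_mulC : commutative gr_mul.
Proof.
elim/quotW=> s; elim/quotW=> t; rewrite !piE.
by apply: gr_eq => c; rewrite grcoefMC.
Qed.

Lemma gr_mul1 : left_id (\pi_gr grone_sum) gr_mul.
Proof. by elim/quotW=> s; rewrite !piE; apply: gr_eq => c; rewrite grcoef1. Qed.

Lemma gr_mulDl : left_distributive gr_mul gr_add.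
Proof.
elim/quotW=> s; elim/quotW=> t; elim/quotW=> u; rewrite !piE.
by apply: gr_eq => c; rewrite grcoefMDl.
Qed.

Lemma gr_one_neq0 : \pi_gr grone_sum != 0.
Proof.
apply/grP => /(_ 0); rewrite grcoef_nil subr0 /grcoef big_mkcond big_seq1 /=.
rewrite eqxx; case=> [/eqP|]; first by rewrite oner_eq0.
by rewrite vfun1 ltxx.
Qed.

HB.instance Definition _ := GRing.Zmodule_isComNzRing.Build gr
  gr_mulA gr_mulC gr_mul1 gr_mulDl gr_one_neq0.

Definition grclass b y (h : vge b y) : gr := \pi_gr [:: GrTerm h].

Lemma vge_refl y : vge (v y) y. Proof. by right. Qed.

(* The initial form of y; it is 0 if y = 0. *)
Definition inform y : gr := grclass (vge_refl y).

Definition homogeneous (z : gr) : Prop :=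
  exists (b : Gam) (y : F) (h : vge b y), z = grclass h.

(* G^* for a subring G of gr: a nonzero homogeneous element of gr is the
   initial form of a nonzero element of F, hence invertible, so that the
   fractions g / h live in gr itself. *)
Definition gstar (G : set gr) : set gr :=
  [set z | exists g h, [/\ G g, G h, homogeneous h & h != 0] /\ z * h = g].

End GradedAlgebra.

Section ValueGroups.
Variable Gam : ordGroupType.
Implicit Types (A G H : set Gam) (b m : Gam).

Definition is_least A m : Prop := A m /\ forall b, A b -> m <= b.

Definition convex_subgroup G H : Prop :=
  [/\ H `<=` G, H 0, forall a b, H a -> H b -> H (a - b)
    & forall a b, H a -> G b -> 0 <= b -> b <= a -> H b].

(* The rank is the number of proper convex subgroups: here {0} is proper, and
   it is the only proper one. *)
Definition rank_one G : Prop :=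
  (exists2 b, G b & b != 0) /\
  forall H, convex_subgroup G H -> H = [set 0] \/ H = G.

(* b belongs to the divisible hull of G; recall that Gam is torsion free. *)
Definition in_hull G b : Prop := exists2 n : nat, (0 < n)%N & G (b *+ n).

(* A is bounded above by an element g / n of the divisible hull of G. *)
Definition bounded_in_hull G A : Prop :=
  exists g, exists2 n : nat, (0 < n)%N & G g /\ forall b, A b -> b *+ n <= g.

End ValueGroups.

Section Generation.

Inductive zspan (V : zmodType) (A : set V) : V -> Prop :=
| zspan0 : zspan A 0
| zspan_sub x y : zspan A x -> zspan A y -> zspan A (x - y)
| zspan_gen x : A x -> zspan A x.

Inductive subring_gen (R : nzRingType) (A : set R) : R -> Prop :=
| subring_gen1 : subring_gen A 1
| subring_gen_sub x y :
    subring_gen A x -> subring_gen A y -> subring_gen A (x - y)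
| subring_gen_mul x y :
    subring_gen A x -> subring_gen A y -> subring_gen A (x * y)
| subring_gen_gen x : A x -> subring_gen A x.

Definition minimal_polynomial (R : nzRingType) (S : set R) (y : R)
    (p : {poly R}) : Prop :=
  [/\ p \is monic, forall j, S p`_j, p.[y] = 0
    & forall q : {poly R},
        q != 0 -> (forall j, S q`_j) -> q.[y] = 0 -> (size p <= size q)%N].

Definition degree (R : nzRingType) (p : {poly R}) : nat := (size p).-1.

End Generation.

(* Index sets are initial segments L of an arbitrary well ordered type W, whose
   least element \bot is the index 0. *)
Section Indices.
Variables (d : Order.disp_t) (W : bOrderType d) (alpha : W -> nat).
Implicit Types (L : set W) (i j k : W).

Definition initial_segment L : Prop :=
  L \bot%O /\ forall i j, L j -> (i <= j)%O -> L i.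

Definition is_max L i : Prop := L i /\ forall j, L j -> (j <= i)%O.

(* j = i + 1 *)
Definition is_succ i j : Prop :=
  (i < j)%O /\ forall k, (i < k)%O -> (j <= k)%O.

(* j = i + t *)
Fixpoint is_plus i (t : nat) j : Prop :=
  if t is t'.+1 then exists2 k, is_plus i t' k & is_succ k j else j = i.

(* j = i + omega *)
Definition is_plus_omega i j : Prop :=
  (forall t, exists2 k, is_plus i t k & (k < j)%O) /\
  (forall j', (forall t k, is_plus i t k -> (k < j')%O) -> (j <= j')%O).

Definition inessential L i : Prop :=
  (exists2 j, is_plus_omega i j & L j) /\
  (forall t j, is_plus i t j -> alpha j = 1%N).

(* j = i+, computed in L *)
Definition is_next L i j : Prop :=
  L j /\ ((inessential L i /\ is_plus_omega i j) \/
          (~ inessential L i /\ is_succ i j)).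

Definition upto L l : set W := [set q | L q /\ (q <= l)%O].

End Indices.

Section KeyPolynomials.
Variables (K : fieldType) (Gam : ordGroupType).
Variable nu : valuation {fraction {poly K}} Gam.
Variables (d : Order.disp_t) (W : bOrderType d).
Variables (alpha : W -> nat) (Q : W -> {poly K}).
Implicit Types (L : set W) (i l : W) (f w : {poly K}).

Definition pval f : Gam := nu f%:F.
Definition beta i : Gam := pval (Q i).
Definition pge (b : Gam) f : Prop := vge nu b f%:F.
Definition inp f : gr nu := inform nu f%:F.
Definition inK (c : K) : gr nu := inp c%:P.

Definition value_group_K : set Gam :=
  [set b | exists2 c : K, c != 0 & b = pval c%:P].

(* G_{nu_K}[in_nu Q_q, q in A] inside G_nu, G_{nu_K} being identified with its
   image in G_nu, which is the subring generated by the in_nu c, c in K. *)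
Definition adjoin (A : set W) : set (gr nu) :=
  subring_gen [set z | (exists c, z = inK c) \/ (exists2 q, A q & z = inp (Q q))].
Definition before L l : set W := [set q | L q /\ (q < l)%O].

(* An exponent g stands for the product of the Q_i ^ (g i), and a function E
   from exponents to K for the sum of the monomials E g * mono g, over the g
   such that E g is nonzero. *)
Definition exponent := {fsfun W -> nat with 0%N}.
Definition expansion := {fsfun exponent -> K with 0}.

Definition mono (g : exponent) : {poly K} := \prod_(i <- finsupp g) Q i ^+ g i.
Definition term (E : expansion) (g : exponent) : {poly K} := E g *: mono g.
Definition ev (E : expansion) : {poly K} := \sum_(g <- finsupp E) term E g.

(* mono g is a product as in an l-standard monomial. *)
Definition standard_exponent L l (g : exponent) : Prop :=
  let L' := upto L l in
  [/\ forall i, g i != 0%N -> L' i,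
      forall i j, (i < l)%O -> is_next alpha L' i j -> (g i < alpha j)%N
    & forall i k j j', inessential alpha L' i -> is_next alpha L' i k ->
        is_next alpha L' j k -> is_next alpha L' j' k ->
        g j != 0%N -> g j' != 0%N -> j = j'].

(* E is a Q_l-free l-standard expansion; E = 0 is the empty sum. *)
Definition free_expansion L l (E : expansion) : Prop :=
  (forall g, g \in finsupp E -> standard_exponent L l g /\ g l = 0%N) /\
  (finsupp E != fset0 ->
     ev E != 0 /\
     is_least [set b | exists2 g, g \in finsupp E & b = pval (term E g)]
              (pval (ev E))).

Definition homogeneous_expansion L l (E : expansion) : Prop :=
  free_expansion L l E /\
  exists b, forall g, g \in finsupp E -> pval (term E g) = b.

(* f = sum_(j < n) c_j Q_l^j is an l-standard expansion, with c_j = ev (C j). *)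
Definition standard_expansion L l f (n : nat) (C : nat -> expansion) : Prop :=
  (forall j, (j < n)%N -> free_expansion L l (C j)) /\
  f = \sum_(j < n) ev (C j) * Q l ^+ j.

Definition summand_values l (n : nat) (C : nat -> expansion) : set Gam :=
  [set b | exists j, [/\ (j < n)%N, ev (C j) != 0
                       & b = pval (ev (C j) * Q l ^+ j)]].

(* nu(f) > min_j nu(c_j Q_l^j) for every l-standard expansion of f (there is
   at least one). *)
Definition jumps L l f : Prop :=
  (exists n C, standard_expansion L l f n C) /\
  (forall n C, standard_expansion L l f n C ->
     exists2 m, is_least (summand_values l n C) m & m < pval f).

(* The polynomial X^a + sum_(j < a) (sum_g in(c_{j,g}) in(M_g)) X^j over G_nu
   and its lift Q_l^a + sum_(j < a) (sum_g c_{j,g} M_g) Q_l^j. *)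
Definition initial_relation (a : nat) (E : nat -> expansion) : {poly gr nu} :=
  'X^a + \sum_(j < a)
    (\sum_(g <- finsupp (E j)) inK (E j g) * inp (mono g))%:P * 'X^j.
Definition lift_relation l (a : nat) (E : nat -> expansion) : {poly K} :=
  Q l ^+ a + \sum_(j < a) ev (E j) * Q l ^+ j.

Record pre_key L : Prop := {
  pre_key_segment : initial_segment L;
  pre_key_countable : countable L;
  pre_key_alpha : forall i, L i -> (0 < alpha i)%N;
  pre_key_alpha0 : alpha \bot%O = 1%N;
  pre_key_monic : forall i, L i -> Q i \is monic;
  pre_key_Q0 : Q \bot%O = 'X;
  pre_key_degree : forall i i0, L i -> i != \bot%O -> ~ is_max L i ->
    is_next alpha L i0 i -> degree (Q i) = (alpha i * degree (Q i0))%N }.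

Definition key_successor L p i : Prop :=
  exists E : nat -> expansion,
    [/\ forall j, (j < alpha i)%N -> free_expansion L p (E j),
        Q i = lift_relation p (alpha i) E,
        forall j g, (j < alpha i)%N -> g \in finsupp (E j) ->
          pval (term (E j) g * Q p ^+ j) = pval (Q p ^+ alpha i)
      & minimal_polynomial (gstar (adjoin (before L p))) (inp (Q p))
          (initial_relation (alpha i) E)].

Definition key_limit L i : Prop :=
  [/\ exists i0, is_next alpha L i0 i,
      forall i0, is_next alpha L i0 i ->
        (exists C, standard_expansion L i0 (Q i) (alpha i).+1 C) /\
        jumps L i0 (Q i),
      forall f, (forall i0, is_next alpha L i0 i -> jumps L i0 f) ->
        (degree (Q i) <= degree f)%N
    & bounded_in_hull value_group_K [set beta i' | i' in before L i] \/
      ~ is_max L i ->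
      forall i0 C, is_next alpha L i0 i ->
        standard_expansion L i0 (Q i) (alpha i).+1 C ->
        [/\ ev (C (alpha i)) = 1,
            is_least (summand_values i0 (alpha i).+1 C) (beta i0 *+ alpha i),
            ev (C 0%N) != 0
          & pval (ev (C 0%N)) = beta i0 *+ alpha i]].

Record key_polynomials L : Prop := {
  key_pre : pre_key L;
  key_hull : forall i, L i -> ~ is_max L i -> in_hull value_group_K (beta i);
  key_succ : forall p i, L i -> is_succ p i -> key_successor L p i;
  key_lim : forall i, L i -> i != \bot%O -> ~ (exists p, is_succ p i) ->
    key_limit L i;
  key_cofinal : forall n, infinite_set [set i | L i /\ degree (Q i) = n] ->
    forall f, f \is monic -> degree f = n ->
    exists2 i, L i /\ degree (Q i) = n & pval f <= beta i }.

(* a * mono g has value at least b, computed monomially. *)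
Definition monomial_ge (b : Gam) (a : K) (g : exponent) : Prop :=
  a != 0 /\ b <= \sum_(i <- finsupp g) beta i *+ g i + pval a%:P.

Definition complete L : Prop :=
  forall b : Gam, pge b =
    zspan [set f | exists a g, [/\ f = a *: mono g, monomial_ge b a g
                                 & exists2 l, L l & standard_exponent L l g]].

(* The Q_l-expansion sum_j d_j Q_l^j of f, as a polynomial with coefficients
   in K[x]. *)
Definition is_expansion l f (D : {poly {poly K}}) : Prop :=
  f = D.[Q l] /\ forall j, (size (D`_j)%R < size (Q l))%N.

(* m = nu_l(f), for f nonzero *)
Definition truncation l f (m : Gam) : Prop :=
  exists2 D, is_expansion l f D
    & is_least [set b | exists2 j, D`_j != 0 & b = pval D`_j + beta l *+ j] m.

Definition same_degree l : set {poly K} :=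
  [set f | exists2 w : {poly K}, (size w < size (Q l))%N & f = Q l + w].

(* l = max L; the minimal polynomial of in(Q_l) has degree a > 1. *)
Definition step_successor L l (a : nat) (E : nat -> expansion) L' : Prop :=
  exists k, [/\ is_succ l k, alpha k = a, Q k = lift_relation l a E
              & L' = L `|` [set k]].

(* The indices l + t for which P t holds exist; they are the new indices, and
   Q_{l+t} = Q_l + z_0 + ... + z_{t-1}. *)
Definition add_partial_sums L l (z : nat -> expansion) (P : nat -> Prop) L' :
    Prop :=
  (forall t, P t -> exists k, [/\ is_plus l t k, alpha k = 1%N
                                & Q k = Q l + \sum_(q < t) ev (z q)]) /\
  L' = L `|` [set k | exists2 t, P t & is_plus l t k].

Definition tail_ge L l (E : expansion) (b : Gam) : Prop :=
  free_expansion L l E /\ forall g, g \in finsupp E -> b <= pval (term E g).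

(* l = max L, the minimal polynomial of in(Q_l) has degree 1, and nu attains a
   maximum on same_degree l at Q' = Q_l + w. *)
Definition step_attained L l L' : Prop :=
  exists (w : {poly K}) (s : nat) (z : nat -> expansion) (tl : expansion),
    [/\ (size w < size (Q l))%N /\
          (forall f, same_degree l f -> pval f <= pval (Q l + w)),
        w = \sum_(q < s.+1) ev (z q) + ev tl,
        forall q, (q <= s)%N ->
          homogeneous_expansion L l (z q) /\ ev (z q) != 0,
        [/\ pval (ev (z 0%N)) = beta l,
            forall q, (q < s)%N -> pval (ev (z q)) < pval (ev (z q.+1)),
            pval (ev (z s)) < pval (Q l + w)
          & tail_ge L l tl (pval (Q l + w))]
      & add_partial_sums L l z (fun t => 0 < t <= s.+1)%N L'].

(* Same, when nu attains no maximum on same_degree l: the Q_l + wt t are cofinal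
   there, and n t is the number of the z_q constructed up to step t, so that
   w_t = sum_(q < n t) z_q; n_prev 0 = 0 corresponds to w_{-1} = 0. *)
Definition step_unattained L l L' : Prop :=
  exists (wt : nat -> {poly K}) (z tl : nat -> expansion) (n : nat -> nat),
    let Qt t := Q l + wt t in
    let n_prev t := if t is t'.+1 then n t' else 0%N in
    [/\ ~ (exists2 f, same_degree l f
             & forall g, same_degree l g -> pval g <= pval f),
        [/\ forall t, (size (wt t) < size (Q l))%N,
            forall t, pval (Qt t) < pval (Qt t.+1)
          & forall f, same_degree l f -> exists t, pval f <= pval (Qt t)],
        [/\ forall q, homogeneous_expansion L l (z q) /\ ev (z q) != 0,
            forall q, pval (ev (z q)) < pval (ev (z q.+1))
          & forall q, exists t, (q < n t)%N],
        forall t, [/\ (n_prev t <= n t)%N,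
            wt t - \sum_(q < n_prev t) ev (z q) =
              \sum_(n_prev t <= q < n t) ev (z q) + ev (tl t),
            forall q, (q < n t)%N -> pval (ev (z q)) < pval (Qt t)
          & tail_ge L l (tl t) (pval (Qt t))]
      & add_partial_sums L l z (fun t => 0 < t)%N L'].

Definition step_from_max L L' : Prop :=
  exists l (a : nat) (E : nat -> expansion),
    [/\ is_max L l,
        forall j, (j < a)%N -> homogeneous_expansion L l (E j),
        minimal_polynomial (adjoin (before L l)) (inp (Q l))
          (initial_relation a E)
      & ((1 < a)%N /\ step_successor L l a E L') \/
        (a = 1%N /\ (step_attained L l L' \/ step_unattained L l L'))].

Definition limit_jump l f : Prop :=
  f \is monic /\
  forall t j, (0 < t)%N -> is_plus l t j ->
    exists2 m, truncation j f m & m < pval f.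

Definition step_from_union L L' : Prop :=
  (~ exists l, is_max L l) /\
  exists l k,
    [/\ L l,
        forall i, L i -> (l < i)%O ->
          exists2 t, (0 < t)%N & is_plus l t i,
        forall t i, (0 < t)%N -> is_plus l t i -> alpha i = 1%N,
        [/\ is_plus_omega l k, limit_jump l (Q k),
            forall f, limit_jump l f -> (degree (Q k) <= degree f)%N
          & forall t j D, (0 < t)%N -> is_plus l t j ->
              is_expansion j (Q k) D -> alpha k = degree D]
      & L' = L `|` [set k]].

(* S a b is the index set reached after omega * a + b steps of the procedure;
   it no longer changes once the set is complete.  Nothing here forces the
   procedure to stop: the index set after omega * omega steps is the union of
   all the S a b, complete or not. *)
Definition procedure (S : nat -> nat -> set W) : Prop :=
  [/\ S 0%N 0%N = [set \bot%O], Q \bot%O = 'X, alpha \bot%O = 1%N,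
      forall a b, (complete (S a b) /\ S a b.+1 = S a b) \/
        (~ complete (S a b) /\
           (step_from_max (S a b) (S a b.+1) \/
            step_from_union (S a b) (S a b.+1)))
    & forall a, S a.+1 0%N = \bigcup_b S a b].

End KeyPolynomials.

Definition order_type_le_omega2 (d : Order.disp_t) (W : bOrderType d)
    (L : set W) : Prop :=
  exists phi : W -> nat *l nat,
    forall i j, L i -> L j -> (i < j)%O -> (phi i < phi j)%O.

(* Main.v *)
(* Call a monic Q of value b strict if, for f and g of degree less than deg Q and
   fg = r + sQ the division by Q, nu(sQ) > nu(fg).  Then the truncation of nu at Q
   is multiplicative.  If all polynomials of degree less than deg P are computed
   correctly by truncations at strict polynomials that all underestimate P, then P
   is strict as well; this propagates strictness along the procedure.

   The minimality of the relation of in(Q_l) says that the truncation at Q_l is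
   exact in degrees less than alpha_(l+1) deg Q_l, so that standard expansions
   obtained by repeated division compute values.

   At a limit index, let f be the limit polynomial and let delta be the eventual
   degree of the initial form of f for the weights beta_t of its predecessors Q_t.
   Multiplying f by an approximate inverse of its coefficient of index delta and
   dropping the terms of higher degree gives a monic g of degree delta deg Q_t.
   The dropped terms lie above the truncated value by a fixed positive gap; since
   nu_K has rank one, the remaining increments of a bounded sequence beta_t are
   eventually smaller than this gap, so g jumps wherever f does, and minimality
   gives deg f = delta deg Q_t.

   Two consecutive steps of the procedure raise the degree.  Hence either some
   finite step is complete, or the degrees are unbounded and the union of the
   first omega steps is complete because every polynomial is expanded exactly. *)

(* Truncated values are handled as predicates on thresholds ([wcmp]), not as minima: the zero
   polynomial then needs no separate case, and strict and weak bounds share their proofs. The weight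
   given to a polynomial is kept apart from its value, only [b <= nu q] being required in [skey].
   This freedom lets two key polynomials of the same degree be compared at one common weight, where
   their truncations agree.

   The delicate point is a limit index. Its definition only locates the degree of [Q i] between
   [alpha i] and [alpha i + 1] times the degree of its predecessors, whereas standard expansions
   need an exact multiple. Exactness holds when the values of the predecessors are bounded in the
   divisible hull of the value group of K. [limit_bounded] derives such a bound as soon as [beta i]
   itself lies in the hull. If it does not, [step_hull] forbids any step from [i]: a relation for
   the initial form of [Q i] would put [beta i] in the hull. The procedure can then only have
   stopped with a complete set. So the invariant may claim expansions under the hull condition
   alone. *)
From HB Require Import structures.
Require Import Defs.
From mathcomp Require Import all_boot all_order all_algebra.
From mathcomp Require Import finmap generic_quotient.
From mathcomp Require Import boolp classical_sets cardinality.
From mathcomp Require Import zify ring.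

Set Implicit Arguments.
Unset Strict Implicit.
Unset Printing Implicit Defensive.
Import Order.TTheory GRing.Theory.
Local Open Scope classical_set_scope.
Local Open Scope ring_scope.

(* The square-zero extension of Z by an abelian group: the [ring] tactic, used
   in this commutative ring, decides equations in the group. *)
Section SquareZero.
Variable G : zmodType.

Definition sqz : Type := (int * G)%type.
HB.instance Definition _ := GRing.Zmodule.on sqz.

Definition sqz_mul (x y : sqz) : sqz := (x.1 * y.1, y.2 *~ x.1 + x.2 *~ y.1).
Definition sqz_one : sqz := (1, 0).

Lemma sqz_mulA : associative sqz_mul.
Proof.
move=> [a x] [b y] [c z]; congr pair => /=; first by rewrite mulrA.
rewrite !mulrzDl -!mulrzA addrA; congr (_ + _ + _); congr (_ *~ _); ring.
Qed.

Lemma sqz_mulC : commutative sqz_mul.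
Proof. by move=> [a x] [b y]; congr pair => /=; rewrite ?(mulrC a) // addrC. Qed.

Lemma sqz_mul1 : left_id sqz_one sqz_mul.
Proof. by move=> [a x]; congr pair => /=; rewrite ?mul1r // mul0rz addr0 mulr1z. Qed.

Lemma sqz_mulDl : left_distributive sqz_mul +%R.
Proof.
move=> [a x] [b y] [c z]; congr pair => /=; first by rewrite mulrDl.
by rewrite mulrzDr mulrzDl addrACA.
Qed.

Lemma sqz_one_neq0 : sqz_one != 0 :> sqz.
Proof. by []. Qed.

HB.instance Definition _ := GRing.Zmodule_isComNzRing.Build sqz
  sqz_mulA sqz_mulC sqz_mul1 sqz_mulDl sqz_one_neq0.

Definition sqz_in (x : G) : sqz := (0, x).

Lemma sqz_in_zmod : zmod_morphism sqz_in.
Proof. by move=> x y; congr pair; rewrite /= subr0. Qed.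
HB.instance Definition _ := GRing.isZmodMorphism.Build G sqz sqz_in sqz_in_zmod.

Lemma sqz_inj x y : sqz_in x = sqz_in y -> x = y.
Proof. by case. Qed.

End SquareZero.

Ltac zring := apply: sqz_inj; ring.

(** * Ordered groups and values of polynomials *)

Section OrderedGroup.
Variable G : ordGroupType.
Implicit Types x y z a b c : G.

Lemma og_leP a b : a <= b \/ b < a.
Proof.
have := ordgroup_comparable a b.
by case/comparable_leP => [|]; [left|right].
Qed.

Lemma og_leNlt a b : ~ (a <= b) -> b < a.
Proof. by case: (og_leP a b). Qed.

Lemma og_ltNle a b : ~ (a < b) -> b <= a.
Proof. by case: (og_leP b a). Qed.

Lemma og_shift_le a b x y : a <= b -> y - x = b - a -> x <= y.
Proof.
move=> /(ler_translate (x - a)); rewrite subrK => le e.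
by have -> : y = x - a + b by rewrite addrAC -addrA -e addrC subrK.
Qed.

Lemma og_shift_lt a b x y : a < b -> y - x = b - a -> x < y.
Proof.
move=> /(ltr_translate (x - a)); rewrite subrK => le e.
by have -> : y = x - a + b by rewrite addrAC -addrA -e addrC subrK.
Qed.

Lemma og_leD a b c d : a <= b -> c <= d -> a + c <= b + d.
Proof.
move=> ab cd; apply: (le_trans (ler_translate a cd)).
by apply: (og_shift_le ab); zring.
Qed.

Lemma og_ltD a b c d : a < b -> c <= d -> a + c < b + d.
Proof.
move=> ab cd; apply: (le_lt_trans (ler_translate a cd)).
by apply: (og_shift_lt ab); zring.
Qed.

Lemma og_leMn n a b : a <= b -> a *+ n <= b *+ n.
Proof.
by move=> ab; elim: n => [|n IH]; rewrite ?mulr0n // !mulrS; apply: og_leD.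
Qed.

Lemma og_ltMn n a b : (0 < n)%N -> a < b -> a *+ n < b *+ n.
Proof.
by case: n => // n _ ab; rewrite !mulrS; apply: og_ltD => //; apply/og_leMn/ltW.
Qed.

Lemma og_leMnn m n a : (m <= n)%N -> 0 <= a -> a *+ m <= a *+ n.
Proof.
move=> /subnK <- a0; rewrite mulrnDr -[X in X <= _]add0r.
by apply: og_leD => //; rewrite -(mul0rn _ (n - m)); apply: og_leMn.
Qed.

End OrderedGroup.

Section PolyValuation.
Variables (K : fieldType) (Gam : ordGroupType).
Variable nu : valuation {fraction {poly K}} Gam.
Implicit Types (f g h q : {poly K}) (b c e : Gam).

Notation v := (pval nu).
Notation pge := (pge nu).

Definition pgt b f : Prop := vgt nu b f%:F.

Lemma tofrac_polyD f g : (f + g)%:F = f%:F + g%:F :> {fraction {poly K}}.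
Proof. exact: tofracD. Qed.

Lemma pge0 b : pge b 0. Proof. by left; apply: tofrac0. Qed.
Lemma pgt0 b : pgt b 0. Proof. by left; apply: tofrac0. Qed.
Hint Resolve pge0 pgt0 : core.

Lemma pgeD b f g : pge b f -> pge b g -> pge b (f + g).
Proof. by move=> bf bg; rewrite /Defs.pge tofrac_polyD; apply: vgeD. Qed.
Lemma pgtD b f g : pgt b f -> pgt b g -> pgt b (f + g).
Proof. by move=> bf bg; rewrite /pgt tofrac_polyD; apply: vgtD. Qed.
Lemma pgeN b f : pge b f -> pge b (- f).
Proof. by move=> bf; rewrite /Defs.pge tofracN; apply: vgeN. Qed.
Lemma pgtN b f : pgt b f -> pgt b (- f).
Proof. by move=> bf; rewrite /pgt tofracN; apply: vgtN. Qed.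
Lemma pgeB b f g : pge b f -> pge b g -> pge b (f - g).
Proof. by move=> bf /pgeN; apply: pgeD. Qed.
Lemma pgtB b f g : pgt b f -> pgt b g -> pgt b (f - g).
Proof. by move=> bf /pgtN; apply: pgtD. Qed.

Lemma pgtW b f : pgt b f -> pge b f.
Proof. exact: vgt_vge. Qed.

Lemma pgeM b c f g : pge b f -> pge c g -> pge (b + c) (f * g).
Proof. by move=> bf cg; rewrite /Defs.pge tofracM; apply: vgeM. Qed.
Lemma pgtM b c f g : pgt b f -> pge c g -> pgt (b + c) (f * g).
Proof. by move=> bf cg; rewrite /pgt tofracM; apply: vgtM. Qed.

Lemma pge_sum b (I : Type) (r : seq I) (P : pred I) (F : I -> {poly K}) :
  (forall i, P i -> pge b (F i)) -> pge b (\sum_(i <- r | P i) F i).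
Proof. by move=> h; apply: (big_ind (pge b)) => // x y; apply: pgeD. Qed.
Lemma pgt_sum b (I : Type) (r : seq I) (P : pred I) (F : I -> {poly K}) :
  (forall i, P i -> pgt b (F i)) -> pgt b (\sum_(i <- r | P i) F i).
Proof. by move=> h; apply: (big_ind (pgt b)) => // x y; apply: pgtD. Qed.

Lemma pgeW b c f : b <= c -> pge c f -> pge b f.
Proof. by move=> bc [h|cf]; [by left|right; apply: le_trans cf]. Qed.
Lemma pgt_ltW b c f : b < c -> pge c f -> pgt b f.
Proof. by move=> bc [h|cf]; [by left|right; apply: lt_le_trans cf]. Qed.
Lemma pgt_leW b c f : b <= c -> pgt c f -> pgt b f.
Proof. by move=> bc [h|cf]; [by left|right; apply: le_lt_trans cf]. Qed.

Lemma pgeP b f : f != 0 -> pge b f <-> b <= v f.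
Proof.
move=> f0; split=> [[/eqP|//]|]; last by right.
by rewrite tofrac_eq0 (negPf f0).
Qed.
Lemma pgtP b f : f != 0 -> pgt b f <-> b < v f.
Proof.
move=> f0; split=> [[/eqP|//]|]; last by right.
by rewrite tofrac_eq0 (negPf f0).
Qed.
Lemma pge_val f : pge (v f) f. Proof. by right. Qed.
Hint Resolve pge_val : core.

Lemma pgt_val f : pgt (v f) f -> f = 0.
Proof. by case: (eqVneq f 0) => // f0 /(pgtP _ f0); rewrite ltxx. Qed.

Lemma NpgtE b f : ~ pgt b f -> f != 0 /\ v f <= b.
Proof.
case: (eqVneq f 0) => [->|f0] h; first by case: h.
by split=> //; apply: og_ltNle => /(pgtP _ f0).
Qed.

Lemma vM f g : f != 0 -> g != 0 -> v (f * g) = v f + v g.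
Proof. by move=> f0 g0; rewrite /pval tofracM vfunM ?tofrac_eq0. Qed.

Lemma v1 : v 1 = 0.
Proof. by rewrite /pval tofrac1 vfun1. Qed.

Lemma vN f : v (- f) = v f.
Proof.
case: (eqVneq f 0) => [->|f0]; first by rewrite oppr0.
by rewrite /pval tofracN vfunN ?tofrac_eq0.
Qed.

Lemma vX f n : f != 0 -> v (f ^+ n) = v f *+ n.
Proof.
move=> f0; elim: n => [|n IH]; first by rewrite expr0 v1.
by rewrite exprS vM ?expf_neq0 // IH mulrS.
Qed.

Lemma pge1 : pge 0 1. Proof. by have := pge_val 1; rewrite v1. Qed.

Lemma pgeX n c f : pge c f -> pge (c *+ n) (f ^+ n).
Proof.
move=> cf; elim: n => [|n IH]; first by rewrite expr0 mulr0n; apply: pge1.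
by rewrite exprS mulrS; apply: pgeM.
Qed.

Lemma v_dom b f g : f != 0 -> v f = b -> pgt b g -> f + g != 0 /\ v (f + g) = b.
Proof.
move=> f0 <- fg; have nz : ~ pgt (v f) (f + g).
  by move=> /pgtB /(_ fg); rewrite addrK => /pgt_val/eqP; rewrite (negPf f0).
have [n0 le] := NpgtE nz; split=> //; apply: le_anti; rewrite le /=.
by apply/(pgeP _ n0)/pgeD/pgtW.
Qed.

Lemma NpgtM b c f g : ~ pgt b f -> ~ pgt c g -> ~ pgt (b + c) (f * g).
Proof.
move=> /NpgtE [f0 hf] /NpgtE [g0 hg]; rewrite pgtP ?mulf_neq0 // vM //.
by move=> /lt_le_trans /(_ (og_leD hf hg)); rewrite ltxx.
Qed.

Lemma v_exact b f : pge b f -> ~ pgt b f -> f != 0 /\ v f = b.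
Proof.
move=> bf /NpgtE [f0 le]; split=> //; apply: le_anti; rewrite le /=.
exact/pgeP.
Qed.

Lemma NpgtV f : f != 0 -> ~ pgt (v f) f.
Proof. by move=> f0 /pgt_val/eqP; apply/negP. Qed.

End PolyValuation.
#[export] Hint Resolve pge0 pgt0 pge_val : core.

(** * Expansions in powers of a polynomial and truncations *)

Lemma seq_argmin (G : ordGroupType) (T : eqType) (F : T -> G) (s : seq T) :
  s != [::] -> exists2 x, x \in s & forall y, y \in s -> F x <= F y.
Proof.
elim: s => // x [|y s] IH _; first by exists x; rewrite ?mem_head // => z /[!inE]/eqP->.
have [//|z zs hz] := IH; have [le|lt] := og_leP (F x) (F z).
  exists x; rewrite ?mem_head // => t; rewrite inE => /orP[/eqP->//|/hz].
  exact: le_trans.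
exists z; first by rewrite inE zs orbT.
by move=> t; rewrite inE => /orP[/eqP->|/hz//]; apply: ltW.
Qed.

Section Digits.
Variable K : fieldType.
Implicit Types (f g q a w : {poly K}) (c : nat -> {poly K}) (i j n : nat).

Definition dig q f j : {poly K} := iter j (fun g => g %/ q) f %% q.

Lemma size_divpF f q : q != 0 -> size (f %/ q) = (size f - (size q).-1)%N.
Proof. exact: size_divp. Qed.

Lemma iter_divpD q f g j : iter j (fun g => g %/ q) (f + g) =
  iter j (fun g => g %/ q) f + iter j (fun g => g %/ q) g.
Proof. by elim: j => // j /= ->; rewrite divpD. Qed.

Lemma digD q f g j : dig q (f + g) j = dig q f j + dig q g j.
Proof. by rewrite /dig iter_divpD modpD. Qed.

Lemma digS q f j : dig q f j.+1 = dig q (f %/ q) j.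
Proof. by rewrite /dig iterSr. Qed.

Lemma dig0 q j : dig q 0 j = 0.
Proof. by elim: j => [|j IH]; rewrite ?digS ?div0p // /dig /= mod0p. Qed.

Lemma digN q f j : dig q (- f) j = - dig q f j.
Proof. by apply/eqP; rewrite -addr_eq0 -digD addNr dig0. Qed.

Lemma dig_sum q (I : Type) (r : seq I) (P : pred I) (F : I -> {poly K}) j :
  dig q (\sum_(i <- r | P i) F i) j = \sum_(i <- r | P i) dig q (F i) j.
Proof. by apply: (big_morph (fun f => dig q f j)) => [x y|]; rewrite ?digD ?dig0. Qed.

Lemma size_dig q f j : q != 0 -> (size (dig q f j) < size q)%N.
Proof. by move=> q0; rewrite /dig ltn_modp. Qed.

Lemma dig_small q f j : (size f < size q)%N ->
  dig q f j = if j is 0%N then f else 0.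
Proof.
move=> s; case: j => [|j]; first by rewrite /dig /= modp_small.
by rewrite digS divp_small ?dig0.
Qed.

Lemma dig_mulq q f j : q != 0 ->
  dig q (f * q) j = if j is j'.+1 then dig q f j' else 0.
Proof.
by move=> q0; case: j => [|j]; rewrite ?digS ?mulpK // /dig /= modp_mull.
Qed.

Lemma dig_mulqX q f n j : q != 0 ->
  dig q (f * q ^+ n) j = if (n <= j)%N then dig q f (j - n) else 0.
Proof.
move=> q0; elim: n j => [|n IH] j; first by rewrite mulr1 subn0.
rewrite exprSr mulrA dig_mulq //; case: j => // j; rewrite IH //.
Qed.

Lemma dig_iter q f i : f = \sum_(j < i) dig q f j * q ^+ j +
  iter i (fun g => g %/ q) f * q ^+ i.
Proof.
elim: i => [|i IH]; first by rewrite big_ord0 add0r mulr1.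
rewrite {1}IH big_ord_recr /= -addrA; congr (_ + _).
by rewrite {1}(divp_eq (iter i _ f) q) mulrDl exprS mulrA addrC.
Qed.

Lemma dig_iterD q f i j : dig q (iter i (fun g => g %/ q) f) j = dig q f (j + i).
Proof. by rewrite /dig iterD. Qed.

Lemma size_iter_divp q f i : q != 0 ->
  size (iter i (fun g => g %/ q) f) = (size f - i * (size q).-1)%N.
Proof.
by move=> q0; elim: i => [|i IH]; rewrite ?subn0 //= size_divpF // IH mulSn addnC subnDA.
Qed.

Lemma dig_oversize q f j : q != 0 ->
  (size f <= j * (size q).-1)%N -> dig q f j = 0.
Proof.
move=> q0; rewrite -subn_eq0 => h; rewrite /dig.
have /eqP := h; rewrite -size_iter_divp // => /eqP.
by rewrite size_poly_eq0 => /eqP ->; rewrite mod0p.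
Qed.

Lemma dig_expand q f n : q != 0 -> (size f <= n * (size q).-1)%N ->
  f = \sum_(j < n) dig q f j * q ^+ j.
Proof.
move=> q0; rewrite -subn_eq0 -size_iter_divp // size_poly_eq0 => /eqP e.
by rewrite {1}(dig_iter q f n) e mul0r addr0.
Qed.

Lemma dig_expand_ex q f : (1 < size q)%N ->
  exists n, f = \sum_(j < n) dig q f j * q ^+ j /\
            forall j, (n <= j)%N -> dig q f j = 0.
Proof.
move=> s; have q0 : q != 0 by rewrite -size_poly_gt0; lia.
exists (size f); split; first by apply: dig_expand => //; nia.
by move=> j le; apply: dig_oversize => //; nia.
Qed.

Lemma dig_unique q n c j : q != 0 ->
  (forall i, (i < n)%N -> (size (c i) < size q)%N) ->
  dig q (\sum_(i < n) c i * q ^+ i) j = if (j < n)%N then c j else 0.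
Proof.
move=> q0 sc; rewrite dig_sum.
have h (i : 'I_n) : dig q (c i * q ^+ i) j = if (j == i :> nat) then c i else 0.
  rewrite dig_mulqX //; have [le|lt] := leqP.
    rewrite dig_small ?sc //; have [->|ne] := eqVneq j i; first by rewrite subnn.
    by case: (j - i)%N (subn_eq0 j i) => // /esym; lia.
  by case: eqP => // e; move: lt; rewrite e ltnn.
under eq_bigr do rewrite h.
case: ltnP => [lt|le]; last first.
  by rewrite big1 // => i _; case: eqP => // e; have := ltn_ord i; lia.
rewrite (bigD1 (Ordinal lt)) //= eqxx big1 ?addr0 // => i ne.
by case: eqP => // e; case/eqP: ne; apply: val_inj.
Qed.

Lemma dig_neq0_size q f j : (1 < size q)%N -> dig q f j != 0 ->
  (j * (size q).-1 < size f)%N.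
Proof.
move=> s; apply: contraNltn => le; apply/eqP/dig_oversize => //.
by rewrite -size_poly_gt0; lia.
Qed.

Lemma monicDl q w : q \is monic -> (size w < size q)%N ->
  q + w \is monic /\ size (q + w) = size q.
Proof.
by move=> qm s; rewrite monicE lead_coefDl // size_polyDl // -monicE.
Qed.

End Digits.

(** * Weighted truncations and strict polynomials *)

Section Weights.
Variables (K : fieldType) (Gam : ordGroupType).
Variable nu : valuation {fraction {poly K}} Gam.
Implicit Types (f g h q p a w u : {poly K}) (b c e m : Gam) (s t : bool).

Notation v := (pval nu).
Notation pge := (pge nu).
Notation pgt := (pgt nu).

Definition pcmp s b f : Prop := if s then pgt b f else pge b f.

Lemma pcmp0 s b : pcmp s b 0. Proof. by case: s => /=. Qed.
Hint Resolve pcmp0 : core.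
Lemma pcmpD s b f g : pcmp s b f -> pcmp s b g -> pcmp s b (f + g).
Proof. by case: s => /=; [apply: pgtD|apply: pgeD]. Qed.
Lemma pcmpN s b f : pcmp s b f -> pcmp s b (- f).
Proof. by case: s => /=; [apply: pgtN|apply: pgeN]. Qed.
Lemma pcmpB s b f g : pcmp s b f -> pcmp s b g -> pcmp s b (f - g).
Proof. by move=> bf /pcmpN; apply: pcmpD. Qed.
Lemma pcmp_sum s b (I : Type) (r : seq I) (P : pred I) (F : I -> {poly K}) :
  (forall i, P i -> pcmp s b (F i)) -> pcmp s b (\sum_(i <- r | P i) F i).
Proof. by move=> h; apply: (big_ind (pcmp s b)) => // x y; apply: pcmpD. Qed.
Lemma pcmpM s b c f g : pcmp s b f -> pge c g -> pcmp s (b + c) (f * g).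
Proof. by case: s => /=; [apply: pgtM|apply: pgeM]. Qed.
Lemma pcmpW s b c f : b <= c -> pcmp s c f -> pcmp s b f.
Proof. by case: s => /=; [apply: pgt_leW|apply: pgeW]. Qed.
Lemma pcmp_ge s b f : pcmp s b f -> pge b f.
Proof. by case: s => //=; apply: pgtW. Qed.
Lemma pgt_pcmp s b f : pgt b f -> pcmp s b f.
Proof. by case: s => //=; apply: pgtW. Qed.

(* The truncation of [nu] at [q] is the case [g = nu q]. *)
Definition wcmp s q (g : Gam) c f : Prop :=
  forall j, pcmp s (c - g *+ j) (dig q f j).
Notation wge := (wcmp false).
Notation wgt := (wcmp true).

Lemma wcmp0 s q b c : wcmp s q b c 0.
Proof. by move=> j; rewrite dig0. Qed.
Lemma wcmpD s q b c f g : wcmp s q b c f -> wcmp s q b c g -> wcmp s q b c (f + g).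
Proof. by move=> hf hg j; rewrite digD; apply: pcmpD. Qed.
Lemma wcmpN s q b c f : wcmp s q b c f -> wcmp s q b c (- f).
Proof. by move=> hf j; rewrite digN; apply: pcmpN. Qed.
Lemma wcmpB s q b c f g : wcmp s q b c f -> wcmp s q b c g -> wcmp s q b c (f - g).
Proof. by move=> hf /wcmpN; apply: wcmpD. Qed.
Lemma wcmp_sum s q b c (I : Type) (r : seq I) (P : pred I) (F : I -> {poly K}) :
  (forall i, P i -> wcmp s q b c (F i)) -> wcmp s q b c (\sum_(i <- r | P i) F i).
Proof.
by move=> h; apply: (big_ind (wcmp s q b c)) => // [|x y]; [apply: wcmp0|apply: wcmpD].
Qed.
Lemma wcmpW s q b c c' f : c <= c' -> wcmp s q b c' f -> wcmp s q b c f.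
Proof. by move=> le hf j; apply: pcmpW (hf j); apply: og_leD. Qed.
Lemma wcmp_ge s q b c f : wcmp s q b c f -> wge q b c f.
Proof. by move=> hf j; apply: pcmp_ge (hf j). Qed.
Lemma wge_gt q b c c' f : c < c' -> wge q b c' f -> wgt q b c f.
Proof.
move=> lt hf j; apply: pgt_ltW (hf j).
by apply: (og_shift_lt lt); zring.
Qed.

Lemma wcmp_weight s q b b' c f : b <= b' -> wcmp s q b c f -> wcmp s q b' c f.
Proof.
move=> le hf j; apply: pcmpW (hf j).
by apply: (og_shift_le (og_leMn j le)); zring.
Qed.

Lemma wcmp_small s q b c f : (size f < size q)%N ->
  wcmp s q b c f <-> pcmp s c f.
Proof.
move=> sf; split=> [/(_ 0%N)|hf j]; first by rewrite dig_small // mulr0n subr0.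
by rewrite dig_small //; case: j => //; rewrite mulr0n subr0.
Qed.

Lemma wcmp_mulqX s q b c n f : q != 0 ->
  wcmp s q b (c + b *+ n) (f * q ^+ n) <-> wcmp s q b c f.
Proof.
move=> q0; split=> [h j|h j].
  have := h (j + n)%N; rewrite dig_mulqX // leq_addl addnK.
  by congr (pcmp _ _ _); rewrite mulrnDr; zring.
rewrite dig_mulqX //; case: leqP => // le; have := h (j - n)%N.
by congr (pcmp _ _ _); rewrite -{2}(subnK le) mulrnDr; zring.
Qed.

(* In the product of two reduced polynomials the carry is strictly larger than
   the product when [q] is given the weight [b <= nu q]. *)
Record skey q b : Prop := SKey {
  skey_monic : q \is monic;
  skey_size : (1 < size q)%N;
  skey_ge : pge b q;
  skey_carry : forall f g c, (size f < size q)%N -> (size g < size q)%N ->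
    pge c (f * g) -> pgt (c - b) ((f * g) %/ q) }.

Lemma skey_neq0 q b : skey q b -> q != 0.
Proof. by case=> /monic_neq0. Qed.

Lemma skey_weight q b b' : skey q b -> b <= b' -> pge b' q -> skey q b'.
Proof.
move=> [qm sq _ qc] le ge; split=> // f g c sf sg /(qc f g c sf sg).
by apply: pgt_leW; apply: (og_shift_le le); zring.
Qed.

Section Mul.
Variables (q : {poly K}) (b : Gam).
Hypothesis sk : skey q b.

Let q0 : q != 0 := skey_neq0 sk.

(** Since [q] is worth at least its weight [b], each term of the expansion is worth at least its
    weighted value: a truncation never exceeds [nu]. *)
Lemma wcmp_pcmp s c f : wcmp s q b c f -> pcmp s c f.
Proof.
move=> h; have [n [-> _]] := dig_expand_ex f (skey_size sk).
apply: pcmp_sum => j _; rewrite -(subrK (b *+ j) c).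
by apply: pcmpM; [apply: h|apply/pgeX/(skey_ge sk)].
Qed.

Lemma skey_carry_cmp s f g c : (size f < size q)%N -> (size g < size q)%N ->
  pcmp s c (f * g) -> pgt (c - b) ((f * g) %/ q).
Proof. by move=> sf sg /pcmp_ge; apply: (skey_carry sk). Qed.

Lemma size_mul_small f g : (size f < size q)%N -> (size g < size q)%N ->
  (size ((f * g) %/ q)%R < size q)%N.
Proof.
move=> sf sg; rewrite size_divpF //.
by apply: leq_ltn_trans (leq_sub2r _ (size_polyMleq f g)) _; lia.
Qed.

Lemma skey_mod s f g c : (size f < size q)%N -> (size g < size q)%N ->
  pcmp s c (f * g) -> pcmp s c ((f * g) %% q).
Proof.
move=> sf sg h; rewrite -[X in pcmp _ _ X](addKr ((f * g) %/ q * q)) -divp_eq addrC.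
apply: pcmpB => //; apply: pgt_pcmp; rewrite -(subrK b c).
by apply: pgtM (skey_ge sk); apply: skey_carry_cmp h.
Qed.

Lemma wcmp_mul_small s f g c : (size f < size q)%N -> (size g < size q)%N ->
  pcmp s c (f * g) -> wcmp s q b c (f * g).
Proof.
move=> sf sg h [|j]; first by rewrite mulr0n subr0; apply: skey_mod.
rewrite digS dig_small ?size_mul_small //; case: j => // ; rewrite mulr1n.
by apply: pgt_pcmp; apply: skey_carry_cmp h.
Qed.

(** By bilinearity only products of two digits matter. Such a product has just two digits, its
    remainder and its carry, and strictness puts the carry above the weight it needs. *)
Lemma wcmpM s c c' f g : wcmp s q b c f -> wge q b c' g ->
  wcmp s q b (c + c') (f * g).
Proof.
have [n [ef _]] := dig_expand_ex f (skey_size sk).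
have [m [eg _]] := dig_expand_ex g (skey_size sk) => hf hg.
rewrite {1}ef {1}eg mulr_suml; apply: wcmp_sum => i _.
rewrite mulr_sumr; apply: wcmp_sum => j _.
rewrite mulrACA -exprD.
have -> : c + c' = c - b *+ i + (c' - b *+ j) + b *+ (i + j) by zring.
apply/wcmp_mulqX => //; apply: wcmp_mul_small; rewrite ?size_dig //.
exact: pcmpM (hf i) (hg j).
Qed.

Lemma wge_q : wge q b b q.
Proof.
rewrite -[q in wge _ _ _ q]mul1r -[q in 1 * q]expr1 -[X in wge _ _ X]add0r -[b in _ + b]mulr1n.
apply/wcmp_mulqX => //; apply/wcmp_small; first by rewrite size_polyC oner_eq0 (skey_size sk).
exact: pge1.
Qed.

Lemma wgeX n c f : wge q b c f -> wge q b (c *+ n) (f ^+ n).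
Proof.
move=> h; elim: n => [|n IH]; last by rewrite exprS mulrS; apply: wcmpM.
rewrite expr0 mulr0n; apply/wcmp_small; last exact: pge1.
by rewrite size_polyC oner_eq0 (skey_size sk).
Qed.

(** Cutting at the least index whose digit attains the weight makes that digit the constant one of
    [f1], as in the proof of Gauss's lemma. *)
Lemma wexact_split c f : wge q b c f -> ~ wgt q b c f ->
  exists i f0 f1, [/\ f = f0 + f1 * q ^+ i, wgt q b c f0,
    wge q b (c - b *+ i) f1 & ~ pgt (c - b *+ i) (f1 %% q)].
Proof.
move=> hf /existsNP [j0 hj0].
have ex : exists j, `[< ~ pgt (c - b *+ j) (dig q f j) >] by exists j0; apply/asboolP.
case: (ex_minnP ex) => i /asboolP ni mini.
exists i, (\sum_(j < i) dig q f j * q ^+ j), (iter i (fun g => g %/ q) f).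
split=> //; first exact: dig_iter.
- apply: wcmp_sum => j _; rewrite -(subrK (b *+ j) c); apply/wcmp_mulqX => //.
  apply/wcmp_small; first exact: size_dig.
  apply: contrapT => h; have := mini j; have /asboolP -> := h.
  by move=> /(_ isT); have := ltn_ord j; lia.
- move=> j; rewrite dig_iterD; have := hf (j + i)%N.
  by congr (pcmp _ _ _); rewrite mulrnDr; zring.
Qed.

(** Gauss's lemma for truncations. The lowest exact digits of the two factors meet in degree
    [i + j], where every other contribution is strictly larger; their product cannot be strictly
    larger because [nu] is multiplicative. *)
Lemma NwgtM c c' f g : wge q b c f -> wge q b c' g ->
  ~ wgt q b c f -> ~ wgt q b c' g -> ~ wgt q b (c + c') (f * g).
Proof.
move=> hf hg /(wexact_split hf) [i [f0 [f1 [ef hf0 hf1 nf1]]]].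
move=> /(wexact_split hg) [j [g0 [g1 [eg hg0 hg1 ng1]]]] h.
set e := (c - b *+ i) + (c' - b *+ j).
have hq : wgt q b e (f1 * g1).
  apply/(wcmp_mulqX _ _ _ (i + j) _ q0).
  have -> : e + b *+ (i + j) = c + c' by rewrite /e; zring.
  have -> : f1 * g1 * q ^+ (i + j) = f * g - f0 * g - (f - f0) * g0.
    by rewrite ef eg exprD; ring.
  apply: wcmpB; first by apply: wcmpB => //; apply: wcmpM.
  rewrite addrC mulrC; apply: wcmpM => //.
  by apply: wcmpB => //; apply: wcmp_ge hf0.
(* The constant digit of [f1 * g1] is the remainder of the product of the two constant digits. The
   carry being strictly larger too, the whole product would exceed the sum of the two values. *)
have /= := hq 0%N; rewrite mulr0n subr0 /dig /= -modp_mul mulrC -modp_mul mulrC => hm.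
have sa : (size (f1 %% q)%R < size q)%N by rewrite ltn_modp.
have sb : (size (g1 %% q)%R < size q)%N by rewrite ltn_modp.
apply: (NpgtM nf1 ng1); rewrite -/e.
have he : pge e ((f1 %% q) * (g1 %% q)).
  by apply: pgeM; [have := hf1 0%N|have := hg1 0%N]; rewrite mulr0n subr0.
rewrite [X in pgt _ X](divp_eq _ q); apply: pgtD; last by rewrite mulrC in hm *.
rewrite -(subrK b e); apply: pgtM (skey_ge sk); exact: (skey_carry sk).
Qed.

Lemma wexact_ex f : f != 0 -> exists m, wge q b m f /\ ~ wgt q b m f.
Proof.
move=> f0; have [n [ef en]] := dig_expand_ex f (skey_size sk).
pose r := [seq j <- iota 0 n | dig q f j != 0].
have r0 : r != [::].
  apply: contra f0 => /eqP r0; rewrite ef big1 // => j _.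
  have [->|nz] := eqVneq (dig q f j) 0; first by rewrite mul0r.
  have : (j : nat) \in r by rewrite mem_filter nz mem_iota /=.
  by rewrite r0.
have [j jr hj] := seq_argmin (fun j => v (dig q f j) + b *+ j) r0.
have dj : dig q f j != 0 by move: jr; rewrite mem_filter => /andP[].
exists (v (dig q f j) + b *+ j); split=> [i|/(_ j)] /=; last first.
  by rewrite addrK; apply: NpgtV.
have [->//|di] := eqVneq (dig q f i) 0.
apply/(pgeP _ _ di); have := hj i; rewrite mem_filter di mem_iota /= add0n.
have -> : (i < n)%N by rewrite ltnNge; apply: contra di => /en ->.
by move=> /(_ isT) le; apply: (og_shift_le le); zring.
Qed.

End Mul.

(** Let [t] be the carry for [q + w]. The carry for [q] equals [t] plus the carry of [t * w]. If [t]
    were too small, both carries for [q] would be strictly above [nu t], and so would their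
    difference [t]. *)
Lemma skey_shift q b w : skey q b -> (size w < size q)%N -> pge b w ->
  skey (q + w) b.
Proof.
move=> sk sw bw; have [qm sq] := monicDl (skey_monic sk) sw.
split; rewrite ?sq ?(skey_size sk) //; first by apply: pgeD => //; apply: skey_ge sk.
move=> f g c sf sg h; set p := q + w; set t := (f * g) %/ p.
have q0 := skey_neq0 sk; have st : (size t < size q)%N.
  rewrite /t size_divpF ?sq ?monic_neq0 //.
  by apply: leq_ltn_trans (leq_sub2r _ (size_polyMleq f g)) _; lia.
have e : (f * g) %/ q = t + (t * w) %/ q.
  rewrite {1}(divp_eq (f * g) p) -/t mulrDr divpD divpD mulpK //.
  by rewrite [X in _ + _ + X]divp_small ?addr0 // -sq ltn_modp monic_neq0.
apply: contrapT => /NpgtE [t0 le].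
have h1 : pgt (v t) ((f * g) %/ q).
  by apply: pgt_leW le _; apply: (skey_carry sk).
have h2 : pgt (v t) ((t * w) %/ q).
  rewrite -[X in pgt X](addrK b); apply: (skey_carry sk) => //.
  exact: pgeM.
have := pgtB h1 h2; rewrite e addrK => /pgt_val/eqP.
by rewrite (negPf t0).
Qed.

Lemma wcmp_shift s q p b c f : skey p b -> (size q <= size p)%N ->
  (1 < size q)%N -> (size (p - q)%R < size p)%N -> pge b (p - q) ->
  wcmp s q b c f -> wcmp s p b c f.
Proof.
move=> sk sq sq1 sw bw h; have [n [-> _]] := dig_expand_ex f sq1.
apply: wcmp_sum => j _; rewrite -(subrK (b *+ j) c).
apply: (wcmpM sk).
  apply/wcmp_small; last exact: h.
  by apply: leq_trans sq; apply: size_dig; rewrite -size_poly_gt0; lia.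
apply: (wgeX sk); rewrite -(subKr p q); apply: wcmpB (wge_q sk) _.
exact/wcmp_small.
Qed.

(** For strict [q] the truncation is at most [nu], so this one inequality expresses that the
    truncation of [nu] at [q] is correct on [f]. *)
Definition exact_at q f : Prop := forall c, pge c f -> wge q (v q) c f.

Lemma exact_at0 q : exact_at q 0. Proof. by move=> c _; apply: wcmp0. Qed.

Lemma exact_at_small q f : (size f < size q)%N -> exact_at q f.
Proof. by move=> sf c h; apply/wcmp_small. Qed.

Lemma exact_atP q m f : skey q (v q) -> wge q (v q) m f -> ~ wgt q (v q) m f ->
  exact_at q f <-> ~ pgt m f.
Proof.
move=> sk hm nm; have f0 : f != 0.
  by apply: contra_notN nm => /eqP ->; apply: wcmp0.
split=> [n /(pgtP _ _ f0) lt|/NpgtE [_ le] c].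
  by apply: nm; apply: wge_gt lt _; apply: n.
by move=> /(pgeP _ _ f0) lc; apply: wcmpW hm; apply: le_trans lc le.
Qed.

Lemma exact_at_cmp s q c f : exact_at q f -> pcmp s c f -> wcmp s q (v q) c f.
Proof.
move=> n; case: s => [|/n//]; have [->|f0] := eqVneq f 0; first by move=> _; apply: wcmp0.
by move=> /(pgtP _ _ f0) lt; apply: wge_gt lt (n _ _).
Qed.

Lemma Nexact_at_val q f m : skey q (v q) -> wge q (v q) m f -> ~ wgt q (v q) m f ->
  ~ exact_at q f -> pgt m f.
Proof. by move=> sk h n /(contra_not (exact_atP sk h n).2) /contrapT. Qed.

(** The truncation is multiplicative and exact on the reduced polynomial [u], so the gap between
    truncation and value survives multiplication by [u]. *)
Lemma Nexact_at_mul q f u : skey q (v q) -> (size u < size q)%N -> u != 0 ->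
  ~ exact_at q f -> ~ exact_at q (u * f).
Proof.
move=> sk su u0 nf; have f0 : f != 0 by apply: contra_notN nf => /eqP ->; apply: exact_at0.
have [m [hm nm]] := wexact_ex sk f0.
have hu : wge q (v q) (v u) u by apply/wcmp_small => //=.
have nu' : ~ wgt q (v q) (v u) u by move=> /(wcmp_small _ _ _ su) /(NpgtV u0).
have fm := Nexact_at_val sk hm nm nf.
move=> /(exact_atP sk (wcmpM sk hu hm) (NwgtM sk hu hm nu' nm)); apply.
by rewrite addrC mulrC; apply: pgtM.
Qed.

(* A polynomial whose value exceeds its [q]-truncation becomes a key polynomial
   as soon as the truncation is exact on the polynomials involved. *)
Lemma carry_of_jump q p f g c : skey q (v q) -> p \is monic -> ~ exact_at q p ->
  exact_at q f -> exact_at q g -> exact_at q ((f * g) %/ p) -> exact_at q ((f * g) %% p) ->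
  pge c (f * g) -> pgt (c - v p) ((f * g) %/ p).
Proof.
set t := _ %/ p; set r := _ %% p => sk pm np nf ng nt nr h.
have p0 := monic_neq0 pm; have [m [hm nm]] := wexact_ex sk p0.
have mp := Nexact_at_val sk hm nm np.
have {mp} mp : m < v p by apply/(pgtP _ m p0).
have [->//|t0] := eqVneq t 0; apply/(pgtP _ _ t0).
have hc : wge q (v q) c (f * g).
  have [f0|f0] := eqVneq f 0; first by rewrite f0 mul0r; apply: wcmp0.
  have [g0|g0] := eqVneq g 0; first by rewrite g0 mulr0; apply: wcmp0.
  apply: (@wcmpW _ _ _ _ (v f + v g)); last by apply: (wcmpM sk); [apply: nf|apply: ng].
  by rewrite -vM //; apply/pgeP => //; apply: mulf_neq0.
(* Here [m] is the truncated value of [p], which lies below [nu p] by the jump. Bounding [c] by the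
   truncated value of [t * p] therefore already gives the strict inequality. *)
suff le : c <= v t + m.
  by apply: (og_shift_lt (le_lt_trans le (ltr_translate (v t) mp))); zring.
apply: contrapT => /og_leNlt lt; have ht : wge q (v q) (v t) t by apply: nt.
have nt' : ~ wgt q (v q) (v t) t by move=> /(wcmp_pcmp sk) /(NpgtV t0).
apply: (NwgtM sk ht hm nt' nm).
have e : t * p = f * g - r by rewrite [f * g](divp_eq _ p) addrK.
rewrite e; apply: wcmpB; first exact: wge_gt lt _.
(* The remainder has a large value as a difference of two large terms; its exactness turns this into
   a large truncation, so [t * p] gets a truncation above [v t + m], against multiplicativity. *)
apply: (exact_at_cmp nr); have -> : r = f * g - t * p by rewrite e subKr.
by apply: pgtB; [apply: pgt_ltW lt _|apply/pgtP; rewrite ?mulf_neq0 // vM // ltr_translate].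
Qed.

Lemma skey_modX q b a n : skey q b -> (size a < size q)%N -> a != 0 ->
  (a ^+ n) %% q != 0 /\ v ((a ^+ n) %% q) = v a *+ n.
Proof.
move=> sk sa a0; have q0 := skey_neq0 sk; elim: n => [|n [r0 vr]].
  rewrite expr0 mulr0n modp_small ?size_polyC ?oner_eq0 ?(skey_size sk) //.
  by rewrite v1.
rewrite exprS mulrS -modp_mul; set r := (a ^+ n) %% q in r0 vr *.
have sr : (size r < size q)%N by rewrite ltn_modp.
have -> : (a * r) %% q = a * r - (a * r) %/ q * q by rewrite {2}(divp_eq (a * r) q); ring.
rewrite -vr -vM //; apply: v_dom; rewrite ?mulf_neq0 //; apply: pgtN.
rewrite -(subrK b (v _)); apply: pgtM (skey_ge sk).
exact: (skey_carry sk).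
Qed.

End Weights.

Section DigitsMore.
Variable K : fieldType.
Implicit Types (f g q u w : {poly K}).

Lemma dig_mul_small q u f j : (1 < size q)%N -> (size u < size q)%N ->
  dig q (u * f) j = (u * dig q f j) %% q +
    (if j is j'.+1 then (u * dig q f j') %/ q else 0).
Proof.
move=> sq su; have q0 : q != 0 by rewrite -size_poly_gt0; lia.
have [n [ef en]] := dig_expand_ex f sq.
have h i : dig q (u * (dig q f i * q ^+ i)) j =
    if (i == j)%N then (u * dig q f j) %% q
    else if (i.+1 == j)%N then (u * dig q f i) %/ q else 0.
  rewrite mulrA dig_mulqX //; have sd := size_dig f i q0.
  case: ltngtP => [lt|gt|->]; last by rewrite subnn /dig.
    have -> : (j - i = (j - i.+1).+1)%N by lia.
    rewrite digS dig_small; last first.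
      rewrite size_divpF //; apply: leq_ltn_trans (leq_sub2r _ (size_polyMleq _ _)) _.
      by move: su sd; lia.
    case: eqP => [->|ne]; first by rewrite subnn.
    by case e: (j - i.+1)%N => //; lia.
  by case: eqP => // e; lia.
rewrite [in LHS]ef mulr_sumr dig_sum; under eq_bigr do rewrite h.
have s1 : \sum_(i < n) (if (i == j :> nat) then (u * dig q f j) %% q else 0) =
    (u * dig q f j) %% q.
  case: (ltnP j n) => [lt|le]; last first.
    rewrite en // mulr0 mod0p big1 // => i _; by case: eqP.
  rewrite (bigD1 (Ordinal lt)) //= eqxx big1 ?addr0 // => i ne.
  by case: eqP => // e; case/eqP: ne; apply: val_inj.
rewrite -[X in _ = X + _]s1.
transitivity (\sum_(i < n) ((if (i == j :> nat) then (u * dig q f j) %% q else 0) +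
   (if (i.+1 == j)%N then (u * dig q f i) %/ q else 0))).
  apply: eq_bigr => i _; case: eqP => [e|_]; last by rewrite add0r.
  by case: eqP => [e'|]; [lia|rewrite addr0].
rewrite big_split /=; congr (_ + _).
clear h s1; case: j => [|j]; first by rewrite big1.
case: (ltnP j n) => [lt|le]; last first.
  by rewrite en // mulr0 div0p big1 // => i _; case: eqP => // e; have := ltn_ord i; lia.
rewrite (bigD1 (Ordinal lt)) //= eqxx big1 ?addr0 // => i ne.
by case: eqP => // -[e]; case/eqP: ne; apply: val_inj.
Qed.

Lemma size_low q n (c : nat -> {poly K}) : (0 < size q)%N ->
  (forall i, (i < n)%N -> (size (c i) < size q)%N) ->
  (size (\sum_(i < n) c i * q ^+ i)%R <= n * (size q).-1)%N.
Proof.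
move=> sq sc; apply: leq_trans (size_sum _ _ _) _; apply/bigmax_leqP => i _.
apply: leq_trans (size_polyMleq _ _) _; have := sc i (ltn_ord i).
have := size_poly_exp_leq q i; have := ltn_ord i; nia.
Qed.

Lemma Bezout_eq1 f g : coprimep f g -> exists u w, u * f + w * g = 1.
Proof.
move=> /Bezout_coprimepP [[u w]] /=; rewrite -size_poly_eq1 => /size_poly1P [c c0 e].
exists (c^-1 *: u), (c^-1 *: w); rewrite -!scalerAl -scalerDr e.
by rewrite -mul_polyC -polyCM mulVf.
Qed.

Lemma size_monicX q n : q \is monic -> (size (q ^+ n)).-1 = (n * (size q).-1)%N.
Proof. by move=> qm; rewrite size_exp mulnC. Qed.

Lemma size_subr_monic f g : f \is monic -> g \is monic -> size f = size g ->
  (size (f - g)%R < size f)%N.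
Proof.
move=> fm gm e; have f0 : (0 < size f)%N by rewrite size_poly_gt0 monic_neq0.
rewrite -[X in (_ < X)%N](prednK f0) ltnS; apply/leq_sizeP => j; rewrite leq_eqVlt coefB.
case/orP => [/eqP <-|lt]; last first.
  have le : (size f <= j)%N by rewrite -(prednK f0).
  by rewrite !nth_default ?subrr // -e.
move: fm gm; rewrite !monicE /lead_coef -e => /eqP-> /eqP->; exact: subrr.
Qed.

Lemma size_carry q f g : q != 0 -> (size f < size q)%N -> (size g < size q)%N ->
  (size ((f * g) %/ q)%R < size q)%N.
Proof.
move=> q0 sf sg; rewrite size_divpF //.
by apply: leq_ltn_trans (leq_sub2r _ (size_polyMleq f g)) _; lia.
Qed.

Lemma size_monic_plus q n (c : nat -> {poly K}) : q \is monic -> (1 < size q)%N ->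
  (forall j, (j < n)%N -> (size (c j) < size q)%N) ->
  q ^+ n + \sum_(j < n) c j * q ^+ j \is monic /\
  size (q ^+ n + \sum_(j < n) c j * q ^+ j) = (n * (size q).-1).+1.
Proof.
move=> qm sq sc; have q0 := monic_neq0 qm.
have sX : size (q ^+ n) = (n * (size q).-1).+1.
  by rewrite -size_monicX // prednK // size_poly_gt0 expf_neq0.
have sl := size_low (ltnW sq) sc.
have lt : (size (\sum_(j < n) c j * q ^+ j)%R < size (q ^+ n)%R)%N by rewrite sX ltnS.
by have [m1 m2] := monicDl (monic_exp _ qm) lt; rewrite m2 sX.
Qed.

Lemma modpX_shift q w n : ((q + w) ^+ n) %% q = (w ^+ n) %% q.
Proof.
elim: n => [//|n IH]; rewrite !exprS mulrDl modpD [q * _]mulrC modp_mull add0r.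
by rewrite -modp_mul IH modp_mul.
Qed.

End DigitsMore.

Section Chain.
Variables (K : fieldType) (Gam : ordGroupType).
Variable nu : valuation {fraction {poly K}} Gam.
Implicit Types (f g h u w p a : {poly K}) (b c e m : Gam) (s : bool).

Notation v := (pval nu).
Notation pge := (pge nu).
Notation pgt := (pgt nu).
Notation wcmp := (wcmp nu).
Notation wge := (wcmp false).
Notation wgt := (wcmp true).
Notation exact_at := (exact_at nu).

(** Strict polynomials are irreducible. A proper factor [d] of [q] would give the product of the
    reduced polynomials [q %/ d] and [d], whose carry is exactly 1; strictness would then say
    [nu q < b]. *)
Lemma skey_coprime q b a : skey nu q b -> (size a < size q)%N -> a != 0 ->
  coprimep a q.
Proof.
move=> sk sc a0; have q0 := skey_neq0 sk; have sq := skey_size sk.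
apply: contrapT => /negP ncop; set d := gcdp a q.
have d0 : d != 0 by rewrite gcdp_eq0 (negPf q0) andbF.
have sd : (1 < size d)%N.
  move: ncop (d0); rewrite /coprimep -/d -size_poly_gt0.
  by case: (size d) => [|[|n]].
have sdq : (size d < size q)%N by apply: leq_ltn_trans sc; apply/dvdp_leq/dvdp_gcdl.
have e : (q %/ d) * d = q by apply/divpK/dvdp_gcdr.
have s1 : (size (q %/ d)%R < size q)%N.
  rewrite size_divpF // ltn_subrL; apply/andP; split.
    by case: (size d) sd => [|[]].
  by apply: leq_trans sq.
have h := @skey_carry _ _ _ _ _ sk _ _ (v q) s1 sdq.
move: h; rewrite e divpp // => /(_ (pge_val _ _)) /pgtP.
rewrite oner_eq0 v1 => /(_ isT) lt; have /(pgeP _ _ q0) le := skey_ge sk.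
have /(le_lt_trans le) : v q < b by apply: (og_shift_lt lt); zring.
by rewrite ltxx.
Qed.

(** The inverse modulo [q] comes from Bezout. Its value is right because [u * a] differs from 1 by a
    multiple of [q] strictly above [u * a]. *)
Lemma skey_inv q b a : skey nu q b -> (size a < size q)%N -> a != 0 ->
  exists u, [/\ (size u < size q)%N, u != 0, (u * a) %% q = 1 & v u = - v a].
Proof.
move=> sk sc a0; have q0 := skey_neq0 sk; have sq := skey_size sk.
have [u [w e]] := Bezout_eq1 (skey_coprime sk sc a0).
have su : (size (u %% q)%R < size q)%N by rewrite ltn_modp.
have e1 : ((u %% q) * a) %% q = 1.
  rewrite mulrC modp_mul mulrC -[u * a](addrK (w * q)) e modpD modpN modp_mull.
  by rewrite subr0 modp_small // size_polyC oner_eq0.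
have u0 : u %% q != 0.
  by apply/eqP => z; move/eqP: e1; rewrite z mul0r mod0p eq_sym oner_eq0.
exists (u %% q); split=> //; apply: (@addIr _ (v a)); rewrite addNr -vM //.
have h := @skey_carry _ _ _ _ _ sk _ _ (v (u %% q * a)) su sc (pge_val _ _).
have [] := @v_dom _ _ nu (v (u %% q * a)) (u %% q * a) (- ((u %% q * a) %/ q * q)) _ erefl.
- by rewrite mulf_neq0.
- by apply: pgtN; rewrite -(subrK b (v _)); apply: pgtM (skey_ge sk).
- rewrite {1 3}(divp_eq (u %% q * a) q) addrAC subrr add0r e1 => _ <-.
  exact: v1.
Qed.

(** * Chains of key polynomials of the same degree *)

Section Above.
Variables (q p : {poly K}) (b : Gam).
Hypothesis skq : skey nu q b.
Hypothesis skp : skey nu p b.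
Hypothesis spq : size p = size q.
Hypothesis bpq : pge b (p - q).

Let ssub : (size (p - q)%R < size p)%N.
Proof. by apply: size_subr_monic => //; [apply: skey_monic skp|apply: skey_monic skq]. Qed.

Lemma wcmp_chg s c f : wcmp s q b c f -> wcmp s p b c f.
Proof.
by apply: (wcmp_shift skp) => //; rewrite ?spq //; apply: skey_size skq.
Qed.

Definition above r c n f : Prop :=
  wge r b c f /\ forall j, (n <= j)%N -> pgt (c - b *+ j) (dig r f j).

(** The first [n] terms have degree below [n] times the common degree, so they contribute no
    [p]-digit of index at least [n]; all the other terms are strictly above the weight. *)
Lemma above_chg c n f : above q c n f -> above p c n f.
Proof.
move=> [h hn]; split=> [|j le]; first exact: wcmp_chg.
have q0 := skey_neq0 skq; have p0 := skey_neq0 skp; have sq := skey_size skq.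
pose f0 := \sum_(i < n) dig q f i * q ^+ i.
have hf : wgt q b c (f - f0).
  move=> i; rewrite digD digN dig_unique => // [|k _]; last exact: size_dig.
  by case: ltnP => [lt|/hn]; rewrite ?subrr ?subr0 //; apply: pgt0.
have -> : f = f - f0 + f0 by rewrite subrK.
rewrite digD [dig _ f0 _]dig_oversize ?addr0 //; first exact: (wcmp_chg hf j).
rewrite spq; apply: leq_trans (_ : n * (size q).-1 <= _)%N; last by rewrite leq_mul2r le orbT.
by apply: size_low => [|i _]; [lia|apply: size_dig].
Qed.

End Above.

Record chain (q : nat -> {poly K}) : Prop := Chain {
  chain_skey : forall t, skey nu (q t) (v (q t));
  chain_size : forall t t', size (q t) = size (q t');
  chain_lt : forall t, v (q t) < v (q t.+1) }.

Section InChain.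
Variable q : nat -> {poly K}.
Hypothesis ch : chain q.

Let sk t := chain_skey ch t.
Let q0 t : q t != 0 := skey_neq0 (sk t).
Let sq t : (1 < size (q t))%N := skey_size (sk t).

Lemma chain_ltn t t' : (t < t')%N -> v (q t) < v (q t').
Proof.
elim: t' => // t' IH; rewrite ltnS leq_eqVlt => /orP[/eqP->|/IH lt].
  exact: chain_lt.
exact: lt_trans lt (chain_lt ch t').
Qed.

Lemma chain_le t t' : (t <= t')%N -> v (q t) <= v (q t').
Proof. by rewrite leq_eqVlt => /orP[/eqP->//|/chain_ltn/ltW]. Qed.

Lemma chain_ssub t t' : (size (q t' - q t)%R < size (q t))%N.
Proof.
rewrite (chain_size ch t t'); apply: size_subr_monic; first exact: skey_monic (sk _).
  exact: skey_monic (sk _).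
exact: (chain_size ch).
Qed.

Lemma chain_gap t t' : (t < t')%N -> q t' - q t != 0 /\ v (q t' - q t) = v (q t).
Proof.
move=> lt; rewrite addrC -(vN _ (q t)); apply: v_dom; rewrite ?oppr_eq0 //.
by rewrite vN; apply/pgtP => //; apply: chain_ltn.
Qed.

Lemma chain_pge_sub t t' : (t <= t')%N -> pge (v (q t)) (q t' - q t).
Proof.
rewrite leq_eqVlt => /orP[/eqP->|/chain_gap [_ <-] //]; rewrite subrr; exact: pge0.
Qed.

Lemma chain_skey_weight t t' : (t <= t')%N -> skey nu (q t') (v (q t)).
Proof.
move=> le; rewrite -[q t'](subrK (q t)) addrC.
by apply: skey_shift (sk t) (chain_ssub _ _) (chain_pge_sub le).
Qed.

(** Two members of the chain differ by a reduced polynomial worth at least the lower value, so the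
    expansions can be converted into one another as long as the weight stays at that lower value. *)
Lemma chain_wcmp s t t' c f : (t <= t')%N ->
  wcmp s (q t) (v (q t)) c f <-> wcmp s (q t') (v (q t)) c f.
Proof.
move=> le; split.
  exact: wcmp_chg (sk t) (chain_skey_weight le) (chain_size ch _ _) (chain_pge_sub le) _ _ _.
apply: wcmp_chg (chain_skey_weight le) (sk t) (chain_size ch _ _) _ _ _ _.
by rewrite -opprB; apply/pgeN/chain_pge_sub.
Qed.

Lemma chain_wcmp_mono s t t' c f : (t <= t')%N ->
  wcmp s (q t) (v (q t)) c f -> wcmp s (q t') (v (q t')) c f.
Proof. by move=> le /(chain_wcmp _ _ _ le); apply/wcmp_weight/chain_le. Qed.

Lemma chain_exact_at t t' f : (t <= t')%N -> exact_at (q t) f -> exact_at (q t') f.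
Proof. by move=> le h c /h; apply: chain_wcmp_mono. Qed.

(** A jump bounds the values of the chain. Were [v (q t)] larger, every term of positive index would
    be worth at least [v f], hence also the constant one, by subtraction, and [q t] would be exact
    on [f]. *)
Lemma jump_bound f c t : ~ exact_at (q t) f -> wge (q 0%N) (v (q 0%N)) c f ->
  v (q t) < v f - c + v (q 0%N).
Proof.
move=> nf /(chain_wcmp _ _ _ (leq0n t)) h; apply: og_leNlt => le; apply: nf => e he.
have [->|f0] := eqVneq f 0; first exact: wcmp0.
apply: (@wcmpW _ _ _ _ _ _ _ (v f)); first exact/pgeP.
have d1 j : (0 < j)%N -> pge (v f - v (q t) *+ j) (dig (q t) f j).
  move=> j0; apply: pgeW (h j).
  have := og_leMnn j0 (_ : 0 <= v (q t) - v (q 0%N)).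
  have l0 := chain_le (leq0n t); move=> /(_ (og_shift_le l0 _)).
  move=> /(_ (_ : _ = _)) -/(_ ltac:(zring)) l1.
  apply: (og_shift_le (og_leD le l1)); rewrite mulr1n; zring.
case=> [|j]; last exact: d1.
have e0 : dig (q t) f 0 = f - (f %/ q t) * q t by rewrite /dig /= {2}(divp_eq f (q t)); ring.
rewrite /= e0 mulr0n subr0; apply: pgeB => //.
have : wge (q t) (v (q t)) (v f - v (q t)) (f %/ q t).
  move=> j; rewrite -digS; have := d1 j.+1 isT; congr (pge _ _); zring.
move=> /(wcmp_pcmp (sk t)) /= /pgeM - /(_ (v (q t)) (q t) (pge_val _ _)).
by rewrite subrK.
Qed.

End InChain.
End Chain.

(** * The shape of a limit key polynomial *)

Section LimitPolynomial.
Variables (K : fieldType) (Gam : ordGroupType).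
Variable nu : valuation {fraction {poly K}} Gam.
Implicit Types (f g h u w p a : {poly K}) (b c e m : Gam) (s : bool).

Notation v := (pval nu).
Notation pge := (pge nu).
Notation pgt := (pgt nu).
Notation wcmp := (wcmp nu).
Notation wge := (wcmp false).
Notation wgt := (wcmp true).
Notation exact_at := (exact_at nu).
Notation above := (above nu).

(* [d] is the degree of the initial form of [f] with respect to the weight [b]. *)
Definition top p b m d f : Prop :=
  above b p m d.+1 f /\ ~ pgt (m - b *+ d) (dig p f d).

Lemma above_succ p b m d f : above b p m d.+1 f ->
  pgt (m - b *+ d) (dig p f d) -> above b p m d f.
Proof.
move=> [h hn] hd; split=> // j; rewrite leq_eqVlt => /orP[/eqP<-//|].
exact: hn.
Qed.

Lemma top_ex p b f : skey nu p b -> f != 0 -> exists m d, top p b m d f.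
Proof.
move=> sk f0; have [m [hm nm]] := wexact_ex sk f0.
have [n [_ en]] := dig_expand_ex f (skey_size sk).
exists m; have : above b p m n f.
  by split=> // j /en ->; apply: pgt0.
elim: n {en} => [[_ h]|n IH h]; first by case: nm => j; apply: h.
have [hd|hd] := EM (pgt (m - b *+ n) (dig p f n)); last by exists n.
by apply: IH; apply: above_succ h hd.
Qed.

Lemma top_neq0 p b m d f : top p b m d f -> dig p f d != 0.
Proof. by case=> _; apply: contra_notN => /eqP ->; apply: pgt0. Qed.

Lemma top_val p b m d f : top p b m d f -> m = v (dig p f d) + b *+ d.
Proof.
by move=> [[h _] nd]; have [_ ->] := v_exact (h d) nd; rewrite subrK.
Qed.

Lemma top_wexact p b m d f : top p b m d f -> wge p b m f /\ ~ wgt p b m f.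
Proof. by move=> [[h _] nd]; split=> // /(_ d). Qed.

Lemma top_chg q p b m d f : skey nu q b -> skey nu p b -> size p = size q ->
  pge b (p - q) -> top q b m d f -> top p b m d f.
Proof.
move=> skq skp spq bpq [ab nd]; split; first exact: above_chg ab.
move=> hd; apply: nd; have hp : above b p m d f.
  by apply: above_succ hd; apply: above_chg ab.
have [_] : above b q m d f.
  by apply: above_chg hp; rewrite // -opprB; apply: pgeN.
by apply.
Qed.

Variable q : nat -> {poly K}.
Hypothesis ch : chain nu q.

Let sk t := chain_skey ch t.
Let q0 t : q t != 0 := skey_neq0 (sk t).
Let sq t : (1 < size (q t))%N := skey_size (sk t).
Let bt t : Gam := v (q t).
Let qm t : q t \is monic := skey_monic (sk t).

Lemma top_chain t t' m d f : (t <= t')%N ->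
  top (q t) (bt t) m d f -> top (q t') (bt t) m d f.
Proof.
move=> le; apply: top_chg (sk t) (chain_skey_weight ch le) (chain_size ch _ _) _.
exact: chain_pge_sub.
Qed.

(** The Newton polygon argument: at a common key polynomial, raising the weight penalises high
    indices, so the last index attaining the minimum can only move down. *)
Lemma top_decr t t' m d m' d' f : (t <= t')%N ->
  top (q t) (bt t) m d f -> top (q t') (bt t') m' d' f -> (d' <= d)%N.
Proof.
move=> le h h'; have {}h := top_chain le h; have [[hm hd] _] := h.
rewrite leqNgt; apply/negP => ld; have [[hm' _] _] := h'.
have l1 := (pgtP _ _ (top_neq0 h')).1 (hd _ ld).
have l2 := (pgeP _ _ (top_neq0 h)).1 (hm' d).
have := og_ltD l1 l2; rewrite {1}(top_val h) {1}(top_val h') => lt.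
have [k e] : exists k, d' = (k + d)%N by exists (d' - d)%N; rewrite subnK // ltnW.
have : bt t' *+ k < bt t *+ k by apply: (og_shift_lt lt); rewrite e; zring.
by move=> /lt_le_trans /(_ (og_leMn _ (chain_le ch le))); rewrite ltxx.
Qed.

Lemma top_stable f : f != 0 -> exists t0 m d,
  forall t, (t0 <= t)%N -> top (q t) (bt t0) m d f /\
    top (q t) (bt t) (m - bt t0 *+ d + bt t *+ d) d f.
Proof.
move=> f0; have ex : exists d, `[< exists t m, top (q t) (bt t) m d f >].
  by have [m [d h]] := top_ex (sk 0%N) f0; exists d; apply/asboolP; exists 0%N, m.
case: (ex_minnP ex) => d /asboolP [t0 [m h]] mind; exists t0, m, d => t le.
have h1 := top_chain le h; split=> //.
have [m' [d' h']] := top_ex (sk t) f0.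
have e : d' = d.
  apply/eqP; rewrite eqn_leq (top_decr le h h') mind //.
  by apply/asboolP; exists t, m'.
by move: h'; rewrite e => h'; rewrite {1}(top_val h1) addrK -(top_val h').
Qed.

(** Late increments, even multiplied by [n], stay below any chosen earlier gap; [bounded_slow]
    supplies this from boundedness and rank one. *)
Hypothesis slow : forall n t0, exists2 t, (t0 < t)%N &
  forall t', (t <= t')%N -> (bt t' - bt t) *+ n < bt t0.+1 - bt t0.

Variable f : {poly K}.
Hypothesis fm : f \is monic.
Hypothesis fj : forall t, ~ exact_at (q t) f.
Hypothesis fmin : forall g, g \is monic -> (forall t, ~ exact_at (q t) g) ->
  (size f <= size g)%N.

Section Approximation.
Variables (t0 d t : nat) (m : Gam).
Hypothesis tops : forall t, (t0 <= t)%N -> top (q t) (bt t0) m d f /\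
    top (q t) (bt t) (m - bt t0 *+ d + bt t *+ d) d f.
Hypothesis lt0 : (t0 < t)%N.
Hypothesis ht : forall t', (t <= t')%N -> (bt t' - bt t) *+ d < bt t0.+1 - bt t0.

(* Normalising by an approximate inverse [u] of the coefficient carrying the
   truncated value and dropping the terms of higher degree keeps every jump, by
   the gap [nu (q t0.+1) - nu (q t0)] that separates those terms. *)
Lemma approximation : exists2 g, g \is monic /\ size g = (d * (size (q t)).-1).+1 &
  forall t', ~ exact_at (q t') g.
Proof.
have [T0 T1] := tops (ltnW lt0); have [[hm0 hd0] _] := T0; have [[hm1 hd1] _] := T1.
have b0t : bt t0.+1 <= bt t by apply: (chain_le ch).
have skw := chain_skey_weight ch (ltnW lt0); rewrite -/(bt t0) in skw.
pose a := dig (q t) f d; have a0 : a != 0 := top_neq0 T0.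
have sa : (size a < size (q t))%N by apply: size_dig.
have va : v a = m - bt t0 *+ d by rewrite (top_val T0) addrK.
have [u [su u0 ua vu]] := skey_inv (sk t) sa a0.
pose F := u * f; pose c j := dig (q t) F j.
have sc j : (size (c j) < size (q t))%N by apply: size_dig.
pose g := q t ^+ d + \sum_(j < d) c j * q t ^+ j.
have [gm gs] : g \is monic /\ size g = (d * (size (q t)).-1).+1.
  by apply: size_monic_plus => // j _; apply: sc.
have deg_at j : dig (q t) g j = if (j < d)%N then c j else if j == d then 1 else 0.
  pose c' i := if (i < d)%N then c i else 1.
  have s' i : (size (c' i) < size (q t))%N.
    by rewrite /c'; case: ifP => // _; rewrite size_polyC oner_eq0.
  have -> : g = \sum_(i < d.+1) c' i * q t ^+ i.
    rewrite big_ord_recr /= /c' ltnn mul1r addrC; congr (_ + _).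
    by apply: eq_bigr => i _; rewrite ltn_ord.
  by rewrite dig_unique // ltnS leq_eqVlt /c'; case: ltngtP.
have uc e j : pge e (dig (q t) f j) -> pge (e - (m - bt t0 *+ d)) (u * dig (q t) f j).
  by move=> h; rewrite -va -vu addrC; apply: pgeM.
have w0 j : pge (bt t0 *+ d - bt t0 *+ j) (u * dig (q t) f j).
  by have := uc _ j (hm0 j); congr (pge _ _); zring.
have carry e j : pge e (u * dig (q t) f j) -> pge (e - bt t0) ((u * dig (q t) f j) %/ q t).
  by move=> h; apply/pgtW/(skey_carry skw) => //; apply: size_dig.
have modc e j : pge e (u * dig (q t) f j) -> pge e ((u * dig (q t) f j) %% q t).
  by move=> h; apply: (skey_mod skw (s := false)) => //; apply: size_dig.
(* Passing from weight [bt t0] to [bt t] raises the term of index [j] over that of index [d] by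
   [j - d] times [bt t - bt t0], hence by at least the fixed gap. *)
have gap j : (d < j)%N -> bt t *+ d + (bt t0.+1 - bt t0) - bt t *+ j <= bt t0 *+ d - bt t0 *+ j.
  move=> ld; have pos : 0 <= bt t - bt t0.
    by have l0 := chain_le ch (ltnW lt0); apply: (og_shift_le l0); zring.
  have [k e] : exists k, j = (k.+1 + d)%N by exists (j - d.+1)%N; lia.
  have := og_leMnn (ltn0Sn k) pos; rewrite mulr1n => l1.
  by apply: (og_shift_le (og_leD b0t l1)); rewrite e; zring.
(* Below [d] the digits of [F] and [g] coincide. Above [d] the gap applies. At [d] the remainder of
   [u * a] is 1, and only the carry coming from index [d - 1] is left. *)
have hG : wge (q t) (bt t) (bt t *+ d + (bt t0.+1 - bt t0)) (F - g).
  move=> j; rewrite /= digD digN deg_at; case: (ltngtP j d) => [_|gt|->].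
  - by rewrite subrr; apply: pge0.
  - rewrite subr0 dig_mul_small //; apply: pgeW (gap j gt) _; apply: pgeD.
      exact/modc/w0.
    case: j gt => [|j _]; first by [].
    by have := carry _ j (w0 j); congr (pge _ _); zring.
  - rewrite dig_mul_small // -/a ua [1 + _]addrC addrK.
    case ed: d hm1 => [|d'] hm1'; first exact: pge0.
    have := carry _ d' (uc _ _ (hm1' d')); apply: pgeW.
    by apply: (og_shift_le b0t); rewrite ?ed; zring.
exists g => // t'; suff big (k : nat) : (t <= k)%N -> ~ exact_at (q k) g.
  have [le|/ltnW le] := leqP t t'; first exact: big.
  by move=> /(chain_exact_at ch le); apply: big.
move: k => s ls gj; have ls0 := leq_trans (ltnW lt0) ls.
have hGs := chain_wcmp_mono ch ls hG; rewrite -/(bt s) in hGs.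
have lt1 : bt s *+ d < bt t *+ d + (bt t0.+1 - bt t0).
  by apply: (og_shift_lt (ht ls)); zring.
have [T2 T3] := tops ls0; have [e1 e2] := top_wexact T3.
have ssu : (size u < size (q s))%N by rewrite (chain_size ch s t).
have hu : wge (q s) (bt s) (v u) u by apply/wcmp_small => //=.
have nu' : ~ wgt (q s) (bt s) (v u) u by move=> /(wcmp_small _ _ _ _ ssu) /(NpgtV u0).
(* After normalisation the truncated value of [F] at stage [s] is that of the pure power, and [lt1]
   keeps the error [F - g] strictly above it. *)
have eF : v u + (m - bt t0 *+ d + bt s *+ d) = bt s *+ d by rewrite vu va; zring.
have F1 := wcmpM (sk s) hu e1; rewrite -/(bt s) eF in F1.
have F2 := NwgtM (sk s) hu e1 nu' e2; rewrite -/(bt s) eF in F2.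
have F3 := Nexact_at_val (sk s) F1 F2 (Nexact_at_mul (sk s) ssu u0 (@fj s)).
have G1 : wgt (q s) (bt s) (bt s *+ d) (F - g) by apply: wge_gt hGs.
have G2 : pgt (bt s *+ d) (F - g) by apply: (wcmp_pcmp (sk s) G1).
have g1 : pgt (bt s *+ d) g by rewrite -[g](subKr F); apply: pgtB.
(* Since [F] jumps, both [F] and [g] have value above [bt s *+ d]. Exactness of [g] would raise its
   truncation above this bound, and with [G1] that of [F]. *)
apply: F2; rewrite -/F -(subrK g F); apply: wcmpD G1 _.
exact: (exact_at_cmp (s := true) gj).
Qed.

End Approximation.

(** Minimality of [f] against the approximation bounds the degree above, and the nonzero digit of
    index [d] bounds it below. The remaining claims come from comparing [f] with the [d]-th power of
    a later member of the chain. *)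
Lemma limit_polynomial : exists d, size f = (d * (size (q 0%N)).-1).+1 /\
  forall t, [/\ dig (q t) f d = 1, wge (q t) (bt t) (bt t *+ d) f,
    dig (q t) f 0 != 0 & v (dig (q t) f 0) = bt t *+ d].
Proof.
have f0 : f != 0 := monic_neq0 fm.
have [t0 [m [d tops]]] := top_stable f0.
have [t lt0 ht] := slow d t0; have [T0 T1] := tops _ (ltnW lt0).
have [g [gm gs] gj] := approximation tops lt0 ht.
have sf : size f = (d * (size (q 0%N)).-1).+1.
  apply/eqP; rewrite (chain_size ch 0 t) -gs eqn_leq fmin // gs.
  exact: dig_neq0_size (top_neq0 T0).
have dd (s : nat) : dig (q s) f d = 1.
  have sX : size (q s ^+ d) = size f.
    by rewrite sf (chain_size ch 0 s) -size_monicX // prednK // size_poly_gt0 expf_neq0.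
  have l : (size (f - q s ^+ d)%R <= d * (size (q s)).-1)%N.
    rewrite -ltnS (chain_size ch s 0) -sf.
    by apply: size_subr_monic; rewrite ?monic_exp.
  rewrite -[f](subrK (q s ^+ d)) digD dig_oversize // add0r -[_ ^+ d]mul1r.
  by rewrite dig_mulqX // leqnn subnn /dig /= modp_small // size_polyC oner_eq0.
(* The index [s'.+1] is past stabilisation and strictly after [s], so that [q s'.+1 - q s] has value
   exactly [bt s]. *)
exists d; split=> // s; pose s' := maxn s t0.
have [_ T3] := tops s'.+1 (leqW (leq_maxr _ _)).
have lss : (s < s'.+1)%N by rewrite ltnS leq_maxl.
have [w0 vw] := chain_gap ch lss; set w := q s'.+1 - q s in w0 vw.
have lt := chain_ltn ch lss; rewrite -/(bt s) -/(bt s'.+1) in lt vw.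
have skw := chain_skey_weight ch (ltnW lss); rewrite -/(bt s) in skw.
have [[hm hd] _] := T3.
move: hm; rewrite {1}(top_val T3) dd v1 add0r => hm.
(* In the expansion at [q s'.+1] the leading terms cancel, and lower digits satisfy bounds for the
   weight [bt s'.+1], which become strict for the smaller weight [bt s]. *)
have hR : wgt (q s) (bt s) (bt s *+ d) (f - q s'.+1 ^+ d).
  apply/(chain_wcmp ch _ _ _ (ltnW lss)) => j; rewrite -/(bt s) digD digN.
  have -> : dig (q s'.+1) (q s'.+1 ^+ d) j = if j == d then 1 else 0.
    rewrite -[_ ^+ d]mul1r dig_mulqX // [j == d]eq_sym.
    case: ltngtP => // [gt|->]; last by rewrite subnn /dig /= modp_small // size_polyC oner_eq0.
    have -> : (j - d = (j - d.+1).+1)%N by lia.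
    by rewrite dig_small ?size_polyC ?oner_eq0.
  case: (ltngtP j d) => [ld|gd|->]; last by rewrite dd [1 - 1]subrr; apply: pcmp0.
    rewrite subr0; apply: pgt_ltW (hm j).
    have [k e] : exists k, d = (k.+1 + j)%N by exists (d - j.+1)%N; lia.
    by apply: (og_shift_lt (og_ltMn (ltn0Sn k) lt)); rewrite e; zring.
  rewrite subr0 [dig _ _ _]dig_oversize //; first exact: pcmp0.
  by rewrite sf (chain_size ch s'.+1 0) ltn_pmul2r // -subn1 subn_gt0.
have hX : wge (q s) (bt s) (bt s *+ d) (q s'.+1 ^+ d).
  apply/(chain_wcmp ch _ _ _ (ltnW lss)); apply: (wgeX skw).
  exact: wge_q.
have sw : (size w < size (q s))%N by apply: (chain_ssub ch).
have [x0 vx] := skey_modX d (sk s) sw w0; rewrite vw in vx.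
(* Modulo [q s] the power of [q s'.+1 = q s + w] reduces to that of [w], whose value is [d] times
   [bt s] by strictness; the other summand is larger. *)
have e0 : dig (q s) f 0 = w ^+ d %% q s + dig (q s) (f - q s'.+1 ^+ d) 0.
  rewrite -modpX_shift [q s + w]addrC /w subrK.
  by rewrite [_ + dig _ _ _]addrC -[_ ^+ d %% _]/(dig (q s) (q s'.+1 ^+ d) 0) -digD subrK.
have h0 := hR 0%N; rewrite mulr0n subr0 in h0; have [n0 vn] := v_dom x0 vx h0.
by rewrite e0; split=> //; rewrite -[f](subrK (q s'.+1 ^+ d)); apply: wcmpD hX; apply: wcmp_ge hR.
Qed.

End LimitPolynomial.

(** * Rank one *)

Section RankOne.
Variable G : ordGroupType.
Variable A : set G.
Hypothesis A0 : A 0.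
Hypothesis AB : forall a b, A a -> A b -> A (a - b).

Lemma subgroupN a : A a -> A (- a).
Proof. by move=> /(AB A0); rewrite sub0r. Qed.

Lemma subgroupD a b : A a -> A b -> A (a + b).
Proof. by move=> ha /subgroupN; rewrite -[b in X in _ -> X]opprK; apply: AB. Qed.

Lemma subgroupMn a n : A a -> A (a *+ n).
Proof.
by move=> ha; elim: n => [|n IH]; rewrite ?mulr0n // mulrS; apply: subgroupD.
Qed.

Notation hull := (in_hull A).

Lemma hull_sub a : A a -> hull a.
Proof. by exists 1%N. Qed.

Lemma hullD a b : hull a -> hull b -> hull (a + b).
Proof.
move=> [n n0 ha] [m m0 hb]; exists (n * m)%N; first by rewrite muln_gt0 n0.
rewrite mulrnDl mulrnA; apply: subgroupD; first exact: subgroupMn.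
by rewrite mulnC mulrnA; apply: subgroupMn.
Qed.

Lemma hullN a : hull a -> hull (- a).
Proof. by move=> [n n0 ha]; exists n => //; rewrite mulNrn; apply: subgroupN. Qed.

Lemma hullB a b : hull a -> hull b -> hull (a - b).
Proof. by move=> ha /hullN; apply: hullD. Qed.

Lemma hullMn a n : hull a -> hull (a *+ n).
Proof.
move=> [m m0 ha]; exists m => //; rewrite -mulrnA mulnC mulrnA; exact: subgroupMn.
Qed.

Lemma hull_div a n : (0 < n)%N -> hull (a *+ n) -> hull a.
Proof.
move=> n0 [m m0 ha]; exists (n * m)%N; first by rewrite muln_gt0 n0.
by rewrite mulrnA.
Qed.

Hypothesis A1 : rank_one A.

(** The elements bounded in absolute value by a multiple of [a] form a convex subgroup; it contains
    [a], so by rank one it is the whole group. *)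
Lemma rank_one_arch a b : A a -> 0 < a -> A b -> exists n, b <= a *+ n.
Proof.
move=> ha a0 hb; pose H := [set x | A x /\ exists n, x <= a *+ n /\ - x <= a *+ n].
have cH : convex_subgroup A H.
  split=> [x []//| | x y [hx [n [n1 n2]]] [hy [m [m1 m2]]] | x y [hx [n [n1 n2]]] hy y0 yx].
  - by split=> //; exists 0%N; rewrite oppr0 mulr0n lexx.
  - split; first exact: AB.
    exists (n + m)%N; rewrite mulrnDr; split; first exact: og_leD.
    by rewrite opprB addrC; apply: og_leD.
  - split=> //; exists n; split; first exact: le_trans yx n1.
    apply: (@le_trans _ _ 0); first by apply: (og_shift_le y0); zring.
    by rewrite -(mulr0n a); apply: og_leMnn => //; apply: ltW.
have [eq|eq] := A1.2 _ cH.
  have : H a.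
    split=> //; exists 1%N; rewrite mulr1n lexx; split=> //.
    by apply: (@le_trans _ _ 0); [apply: (og_shift_le (ltW a0)); zring|apply: ltW].
  by rewrite eq => /= e; move: a0; rewrite e ltxx.
have : H b by rewrite eq.
by move=> [_ [n [le _]]]; exists n.
Qed.

Lemma hull_arch a b : hull a -> 0 < a -> hull b -> exists n, b <= a *+ n.
Proof.
move=> [n n0 ha] a0 [m m0 hb].
have [le|lt] := og_leP b 0; first by exists 0%N; rewrite mulr0n.
have an0 : 0 < a *+ n by rewrite -(mul0rn _ n); apply: og_ltMn.
have [k le] := rank_one_arch ha an0 hb; exists (n * k)%N.
rewrite mulrnA; apply: le_trans le; rewrite -{1}(mulr1n b).
exact/og_leMnn/ltW.
Qed.

(** Otherwise increments whose [n]-fold is at least the positive [e] recur for ever, and their sums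
    pass every element of the hull, against the bound [B / k]. *)
Lemma bounded_slow (u : nat -> G) (B : G) (k : nat) :
  (forall t, u t < u t.+1) -> (forall t, hull (u t)) -> hull B -> (0 < k)%N ->
  (forall t, u t *+ k <= B) ->
  forall n t0, exists2 t, (t0 < t)%N &
    forall t', (t <= t')%N -> (u t' - u t) *+ n < u t0.+1 - u t0.
Proof.
move=> ut hu hB k0 uB n t0; apply: contrapT => no.
set e := u t0.+1 - u t0 in no.
have e0 : 0 < e by apply: (og_shift_lt (ut t0)); rewrite /e; zring.
have he : hull e by apply: hullB.
have step t : (t0 < t)%N -> exists2 t', (t <= t')%N & e <= (u t' - u t) *+ n.
  move=> lt; apply: contrapT => no'; apply: no; exists t => // t' le.
  by apply: og_leNlt => le'; apply: no'; exists t'.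
have iter N : exists2 t, (t0 < t)%N & e *+ N <= (u t - u t0.+1) *+ n.
  elim: N => [|N [t lt le]]; first by exists t0.+1; rewrite // subrr mul0rn mulr0n.
  have [t' le' h] := step t lt; exists t'; first exact: leq_trans lt le'.
  by rewrite mulrSr; apply: (og_shift_le (og_leD le h)); zring.
have hC : hull (B *+ n - u t0.+1 *+ n *+ k) by apply: hullB; do ?apply: hullMn.
have ek0 : 0 < e *+ k by rewrite -(mul0rn _ k); apply: og_ltMn.
have [N le] := hull_arch (hullMn k he) ek0 hC.
(* [N] steps already use up the available room [B *+ n - u t0.+1 *+ n *+ k]; one step more gives the
   contradiction. *)
have [t _ h] := iter N.+1.
have l1 := og_leMn k h; have l2 := og_leMn n (uB t).
have : e *+ k <= 0 by apply: (og_shift_le (og_leD (og_leD l1 l2) le)); zring.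
by move=> /(lt_le_trans ek0); rewrite ltxx.
Qed.

End RankOne.

Section ValueGroupK.
Variables (K : fieldType) (Gam : ordGroupType).
Variable nu : valuation {fraction {poly K}} Gam.

Notation GK := (value_group_K nu).

Lemma value_group_K0 : GK 0.
Proof. by exists 1; rewrite ?oner_neq0 // /pval tofrac1 vfun1. Qed.

Lemma value_group_KB a b : GK a -> GK b -> GK (a - b).
Proof.
move=> [x x0 ->] [y y0 ->]; exists (x / y); first by rewrite mulf_neq0 ?invr_neq0.
apply: (@addIr _ (pval nu y%:P)); rewrite subrK -vM ?polyC_eq0 ?mulf_neq0 ?invr_neq0 //.
by rewrite -polyCM divfK.
Qed.

End ValueGroupK.

(** * Initial forms and their relations *)

Section Components.
Local Open Scope quotient_scope.
Variables (F : fieldType) (Gam : ordGroupType) (v : valuation F Gam).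
Implicit Types (b c e : Gam) (x y : F) (z : gr v).

(* Junk value [0] when the value of [y] is less than [b]. *)
Definition cls b y : gr v :=
  if pselect (vge v b y) is left h then grclass h else 0.

Lemma clsE b y (h : vge v b y) : cls b y = \pi_(gr v) [:: GrTerm h].
Proof.
rewrite /cls; case: pselect => // h'; apply: gr_eq => c.
by rewrite /grcoef !big_cons !big_nil.
Qed.

Lemma informE y : inform v y = cls (v y) y.
Proof. by rewrite (clsE (vge_refl v y)). Qed.

Lemma gr_piD (s t : grsum v) : \pi_(gr v) s + \pi_(gr v) t = \pi_(gr v) (gradd_sum s t).
Proof. by rewrite pi_gr_add. Qed.

Lemma gr_piM (s t : grsum v) : \pi_(gr v) s * \pi_(gr v) t = \pi_(gr v) (grmul_sum s t).
Proof. by rewrite pi_gr_mul. Qed.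

Lemma grcoef_cons (p : grterm v) (s : grsum v) c :
  grcoef (p :: s) c = (if (val p).1 == c then (val p).2 else 0) + grcoef s c.
Proof. by rewrite /grcoef big_cons; case: eqP; rewrite ?add0r. Qed.

Lemma cls_sum_pi (I : eqType) (r : seq I) (e : I -> Gam) (y : I -> F) :
  (forall i, i \in r -> vge v (e i) (y i)) ->
  exists2 s : grsum v, \pi_(gr v) s = \sum_(i <- r) cls (e i) (y i) &
    forall c, grcoef s c = \sum_(i <- r | e i == c) y i.
Proof.
elim: r => [_|i r IH h].
  exists [::] => [|c]; first by rewrite big_nil.
  by rewrite grcoef_nil big_nil.
have [j jr|s es cs] := IH; first by apply: h; rewrite inE jr orbT.
have hi := h i (mem_head _ _); exists (GrTerm hi :: s) => [|c].
  by rewrite big_cons -es (clsE hi) gr_piD.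
by rewrite grcoef_cons big_cons cs /=; case: eqP; rewrite ?add0r.
Qed.

(** Equality in the direct sum is tested degree by degree. This turns relations between initial
    forms into inequalities between values in [F]. *)
Lemma cls_sum_eq0 (I : eqType) (r : seq I) (e : I -> Gam) (y : I -> F) :
  (forall i, i \in r -> vge v (e i) (y i)) ->
  \sum_(i <- r) cls (e i) (y i) = 0 <->
  forall c, vgt v c (\sum_(i <- r | e i == c) y i).
Proof.
move=> /cls_sum_pi [s <- cs]; split=> [/eqP/grP h c|h].
  by have := h c; rewrite grcoef_nil subr0 cs.
by apply/eqP/grP => c; rewrite grcoef_nil subr0 cs.
Qed.

Lemma cls_eq0 b y : vge v b y -> cls b y = 0 <-> vgt v b y.
Proof.
move=> h; have := @cls_sum_eq0 unit [:: tt] (fun=> b) (fun=> y) (fun _ _ => h).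
rewrite big_cons big_nil addr0 => e; split=> [/e/(_ b)|hb].
  by rewrite big_cons eqxx big_nil addr0.
apply/e => c; rewrite big_cons big_nil; case: eqP => [<-|_]; first by rewrite addr0.
exact: vgt0.
Qed.

Lemma clsD b x y : vge v b x -> vge v b y -> cls b (x + y) = cls b x + cls b y.
Proof.
move=> hx hy; rewrite (clsE hx) (clsE hy) (clsE (vgeD hx hy)) gr_piD.
apply: gr_eq => c; rewrite grcoefD !grcoef_cons grcoef_nil /=.
by case: eqP; rewrite ?addr0.
Qed.

Lemma clsM b c x y : vge v b x -> vge v c y -> cls (b + c) (x * y) = cls b x * cls c y.
Proof.
move=> hx hy; rewrite (clsE hx) (clsE hy) (clsE (vgeM hx hy)) gr_piM.
by apply: gr_eq => e; rewrite /= !grcoef_cons.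
Qed.

Lemma cls0 b : cls b 0 = 0.
Proof. by apply/cls_eq0; [apply: vge0|apply: vgt0]. Qed.

Lemma cls_sum b (I : Type) (r : seq I) (P : pred I) (y : I -> F) :
  (forall i, P i -> vge v b (y i)) ->
  cls b (\sum_(i <- r | P i) y i) = \sum_(i <- r | P i) cls b (y i).
Proof.
move=> h; elim: r => [|i r IH]; first by rewrite !big_nil cls0.
rewrite !big_cons; case: ifP => // Pi; rewrite clsD ?IH //; first exact: h.
by apply: (big_ind (vge v b)) => //; [apply: vge0|move=> ? ?; apply: vgeD].
Qed.

Lemma gr_components z : exists s : seq (Gam * F),
  (forall p, p \in s -> vge v p.1 p.2) /\ z = \sum_(p <- s) cls p.1 p.2.
Proof.
elim/quotW: z => s; exists (map val s); split.
  by move=> p /mapP [q _ ->]; apply/asboolP/(valP q).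
elim: s => [|p s IH]; first by rewrite big_nil.
have -> : p :: s = gradd_sum [:: p] s by [].
have hp : vge v (val p).1 (val p).2 by apply/asboolP/(valP p).
rewrite -gr_piD IH big_cons; congr (_ + _); rewrite (clsE hp).
by apply: gr_eq => c; rewrite !grcoef_cons.
Qed.

Lemma informM x y : inform v (x * y) = inform v x * inform v y.
Proof.
have [->|x0] := eqVneq x 0; first by rewrite mul0r !informE !cls0 mul0r.
have [->|y0] := eqVneq y 0; first by rewrite mulr0 !informE !cls0 mulr0.
by rewrite !informE vfunM // clsM //; apply: vge_refl.
Qed.

Lemma inform1 : inform v 1 = 1.
Proof.
rewrite informE (clsE (vge_refl _ _)); apply: gr_eq => c.
by rewrite !grcoef_cons /= vfun1.
Qed.

Lemma inform0 : inform v 0 = 0.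
Proof. by rewrite informE cls0. Qed.

Lemma inform_neq0 x : x != 0 -> inform v x != 0.
Proof.
move=> x0; rewrite informE; apply/eqP => /(cls_eq0 (vge_refl _ _)) [/eqP|].
  by rewrite (negPf x0).
by rewrite ltxx.
Qed.

Lemma informV x : x != 0 -> inform v x * inform v x^-1 = 1.
Proof. by move=> x0; rewrite -informM divff // inform1. Qed.

Lemma informX x n : inform v (x ^+ n) = inform v x ^+ n.
Proof. by elim: n => [|n IH]; rewrite ?inform1 // !exprS informM IH. Qed.

Lemma cls_val b x : x != 0 -> vge v b x -> cls b x = if b == v x then inform v x else 0.
Proof.
move=> x0 hx; case: eqP => [->|ne]; first by rewrite informE.
apply/cls_eq0 => //; right; case: hx => [/eqP|le]; first by rewrite (negPf x0).
by rewrite lt_neqAle le andbT; apply/eqP.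
Qed.

Lemma homogeneous_inform z : homogeneous z -> z != 0 ->
  exists2 x, x != 0 & z = inform v x.
Proof.
move=> [b [y [h ->]]]; have -> : grclass h = cls b y by rewrite (clsE h).
have [->|y0] := eqVneq y 0; first by rewrite cls0 eqxx.
by rewrite cls_val //; case: ifP => [_|]; [exists y|rewrite eqxx].
Qed.

Lemma homogeneous_cls b y : homogeneous (cls b y).
Proof.
have [h|h] := EM (vge v b y); first by exists b, y, h; rewrite (clsE h).
exists b, 0, (vge0 v b); rewrite /cls; case: pselect => // _.
by rewrite -(cls0 b) (clsE (vge0 v b)).
Qed.

End Components.

Section SubringGen.
Variables (R : nzRingType) (A : set R).
Notation S := (subring_gen A).

Lemma subring_gen0 : S 0.
Proof. rewrite -(subrr 1); apply: subring_gen_sub; exact: subring_gen1. Qed.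

Lemma subring_genD x y : S x -> S y -> S (x + y).
Proof.
move=> sx sy; rewrite -[y]opprK; apply: subring_gen_sub => //.
by rewrite -sub0r; apply: subring_gen_sub => //; apply: subring_gen0.
Qed.

Lemma subring_gen_sum (I : eqType) (r : seq I) (P : pred I) (F : I -> R) :
  (forall i, i \in r -> P i -> S (F i)) -> S (\sum_(i <- r | P i) F i).
Proof.
move=> h; rewrite big_seq_cond; apply: (big_ind S) => [|x y|i /andP[]].
- exact: subring_gen0.
- exact: subring_genD.
- exact: h.
Qed.

Lemma subring_gen_prod (I : eqType) (r : seq I) (P : pred I) (F : I -> R) :
  (forall i, i \in r -> P i -> S (F i)) -> S (\prod_(i <- r | P i) F i).
Proof.
move=> h; rewrite big_seq_cond; apply: (big_ind S) => [|x y|i /andP[]].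
- exact: subring_gen1.
- exact: subring_gen_mul.
- exact: h.
Qed.

Lemma subring_genX x n : S x -> S (x ^+ n).
Proof.
move=> sx; elim: n => [|n IH]; first exact: subring_gen1.
by rewrite exprS; apply: subring_gen_mul.
Qed.

End SubringGen.

Section MonicPlus.
Variables (R : comNzRingType) (n : nat) (C : nat -> R).

Lemma monic_plus_coef j : ('X^n + \poly_(j < n) C j)`_j =
  if (j < n)%N then C j else if j == n then 1 else 0.
Proof.
by rewrite coefD coefXn coef_poly; case: ltngtP => _; rewrite ?add0r ?addr0.
Qed.

Lemma monic_plus_size : size ('X^n + \poly_(j < n) C j) = n.+1.
Proof. by rewrite size_polyDl size_polyXn // ltnS size_poly. Qed.

Lemma monic_plus_monic : 'X^n + \poly_(j < n) C j \is monic.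
Proof.
by rewrite monicE lead_coefE monic_plus_size monic_plus_coef ltnn eqxx.
Qed.

Lemma monic_plus_horner x :
  ('X^n + \poly_(j < n) C j).[x] = x ^+ n + \sum_(j < n) C j * x ^+ j.
Proof. by rewrite hornerD hornerXn horner_poly. Qed.

End MonicPlus.

Section GradedFractions.
Variables (F : fieldType) (Gam : ordGroupType) (v : valuation F Gam).
Variable A : set (gr v).
Hypothesis A1 : A 1.
Hypothesis AM : forall x y, A x -> A y -> A (x * y).

Lemma gstar_sub x : A x -> gstar A x.
Proof.
move=> ax; exists x, 1; split; last by rewrite mulr1.
split=> //; last exact: oner_neq0.
by rewrite -inform1 informE; apply: homogeneous_cls.
Qed.

(* The denominators are initial forms, hence units, so they can be cleared. *)
Lemma minimal_polynomial_gstar y p :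
  minimal_polynomial A y p -> minimal_polynomial (gstar A) y p.
Proof.
move=> [pm pA py pmin]; split=> // [j|q q0 qA qy]; first exact/gstar_sub.
have /choice [h hP] : forall j, exists h, [/\ A h, A (q`_j * h) & exists2 x, x != 0 & h = inform v x].
  move=> j; have [g [h [[ag ah hh h0] e]]] := qA j; exists h; rewrite e; split=> //.
  exact: homogeneous_inform.
pose H := \prod_(j < size q) h j.
have [x x0 Hx] : exists2 x, x != 0 & H = inform v x.
  rewrite /H; apply: (big_ind (fun z => exists2 x, x != 0 & z = inform v x)).
  - by exists 1; rewrite ?oner_neq0 // inform1.
  - by move=> _ _ [x x0 ->] [z z0 ->]; exists (x * z); rewrite ?mulf_neq0 // informM.
  - by move=> j _; have [_ _] := hP j.
have HA j : A (H * q`_j).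
  have [lt|le] := ltnP j (size q); last first.
    rewrite nth_default // mulr0; have [_ + _] := hP (size q).
    by rewrite nth_default // mul0r.
  rewrite /H (bigD1 (Ordinal lt)) //= mulrC mulrA; apply: AM; first by have [] := hP j.
  by apply: (big_ind A) => // i _; have [] := hP i.
apply: leq_trans (size_scale_leq H q); apply: pmin.
- apply: contra q0 => /eqP e; apply/eqP; have := congr1 (fun r => inform v x^-1 *: r) e.
  by rewrite scalerA Hx mulrC informV // scale1r scaler0.
- by move=> j; rewrite coefZ.
- by rewrite hornerZ qy mulr0.
Qed.

End GradedFractions.

(** * Consequences of the minimal relation of an initial form *)

Section Relation.
Variables (K : fieldType) (Gam : ordGroupType).
Variable nu : valuation {fraction {poly K}} Gam.
Variables (d : Order.disp_t) (W : bOrderType d).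
Variables (alpha : W -> nat) (Q : W -> {poly K}).
Implicit Types (f h c : {poly K}) (b e m : Gam) (E : expansion K W).

Notation v := (pval nu).
Notation pge := (pge nu).
Notation pgt := (pgt nu).
Notation wcmp := (wcmp nu).
Notation wge := (wcmp false).
Notation wgt := (wcmp true).
Notation exact_at := (exact_at nu).
Notation inp := (inp nu).

Lemma inpM f h : inp (f * h) = inp f * inp h.
Proof. by rewrite /Defs.inp tofracM informM. Qed.
Lemma inpX f n : inp (f ^+ n) = inp f ^+ n.
Proof. by rewrite /Defs.inp tofracXn informX. Qed.
Lemma inp0 : inp 0 = 0.
Proof. by rewrite /Defs.inp tofrac0 inform0. Qed.
Lemma inp1 : inp 1 = 1.
Proof. by rewrite /Defs.inp tofrac1 inform1. Qed.
Lemma inp_eq0 f : (inp f == 0) = (f == 0).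
Proof.
have [->|f0] := eqVneq f 0; first by rewrite inp0 eqxx.
by apply/negbTE/inform_neq0; rewrite tofrac_eq0.
Qed.
Lemma inp_cls f : inp f = cls nu (v f) f%:F.
Proof. exact: informE. Qed.

Lemma inp_prod (I : Type) (r : seq I) (P : pred I) (G : I -> {poly K}) :
  inp (\prod_(i <- r | P i) G i) = \prod_(i <- r | P i) inp (G i).
Proof. by apply: (big_morph inp) => [x y|]; rewrite ?inpM ?inp1. Qed.

Lemma cls_psum b (I : Type) (r : seq I) (P : pred I) (G : I -> {poly K}) :
  (forall i, P i -> pge b (G i)) ->
  cls nu b (\sum_(i <- r | P i) G i)%:F = \sum_(i <- r | P i) cls nu b (G i)%:F.
Proof.
move=> h; rewrite -cls_sum // [in RHS](_ : \sum_(i <- r | P i) _ = (\sum_(i <- r | P i) G i)%:F) //.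
by rewrite rmorph_sum.
Qed.

Lemma cls_peq0 b f : pge b f -> cls nu b f%:F = 0 <-> pgt b f.
Proof. exact: cls_eq0. Qed.

Lemma cls_pval b f : f != 0 -> pge b f -> cls nu b f%:F = if b == v f then inp f else 0.
Proof. by move=> f0; apply: cls_val; rewrite tofrac_eq0. Qed.

Lemma inp_term E g : inp (term Q E g) = inK nu (E g) * inp (mono Q g).
Proof. by rewrite -inpM mul_polyC. Qed.

(** The value of the sum is the common value of its monomials, so no cancellation occurs in that
    degree and taking initial forms is additive here. *)
Lemma homogeneous_coef L l E : homogeneous_expansion nu alpha Q L l E ->
  \sum_(g <- finsupp E) inK nu (E g) * inp (mono Q g) = inp (ev Q E).
Proof.
move=> [[_ hE] [b hb]]; have [e|ne] := eqVneq (finsupp E) fset0.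
  by rewrite /ev e !big_nil inp0.
have [ev0 [[g gE vE] _]] := hE ne; rewrite hb // in vE.
rewrite inp_cls vE /ev [in RHS]big_seq cls_psum; last by move=> i iE; rewrite -(hb i iE).
rewrite [LHS]big_seq; apply: eq_bigr => i iE; rewrite -(hb i iE).
by rewrite -inp_cls inp_term.
Qed.

Lemma initial_relationE n (E : nat -> expansion K W) (C : nat -> {poly K}) :
  (forall j, (j < n)%N ->
    \sum_(g <- finsupp (E j)) inK nu (E j g) * inp (mono Q g) = inp (C j)) ->
  initial_relation nu Q n E = 'X^n + \poly_(j < n) inp (C j).
Proof.
move=> h; rewrite /initial_relation poly_def; congr (_ + _).
by apply: eq_bigr => j _; rewrite h // mul_polyC.
Qed.

Lemma adjoin_mono (A : set W) (g : exponent W) :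
  (forall i, g i != 0%N -> A i) -> adjoin Q A (inp (mono Q g)).
Proof.
move=> h; rewrite /mono inp_prod; apply: subring_gen_prod => i.
rewrite mem_finsupp => gi _; rewrite inpX; apply: subring_genX.
by apply: subring_gen_gen; right; exists i => //; apply: h.
Qed.

Lemma adjoin_term (A : set W) E (g : exponent W) :
  (forall i, g i != 0%N -> A i) -> adjoin Q A (inp (term Q E g)).
Proof.
move=> h; rewrite inp_term; apply: subring_gen_mul; last exact: adjoin_mono.
by apply: subring_gen_gen; left; exists (E g).
Qed.

Lemma adjoin_cls (A : set W) b f : adjoin Q A (inp f) -> pge b f ->
  adjoin Q A (cls nu b f%:F).
Proof.
have [-> _ _|f0 h hb] := eqVneq f 0.
  by rewrite tofrac0 cls0; apply: subring_gen0.
by rewrite cls_pval //; case: ifP => // _; apply: subring_gen0.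
Qed.

Lemma adjoin_ev (A : set W) E b :
  (forall g, g \in finsupp E -> pge b (term Q E g) /\ forall i, g i != 0%N -> A i) ->
  adjoin Q A (cls nu b (ev Q E)%:F).
Proof.
move=> h; rewrite /ev big_seq cls_psum => [|g /h[]//].
apply: subring_gen_sum => g _ /h [hb hg]; apply: adjoin_cls => //.
exact: adjoin_term.
Qed.

Lemma free_pge L l E : free_expansion nu alpha Q L l E ->
  forall g, g \in finsupp E -> pge (v (ev Q E)) (term Q E g).
Proof.
move=> [_ h] g gE; have ne : finsupp E != fset0 by apply/fset0Pn; exists g.
have [_ [_ min]] := h ne; right; apply: min; by exists g.
Qed.

Section KeyRelation.
Variables (q : {poly K}) (n : nat) (C : nat -> {poly K}) (A : set (gr nu)).
Hypothesis sk : skey nu q (v q).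
Hypothesis A0 : A 0.
Hypothesis mp : minimal_polynomial A (inp q) ('X^n + \poly_(j < n) inp (C j)).

Let q0 : q != 0 := skey_neq0 sk.

Lemma relation_indep k (c : nat -> {poly K}) : (k <= n)%N ->
  (forall j, A (inp (c j))) -> \sum_(j < k) inp (c j) * inp q ^+ j = 0 ->
  forall j, (j < k)%N -> c j = 0.
Proof.
move=> kn cA e0 j jk; have [_ _ _ min] := mp.
have e : (\poly_(j < k) inp (c j)).[inp q] = 0 by rewrite horner_poly.
have [p0|p0] := eqVneq (\poly_(j < k) inp (c j)) 0.
  apply/eqP; rewrite -inp_eq0; have := congr1 (fun p : {poly _} => p`_j) p0.
  by rewrite coef_poly jk coef0 => ->.
have : (size (\poly_(j < k) inp (c j)) <= k)%N by apply: size_poly.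
rewrite leqNgt => /negP []; apply: leq_trans (min _ p0 _ e).
  by rewrite monic_plus_size ltnS.
by move=> i; rewrite coef_poly; case: ifP.
Qed.

(** Only the terms of value exactly [m] survive modulo larger values; those initial forms must
    cancel when the sum is worth more than [m]. *)
Lemma relation_component k (c : nat -> {poly K}) m :
  (forall j, (j < k)%N -> pge m (c j * q ^+ j)) ->
  pgt m (\sum_(j < k) c j * q ^+ j) ->
  \sum_(j < k) inp (if v (c j) + v q *+ j == m then c j else 0) * inp q ^+ j = 0.
Proof.
move=> h hs; have hk (j : 'I_k) (_ : true) : pge m (c j * q ^+ j) by apply: h.
have /(cls_peq0 (pgtW hs)) := hs; rewrite cls_psum // => e0.
apply: etrans e0; apply: eq_bigr => j _; have [c0|c0] := eqVneq (c j) 0.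
  by rewrite c0 if_same inp0 !mul0r tofrac0 cls0.
rewrite cls_pval ?mulf_neq0 ?expf_neq0 //; last exact: h.
rewrite vM ?expf_neq0 // vX // eq_sym; case: eqP => _.
  by rewrite inpM inpX.
by rewrite inp0 mul0r.
Qed.

(** A jump of [f] would make the terms of least weight cancel, a relation of degree less than [n]
    with coefficients in [A]. Minimality kills all those coefficients, although the least weight is
    attained. *)
Lemma relation_exact_at f : (forall c, (size c < size q)%N -> A (inp c)) ->
  (size f <= n * (size q).-1)%N -> exact_at q f.
Proof.
move=> smallA sf; apply: contrapT => nf.
have f0 : f != 0 by apply: contra_notN nf => /eqP ->; apply: exact_at0.
have [m [hm nm]] := wexact_ex sk f0; have fm := Nexact_at_val sk hm nm nf.
have sd j : (size (dig q f j) < size q)%N by apply: size_dig.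
have hd j : pge m (dig q f j * q ^+ j).
  rewrite -(subrK (v q *+ j) m); apply: pgeM; first exact: hm.
  exact/pgeX.
have ef := dig_expand q0 sf; rewrite {1}ef in fm.
have rel := relation_component (fun j _ => hd j) fm.
apply: nm => j /=; have [le|lt] := leqP n j.
  by rewrite dig_oversize ?(leq_trans sf) ?leq_mul2r ?le ?orbT //; apply: pgt0.
have cA i : A (inp (if v (dig q f i) + v q *+ i == m then dig q f i else 0)).
  by apply: smallA; case: ifP => // _; rewrite size_poly0 (leq_trans _ (skey_size sk)).
have := relation_indep (leqnn n) cA rel lt.
have [->|d0] := eqVneq (dig q f j) 0; first by move=> _; apply: pgt0.
case: eqP => [_ /eqP|ne _]; first by rewrite (negPf d0).
apply/(pgtP _ _ d0); have /(pgeP _ _ d0) le := hm j.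
rewrite lt_neqAle le andbT; apply/eqP => e; apply: ne.
by rewrite -e subrK.
Qed.

Hypothesis CA : forall j, (j < n)%N -> A (inp (C j)).

(** The default 1 is the leading coefficient, at index [n]. *)
Let C' j := if (j < n)%N then C j else 1.

Let vC j : C' j != 0 -> v (C' j * q ^+ j) = v (C' j) + v q *+ j.
Proof. by move=> c0; rewrite vM ?expf_neq0 // vX. Qed.

Lemma relation_degree e :
  pgt e (\sum_(j < n.+1) (if v (C' j * q ^+ j) == e then C' j else 0) * q ^+ j).
Proof.
have [_ _ root _] := mp; rewrite monic_plus_horner in root.
have key : \sum_(j <- index_iota 0 n.+1)
    cls nu (v (C' j * q ^+ j)) (C' j * q ^+ j)%:F = 0.
  rewrite big_mkord -[RHS]root big_ord_recr addrC /=; congr (_ + _).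
    by apply: eq_bigr => j _; rewrite -inp_cls /C' ltn_ord inpM inpX.
  by rewrite -inp_cls /C' ltnn mul1r inpX.
have /cls_sum_eq0 h : forall j, j \in index_iota 0 n.+1 ->
  vge nu (v (C' j * q ^+ j)) (C' j * q ^+ j)%:F by move=> j _; apply: pge_val.
have := (h.1 key) e; rewrite big_mkord /= big_mkcond /= /pgt.
congr (vgt _ _ _); rewrite (rmorph_sum (@FracField.tofrac _)).
by apply: eq_bigr => j _; case: ifP => // _; rewrite mul0r rmorph0.
Qed.

(** A minimal relation is homogeneous. A component of another degree would miss the leading term and
    so be a nontrivial relation of degree less than [n]. *)
Lemma relation_value j : (j < n)%N -> C j != 0 -> v (C j) + v q *+ j = v q *+ n.
Proof.
move=> jn Cj; set e := v (C j) + v q *+ j; apply: contrapT => /eqP ne.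
pose c i := if v (C' i * q ^+ i) == e then C' i else 0.
have vc i : c i != 0 -> v (c i) + v q *+ i = e.
  rewrite /c; case: (v (C' i * q ^+ i) =P e) => [<- c0|_]; last by rewrite eqxx.
  exact/esym/vC.
have := relation_degree e; rewrite big_ord_recr /= -/(c n).
have -> : c n = 0.
  by rewrite /c /C' ltnn mul1r vX // eq_sym (negPf ne).
rewrite mul0r addr0 => he.
have cq i : (i < n)%N -> pge e (c i * q ^+ i).
  move=> _; have [->|c0] := eqVneq (c i) 0; first by rewrite mul0r; apply: pge0.
  by apply/pgeP; rewrite ?mulf_neq0 ?expf_neq0 // vM ?expf_neq0 // vX // vc.
have rel := relation_component cq he.
have cA i : A (inp (if v (c i) + v q *+ i == e then c i else 0)).
  case: ifP => _; last by rewrite inp0.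
  rewrite /c; case: ifP => _; last by rewrite inp0.
  rewrite /C'; case: ltnP => [/CA//|_]; rewrite inp1.
  by have [_ + _ _] := mp => /(_ n); rewrite monic_plus_coef ltnn eqxx.
have := relation_indep (leqnn n) cA rel jn.
have cj : c j = C j.
  by rewrite /c vC /C' ?jn // eqxx.
by rewrite cj eqxx => /eqP; rewrite (negPf Cj).
Qed.

Lemma relation_lift : pgt (v q *+ n) (q ^+ n + \sum_(j < n) C j * q ^+ j).
Proof.
have := relation_degree (v q *+ n); congr (pgt _ _).
rewrite big_ord_recr [LHS]addrC /= /C' ltnn !mul1r vX // eqxx mul1r; congr (_ + _).
apply: eq_bigr => j _; have [c0|c0] := eqVneq (C j) 0.
  by rewrite ltn_ord c0 if_same.
by rewrite ltn_ord vM ?expf_neq0 // vX // relation_value // eqxx.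
Qed.

(** The lift is worth more than the power [q ^+ n], so it cannot be that power alone. *)
Lemma relation_nontrivial : exists2 j, (j < n)%N & C j != 0.
Proof.
apply: contrapT => no; have := relation_lift; rewrite big1 => [|j _].
  by rewrite addr0 -vX // => /pgt_val/eqP; rewrite expf_eq0 (negPf q0) andbF.
have [->|c0] := eqVneq (C j) 0; first by rewrite mul0r.
by case: no; exists j.
Qed.

End KeyRelation.

Lemma minimal_polynomial1 (A : set (gr nu)) (q c : {poly K}) :
  A 0 -> A 1 -> A (inp c) -> inp q = - inp c ->  q != 0 ->
  minimal_polynomial A (inp q) ('X^1 + \poly_(j < 1) inp c).
Proof.
move=> A0 A1 Ac e q0; split; first exact: monic_plus_monic.
- by move=> j; rewrite monic_plus_coef; do 2?case: ifP.
- by rewrite monic_plus_horner big_ord1 mulr1 expr1 e addNr.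
move=> p p0 _ root; rewrite monic_plus_size ltnNge; apply: contra p0 => /size1_polyC ep.
by move: root; rewrite ep hornerC => ->.
Qed.

Lemma inp_opp_of_gt (q c : {poly K}) : q != 0 -> pgt (v q) (q + c) -> inp q = - inp c.
Proof.
move=> q0 h; have c0 : c != 0.
  by apply/eqP => c0; move: h; rewrite c0 addr0; apply: NpgtV.
have [_ vc] : - q != 0 /\ v (- q + (q + c)) = v q.
  by have [] := @v_dom _ _ nu (v q) (- q) (q + c) _ (vN _ _) h; rewrite oppr_eq0.
rewrite addKr in vc; apply/eqP; rewrite -addr_eq0 !inp_cls vc.
have hq := pge_val nu q; have hc : pge (v q) c by rewrite -vc.
by rewrite -clsD // -tofracD; apply/eqP/cls_peq0 => //; apply: pgtW.
Qed.

End Relation.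

(** * Indices and standard exponents *)

Section IndexLemmas.
Variables (disp : Order.disp_t) (W : bOrderType disp).
Implicit Types (i j k l p : W) (s t : nat).

Lemma is_succ_uniq i j k : is_succ i j -> is_succ i k -> j = k.
Proof. by move=> [ij hj] [ik hk]; apply: le_anti; rewrite hj ?hk. Qed.

Lemma is_succ_le p j k : is_succ p j -> (k < j)%O -> (k <= p)%O.
Proof. by move=> [_ h] kj; rewrite leNgt; apply/negP => /h; rewrite leNgt kj. Qed.

Lemma is_succ_inj i j k : is_succ i k -> is_succ j k -> i = j.
Proof.
move=> hi hj; apply: le_anti; rewrite (is_succ_le hj) ?(is_succ_le hi) //.
  by case: hj.
by case: hi.
Qed.

Lemma is_plus_uniq l t i j : is_plus l t i -> is_plus l t j -> i = j.
Proof.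
elim: t i j => [|t IH] i j /=; first by move=> -> ->.
by move=> [k hk ki] [k' hk' kj]; move: kj; rewrite -(IH _ _ hk hk'); apply: is_succ_uniq.
Qed.

Lemma is_plusD l s t k j : is_plus l s k -> is_plus k t j -> is_plus l (s + t) j.
Proof.
move=> lk; elim: t j => [|t IH] j /=; first by rewrite addn0 => ->.
by move=> [m km mj]; rewrite addnS; exists m => //; apply: IH.
Qed.

Lemma is_plus_split l s t j : is_plus l (s + t) j ->
  exists2 k, is_plus l s k & is_plus k t j.
Proof.
elim: t j => [|t IH] j; first by rewrite addn0 => h; exists j.
by rewrite addnS => -[m /IH [k lk km] mj]; exists k => //; exists m.
Qed.

Lemma is_plus_lt0 l t i : is_plus l t.+1 i -> (l < i)%O.
Proof.
elim: t i => [|t IH] i /=; first by move=> [k -> []].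
by move=> [k /IH lk [ki _]]; apply: lt_trans ki.
Qed.

Lemma is_plus_le l t i : is_plus l t i -> (l <= i)%O.
Proof. by case: t => [/= ->//|t /is_plus_lt0/ltW]. Qed.

Lemma is_plus_lt l s t i j : is_plus l s i -> is_plus l t j -> (s < t)%N -> (i < j)%O.
Proof.
move=> li lj lt; have e : t = (s + (t - s.+1).+1)%N by lia.
move: lj; rewrite e => /is_plus_split [k lk /is_plus_lt0].
by rewrite (is_plus_uniq li lk).
Qed.

Lemma is_plus_between l t k i : is_plus l t k -> (l <= i)%O -> (i <= k)%O ->
  exists2 s, (s <= t)%N & is_plus l s i.
Proof.
elim: t k => [|t IH] k /=.
  by move=> -> li il; exists 0%N => //=; apply: le_anti; rewrite li il.
move=> [m lm mk] li; rewrite le_eqVlt => /orP[/eqP->|ik].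
  by exists t.+1 => //; exists m.
have [s st h] := IH m lm li (is_succ_le mk ik); exists s => //; exact: leqW.
Qed.

Lemma is_plus_leq l s t i j : is_plus l s i -> is_plus l t j -> (i <= j)%O -> (s <= t)%N.
Proof.
by move=> li lj le; rewrite leqNgt; apply/negP => /(is_plus_lt lj li); rewrite ltNge le.
Qed.

Section Omega.
Variables (i j : W).
Hypothesis ij : is_plus_omega i j.

Lemma omega_ex t : exists k, is_plus i t k.
Proof. by have [k] := ij.1 t; exists k. Qed.

Lemma omega_lt t k : is_plus i t k -> (k < j)%O.
Proof. by have [m im mj] := ij.1 t; move=> /(is_plus_uniq im) <-. Qed.

Lemma omega_gt : (i < j)%O.
Proof. exact: (@omega_lt 0%N). Qed.

Lemma omega_between k : (i <= k)%O -> (k < j)%O -> exists t, is_plus i t k.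
Proof.
move=> ik kj; apply: contrapT => no.
suff : (j <= k)%O by rewrite leNgt kj.
apply: ij.2 => t m im; rewrite ltNge; apply/negP => km.
by have [s _ h] := is_plus_between im ik km; apply: no; exists s.
Qed.

(** A predecessor of [i + omega] would be some [i + t], with [i + t + 1] still below [j]. *)
Lemma omega_nsucc p : ~ is_succ p j.
Proof.
move=> pj; have [pj' _] := pj.
have [ip|/ltW pi] := leP i p; last first.
  by have := is_succ_le pj omega_gt; move=> ip; have /= := @omega_lt 1; have [k ik] := omega_ex 1;
  move=> /(_ k ik) kj; have := is_plus_lt0 ik; rewrite ltNge (le_trans (is_succ_le pj kj)).
have [t ht] := omega_between ip pj'.
have [k ik] := omega_ex t.+1; have := omega_lt ik.
by move=> /(is_succ_le pj); rewrite leNgt (is_plus_lt ht ik).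
Qed.

Lemma omega_shift t k : is_plus i t k -> is_plus_omega k j.
Proof.
move=> ik; split=> [s|m h].
  have [n hn exact_at] := ij.1 (t + s)%N; have [k' ik' k'n] := is_plus_split hn.
  by exists n => //; rewrite (is_plus_uniq ik ik').
apply: ij.2 => s n hn; have [le|lt] := leqP t s.
  move: hn; rewrite -(subnKC le) => /is_plus_split [k' /(is_plus_uniq ik) <-].
  exact: h.
by apply: lt_trans (is_plus_lt hn ik lt) _; apply: (h 0%N).
Qed.

Lemma omega_seq : exists s : nat -> W, forall t, is_plus i t (s t).
Proof. by have /choice [s hs] := omega_ex; exists s. Qed.

End Omega.

Lemma omega_uniq i j k : is_plus_omega i j -> is_plus_omega i k -> j = k.
Proof.
move=> ij ik; apply: le_anti; apply/andP; split.
  by apply: ij.2 => t m /(omega_lt ik).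
by apply: ik.2 => t m /(omega_lt ij).
Qed.

End IndexLemmas.

Section StandardExponents.
Variables (disp : Order.disp_t) (W : bOrderType disp) (alpha : W -> nat).
Implicit Types (i j k l p : W) (g : exponent W).

Notation std := (standard_exponent alpha setT).
Notation uptoT l := (upto [set: W] l).

Lemma upto_initial (L : set W) l : initial_segment L -> L l -> upto L l = uptoT l.
Proof.
move=> [_ h] Ll; apply/seteqP; split=> i [Li il]; split=> //=.
exact: h Ll il.
Qed.

Lemma before_initial (L : set W) l : initial_segment L -> L l ->
  before L l = before setT l.
Proof.
move=> [_ h] Ll; apply/seteqP; split=> i [Li il]; split=> //=.
exact: h Ll (ltW il).
Qed.

Lemma inessential_mono (L L' : set W) i : L `<=` L' ->
  inessential alpha L i -> inessential alpha L' i.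
Proof. by move=> sub [[j ij Lj] h]; split=> //; exists j => //; apply: sub. Qed.

Lemma upto_le p l : (p <= l)%O -> uptoT p `<=` uptoT l.
Proof. by move=> pl i [_ ip]; split=> //; apply: le_trans pl. Qed.

Lemma is_next_uniq (L : set W) i j k :
  is_next alpha L i j -> is_next alpha L i k -> j = k.
Proof.
move=> [_ [[h ij]|[h ij]]] [_ [[h' ik]|[h' ik]]] //.
- exact: omega_uniq ij ik.
- exact: is_succ_uniq ij ik.
Qed.

Lemma is_next_lt (L : set W) i j : is_next alpha L i j -> (i < j)%O.
Proof. by move=> [_ [[_ /omega_gt]|[_ []]]]. Qed.

Lemma is_next_omega (L : set W) i j k :
  is_next alpha L i k -> is_plus_omega j k -> inessential alpha L i /\ is_plus_omega i k.
Proof. by move=> [_ [//|[_ h]]] jk; case: (omega_nsucc jk h). Qed.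

Lemma std_supp l g i : std l g -> g i != 0%N -> (i <= l)%O.
Proof. by move=> [h _ _] /h[]. Qed.

(* Such an index [i] is not inessential up to [p], so its exponent is bounded by
   [alpha (i + 1) = 1]. *)
Lemma std_gap p l g i k : std p g -> inessential alpha (uptoT l) i ->
  is_plus_omega i k -> (p < k)%O -> (i < p)%O -> g i = 0%N.
Proof.
move=> [_ h2 _] [[k' ik' _] a1] ik pk ip.
have [m hm] := omega_ex ik 1; have /= [i' ei si] := hm; rewrite {}ei in si.
have mp : (m <= p)%O by apply: si.2.
have := h2 i m ip; rewrite (a1 1%N m hm).
have ni : ~ inessential alpha (uptoT p) i.
  move=> [[k'' ik'' [_ kp]] _]; move: kp; rewrite (omega_uniq ik'' ik).
  by rewrite leNgt pk.
by move=> /(_ (conj (conj I mp) (or_intror (conj ni si)))); case: (g i).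
Qed.

Section Up.
Variables (p l : W).
Hypothesis pl : (p <= l)%O.
Hypothesis apos : forall i, (i <= l)%O -> (0 < alpha i)%N.

Lemma std_up2 g i j : std p g -> (i < p)%O -> is_next alpha (uptoT l) i j ->
  (g i < alpha j)%N.
Proof.
move=> hg ip nx; have := hg => -[_ h2 _].
have aj : (0 < alpha j)%N by apply: apos; case: nx => -[].
case: nx => [[_ jl] [[ines ij]|[nin sij]]].
  have [jp|pj] := leP j p; last by rewrite (std_gap hg ines ij pj ip).
  apply: h2 ip _; split; first by split.
  left; split=> //; split; last by case: ines.
  by exists j => //; split.
have jp : (j <= p)%O by apply: (proj2 sij).
apply: h2 ip _; split; first by split.
right; split=> // /(inessential_mono (upto_le pl)); exact: nin.
Qed.

Lemma std_up3 g i k j j' : std p g -> inessential alpha (uptoT l) i ->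
  is_next alpha (uptoT l) i k -> is_next alpha (uptoT l) j k ->
  is_next alpha (uptoT l) j' k -> (j < p)%O -> (j' < p)%O ->
  g j != 0%N -> g j' != 0%N -> j = j'.
Proof.
move=> hg ines nik njk nj'k jp j'p gj gj'; have := hg => -[_ _ h3].
have ik : is_plus_omega i k by case: nik => [_ [[]//|[/(_ ines)]]].
have [ijn jk] := is_next_omega njk ik; have [ijn' j'k] := is_next_omega nj'k ik.
have [kp|pk] := leP k p; last by rewrite (std_gap hg ijn jk pk jp) in gj.
have nx m : inessential alpha (uptoT l) m -> is_plus_omega m k ->
    is_next alpha (uptoT p) m k.
  move=> [_ am] mk; split; first by split.
  by left; split=> //; split=> //; exists k.
apply: (h3 i k) => //; [|exact: nx|exact: nx|exact: nx].
by split; [exists k|case: ines].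
Qed.

(** Enlarging the index set changes [i+] only for indices that become inessential, their limit lying
    beyond [p]; [std_gap] shows that these carry no exponent. *)
Lemma std_up g : std p g -> g p = 0%N -> std l g.
Proof.
move=> hg gp; have lt i : g i != 0%N -> (i < p)%O.
  move=> gi; have := std_supp hg gi; rewrite le_eqVlt => /orP[/eqP e|//].
  by move: gi; rewrite e gp.
split=> [i gi|i j il nx|i k j j' ines nik njk nj'k gj gj'].
- by split=> //=; apply: le_trans pl; apply: std_supp hg gi.
- have [e|gi] := eqVneq (g i) 0%N; last by apply: std_up2 (lt _ gi) nx.
  by rewrite e; apply: apos; case: nx => -[].
- by apply: (std_up3 hg ines nik njk nj'k); rewrite ?lt.
Qed.

(** The new exponent at [p] is controlled by [alpha l]. Another index sharing the limit [k > p] with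
    [p] has exponent zero by [std_gap], so the uniqueness clause survives. *)
Lemma std_add g n : is_next alpha (uptoT l) p l -> std p g -> g p = 0%N ->
  (n < alpha l)%N -> std l [fsfun g with p |-> n].
Proof.
move=> nx hg gp na; have gE i : i != p -> [fsfun g with p |-> n] i = g i.
  by move=> ip; rewrite fsfun_withE (negPf ip).
have gpE : [fsfun g with p |-> n] p = n by rewrite fsfun_withE eqxx.
have ltp i : i != p -> [fsfun g with p |-> n] i != 0%N -> (i < p)%O.
  by move=> ip; rewrite gE // lt_neqAle ip => /(std_supp hg).
split=> [i gi|i j il nij|i k j j' ines nik njk nj'k gj gj'].
- split=> //=; have [->//|ip] := eqVneq i p.
  by apply: le_trans pl; apply/ltW/ltp.
- have [e|ip] := eqVneq i p.
    by move: nij; rewrite e gpE => nij; rewrite -(is_next_uniq nx nij).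
  have [e|gi] := eqVneq ([fsfun g with p |-> n] i) 0%N.
    by rewrite e; apply: apos; case: nij => -[].
  by rewrite gE //; apply: std_up2 (ltp _ ip gi) nij.
- have ik : is_plus_omega i k by case: nik => [_ [[]//|[/(_ ines)]]].
  have pcase m : m != p -> [fsfun g with p |-> n] m != 0%N ->
      is_next alpha (uptoT l) m k -> ~ is_next alpha (uptoT l) p k.
    move=> mp gm nmk npk; have [imn mk] := is_next_omega nmk ik.
    have pk := is_next_lt npk; move: (gm).
    by rewrite gE // (std_gap hg imn mk pk (ltp _ mp gm)).
  have [ej|jp] := eqVneq j p; have [ej'|j'p] := eqVneq j' p.
  + by rewrite ej ej'.
  + by case: (pcase j') => //; rewrite -ej.
  + by case: (pcase j) => //; rewrite -ej'.
  + apply: (std_up3 hg ines nik njk nj'k); rewrite -?gE //; exact: ltp.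
Qed.

(** The closure assumption keeps the limits of the inessential indices in use at most [p]; otherwise
    restriction to [p] would turn their [i+] into [i + 1] and impose tighter exponent bounds. *)
Lemma std_down g : std l g -> (forall i, g i != 0%N -> (i < p)%O) ->
  (forall i k, g i != 0%N -> inessential alpha (uptoT l) i -> is_plus_omega i k ->
     (k <= p)%O) ->
  std p g.
Proof.
move=> [h1 h2 h3] sup cl; have tr i k : is_plus_omega i k -> is_next alpha (uptoT p) i k ->
    is_next alpha (uptoT l) i k.
  move=> ik [[_ kp] [[ines _]|[_ /(omega_nsucc ik)]]] //; split.
    by split=> //; apply: le_trans pl.
  by left; split=> //; apply: inessential_mono ines; apply: upto_le.
split=> [i gi|i j ip nx|i k j j' ines nik njk nj'k gj gj'].
- by split=> //; apply/ltW/sup.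
- have ajp : (0 < alpha j)%N by apply: apos; case: nx => -[_ jp] _; apply: le_trans pl.
  have [->//|gi] := eqVneq (g i) 0%N.
  apply: h2; first exact: lt_le_trans pl.
  case: nx => [[_ jp] [[ines ij]|[nin sij]]].
    by apply: (tr _ _ ij); split=> //; left.
  split; first by split=> //; apply: le_trans pl.
  right; split=> // ines; apply: nin; have [[k ik kl] ai] := ines.
  by split=> //; exists k => //; split=> //; apply: cl gi ines ik.
- have ik : is_plus_omega i k by case: nik => [_ [[]//|[/(_ ines)]]].
  have [_ jk] := is_next_omega njk ik; have [_ j'k] := is_next_omega nj'k ik.
  apply: (h3 i k) => //; [|exact: tr|exact: tr|exact: tr].
  by apply: inessential_mono ines; apply: upto_le.
Qed.

End Up.
End StandardExponents.

(** * Standard expansions *)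

Section Construction.
Variables (K : fieldType) (Gam : ordGroupType).
Variable nu : valuation {fraction {poly K}} Gam.
Variables (disp : Order.disp_t) (W : bOrderType disp).
Hypothesis W_wf : well_founded (fun i j : W => (i < j)%O).
Variables (alpha : W -> nat) (Q : W -> {poly K}).
Implicit Types (i k l p : W) (g : exponent W) (E : expansion K W) (f c : {poly K}).

Notation v := (pval nu).
Notation pge := (pge nu).
Notation pgt := (pgt nu).
Notation wcmp := (wcmp nu).
Notation wge := (wcmp false).
Notation wgt := (wcmp true).
Notation exact_at := (exact_at nu).
Notation mono := (mono Q).
Notation term := (term Q).
Notation ev := (ev Q).
Notation beta := (beta nu Q).
Notation std := (standard_exponent alpha setT).
Notation uptoT l := (upto [set: W] l).
Notation free l E := (free_expansion nu alpha Q setT l E).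
Notation GK := (value_group_K nu).
Notation hull := (in_hull GK).

Lemma exponent_big (R : Type) (idx : R) (op : Monoid.com_law idx) (F : W -> nat -> R)
    g (X : {fset W}) :
  (forall i, F i 0%N = idx) -> (finsupp g `<=` X)%fset ->
  \big[op/idx]_(i <- finsupp g) F i (g i) = \big[op/idx]_(i <- X) F i (g i).
Proof.
move=> F0 sX; apply: (big_fset_incl _ sX) => i _ /fsfun_dflt ->.
exact: F0.
Qed.

(** The abstract operation covers both the product in [mono] and the sum in [wt]. *)
Lemma exponent_with (R : Type) (idx : R) (op : Monoid.com_law idx) (F : W -> nat -> R)
    g p n : (forall i, F i 0%N = idx) -> g p = 0%N ->
  \big[op/idx]_(i <- finsupp [fsfun g with p |-> n]) F i ([fsfun g with p |-> n] i) =
  op (\big[op/idx]_(i <- finsupp g) F i (g i)) (F p n).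
Proof.
move=> F0 gp; pose X := (p |` finsupp g)%fset.
rewrite (@exponent_big _ _ _ _ _ X) //; last first.
  apply/fsubsetP => i; rewrite in_fset1U; have [//|ip] := eqVneq i p.
  by rewrite !mem_finsupp fsfun_withE (negPf ip).
have pg : p \notin finsupp g by rewrite mem_finsupp gp.
rewrite /X big_fsetU1 //= fsfun_withE eqxx Monoid.mulmC; congr (op _ _).
rewrite big_seq [RHS]big_seq; apply: eq_bigr => i; rewrite fsfun_withE.
by case: eqP => // ->; rewrite (negPf pg).
Qed.

Lemma mono_with g p n : g p = 0%N -> mono [fsfun g with p |-> n] = mono g * Q p ^+ n.
Proof. by move=> gp; rewrite /Defs.mono (exponent_with _ (F := fun i m => Q i ^+ m)). Qed.

Lemma with_with0 g p n : [fsfun [fsfun g with p |-> 0%N] with p |-> n] = [fsfun g with p |-> n].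
Proof. by apply/fsfunP => i; rewrite !fsfun_withE; case: eqP. Qed.

Lemma with_id g p : [fsfun g with p |-> g p] = g.
Proof. by apply/fsfunP => i; rewrite fsfun_withE; case: eqP => // ->. Qed.

Definition deg_at i : nat := (size (Q i)).-1.
Definition wt g : nat := \sum_(i <- finsupp g) (g i * deg_at i)%N.

Lemma wt_with g p n : g p = 0%N -> wt [fsfun g with p |-> n] = (wt g + n * deg_at p)%N.
Proof.
by move=> gp; rewrite /wt (exponent_with _ (F := fun i m => (m * deg_at i)%N)).
Qed.

Lemma wt_without g p : wt g = (wt [fsfun g with p |-> 0%N] + g p * deg_at p)%N.
Proof.
rewrite -wt_with; last by rewrite fsfun_withE eqxx.
by rewrite with_with0 with_id.
Qed.

Lemma size_mono g : (size (mono g) <= (wt g).+1)%N.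
Proof.
rewrite /Defs.mono /wt; elim/big_rec2: _ => [|i m f _ IH].
  by rewrite size_polyC oner_eq0.
apply: leq_trans (size_polyMleq _ _) _.
have := size_poly_exp_leq (Q i) (g i); rewrite /deg_at mulnC; lia.
Qed.

Lemma mono_neq0 g : (forall i, g i != 0%N -> Q i != 0) -> mono g != 0.
Proof.
move=> h; rewrite /Defs.mono prodf_seq_neq0; apply/allP => i; rewrite mem_finsupp => gi.
by rewrite expf_neq0 // h.
Qed.

Lemma v_mono g : (forall i, g i != 0%N -> Q i != 0) ->
  v (mono g) = \sum_(i <- finsupp g) beta i *+ g i.
Proof.
move=> h; rewrite /Defs.mono.
suff : \prod_(i <- finsupp g) Q i ^+ g i != 0 /\
  v (\prod_(i <- finsupp g) Q i ^+ g i) = \sum_(i <- finsupp g) beta i *+ g i by case.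
have : all (fun i => Q i != 0) (finsupp g).
  by apply/allP => i; rewrite mem_finsupp => /h.
elim: (enum_fset (finsupp g)) => [_|i s IH /= /andP[qi /IH [n0 e]]].
  by rewrite !big_nil oner_neq0 v1.
by rewrite !big_cons mulf_neq0 ?expf_neq0 // vM ?expf_neq0 // vX // e.
Qed.

Section Hull.
Variable A : set Gam.
Hypothesis A0 : A 0.
Hypothesis AB : forall a b, A a -> A b -> A (a - b).

Lemma hull_term E g : (forall a : K, a != 0 -> A (v a%:P)) ->
  g \in finsupp E ->
  (forall i, g i != 0%N -> Q i != 0 /\ in_hull A (beta i)) ->
  in_hull A (v (term E g)).
Proof.
move=> hK; rewrite mem_finsupp => Eg h.
have h1 i : g i != 0%N -> Q i != 0 by case/h.
rewrite /Defs.term -mul_polyC vM ?polyC_eq0 ?mono_neq0 // v_mono //.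
apply: (hullD A0 AB); first exact/hull_sub/hK.
rewrite big_seq; apply: (big_ind (in_hull A)) => [|x y|i].
- by apply: hull_sub.
- exact: hullD.
- by rewrite mem_finsupp => /h [_ hi]; apply: hullMn.
Qed.

End Hull.

(** At a limit only an inequality of degrees is recorded, since equality can fail when the values
    below are unbounded; the inequality suffices for the degree bound [wt_small]. *)
Definition kind i : Prop :=
  [\/ i = \bot%O, exists2 p, is_succ p i & deg_at i = (alpha i * deg_at p)%N
    | exists i0, [/\ is_plus_omega i0 i,
        forall t j, is_plus i0 t j -> alpha j = 1%N
        & (alpha i * deg_at i0 <= deg_at i)%N]].

Definition good l : Prop := forall i, (i <= l)%O ->
  [/\ Q i \is monic, (1 < size (Q i))%N, (0 < alpha i)%N & kind i].

Lemma good_le p l : (p <= l)%O -> good l -> good p.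
Proof. by move=> pl gl i ip; apply: gl; apply: le_trans pl. Qed.

Lemma good_alpha l : good l -> forall i, (i <= l)%O -> (0 < alpha i)%N.
Proof. by move=> gl i /gl[]. Qed.

Lemma good_dg l : good l -> (0 < deg_at l)%N.
Proof. by move=> /(_ l (lexx l)) [_ + _ _]; rewrite /deg_at; case: (size _) => [|[]]. Qed.

Lemma dg_succ l p : good l -> is_succ p l -> deg_at l = (alpha l * deg_at p)%N.
Proof.
move=> gl pl; have [_ _ _ [e|[p' p'l ->]|[i0 [il _ _]]]] := gl l (lexx l).
- by have [lt _] := pl; move: lt; rewrite e ltx0.
- by rewrite (is_succ_inj pl p'l).
- by case: (omega_nsucc il pl).
Qed.

Lemma dg_plus l i t : good l ->
  (forall s j, is_plus i s j -> (0 < s <= t)%N -> alpha j = 1%N) ->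
  is_plus i t l -> deg_at l = deg_at i.
Proof.
elim: t l => [|t IH] l gl a1 /=; first by move=> ->.
move=> [k ik kl]; have [lt _] := kl; rewrite (dg_succ gl kl) (a1 t.+1 l) ?mul1n ?leqnn //=.
  apply: IH ik => [|s j h /andP[s0 le]]; first exact: good_le (ltW lt) gl.
  by apply: a1 h _; rewrite s0 leqW.
by exists k.
Qed.

(** Exponents are digits of a mixed radix system. Removing the exponent of the index [p] just below
    [l] leaves less than one unit [deg_at p], and at most [alpha l] units fit below [deg_at l]. *)
Lemma wt_small l g : good l -> std l g -> g l = 0%N -> (wt g < deg_at l)%N.
Proof.
elim/(well_founded_ind W_wf): l g => l IH g gl hg gl0.
have apos := good_alpha gl; have dl := good_dg gl.
have lt i : g i != 0%N -> (i < l)%O.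
  move=> gi; have := std_supp hg gi; rewrite le_eqVlt => /orP[/eqP e|//].
  by move: gi; rewrite e gl0.
have restrict p (g' := [fsfun g with p |-> 0%N]) : (p < l)%O ->
    (forall i, i != p -> g i != 0%N -> (i < p)%O) ->
    (forall i k, i != p -> g i != 0%N -> inessential alpha (uptoT l) i ->
       is_plus_omega i k -> (k <= p)%O) ->
    (wt g < deg_at p + g p * deg_at p)%N.
  move=> pl sup cl; rewrite (wt_without g p) ltn_add2r.
  have gE i : g' i != 0%N -> i != p /\ g i != 0%N.
    by rewrite /g' fsfun_withE; have [_ /eqP|] := eqVneq i p.
  have g'0 : g' p = 0%N by rewrite /g' fsfun_withE eqxx.
  apply: IH => //; first exact: good_le (ltW pl) gl.
  apply: (std_down (ltW pl) apos).
  - have [h1 h2 h3] := hg; split=> [i /gE[_ /h1]//|i j il nij|i k j j' a b c e].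
      apply: leq_ltn_trans (h2 i j il nij); rewrite /g' fsfun_withE; by case: eqP.
    by move=> /gE [_ gj] /gE [_ gj']; apply: h3 a b c e gj gj'.
  - by move=> i /gE [ip]; apply: sup.
  - by move=> i k /gE [ip gi]; apply: cl.
have [_ _ _ [e|[p pl el]|[i0 [i0l a1 el]]]] := gl l (lexx l).
- rewrite /wt big_seq big1 // => i; rewrite mem_finsupp => /lt.
  by rewrite e ltx0.
- have [pl' _] := pl.
  have nin : ~ inessential alpha (uptoT l) p.
    move=> [[k pk [_ kl]] _]; have := omega_lt pk (ex_intro2 _ _ p erefl pl : is_plus p 1 l).
    by rewrite ltNge kl.
  have gp : (g p < alpha l)%N.
    by have [_ h2 _] := hg; apply: (h2 p l) => //; split; [split|right].
  apply: leq_trans (restrict p pl' _ _) _.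
  + by move=> i ip /lt /(is_succ_le pl); rewrite le_eqVlt (negPf ip).
  + move=> i k _ _ [[k' ik' [_ kl]] _] ik; rewrite -(omega_uniq ik' ik).
    apply: (is_succ_le pl); rewrite lt_neqAle kl andbT; apply/eqP => e.
    by move: ik'; rewrite e => h; case: (omega_nsucc h pl).
  + by rewrite el -mulSn leq_mul2r gp orbT.
- have nx i : inessential alpha (uptoT l) i -> is_plus_omega i l ->
      is_next alpha (uptoT l) i l.
    by move=> ii il; split; [split|left].
  have cls p i k : is_plus_omega p l -> inessential alpha (uptoT l) i ->
      is_plus_omega i k -> (k <= p)%O \/ k = l.
    move=> pl [[k' ik' [_ kl]] _] ik; rewrite -(omega_uniq ik' ik).
    have [kl'|lk|->] := ltgtP k' l; [|by move: kl; rewrite leNgt lk|by right].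
    left; rewrite leNgt; apply/negP => pk.
    have [t it] := omega_between pl (ltW pk) kl'.
    case: t it => [/= e|t [m _ mk]]; first by move: pk; rewrite e ltxx.
    by case: (omega_nsucc ik' mk).
  have shift m t i : is_next alpha (uptoT l) m l -> is_plus m t i ->
      is_next alpha (uptoT l) i l.
    move=> mn mi; have [[_ am] ml] := is_next_omega mn i0l.
    have il := omega_shift ml mi; apply: nx => //; split; first by exists l; [|split].
    by move=> s j h; apply: (am (t + s)%N); apply: is_plusD mi h.
  have i0n : is_next alpha (uptoT l) i0 l.
    by apply: nx => //; split=> //; exists l => //; split.
  have [_ h2 h3] := hg.
  (* At a limit at most one index of the final block carries an exponent. It plays the role of the
     predecessor, with the degree of the whole block; if there is none, [i0] serves with exponent
     zero. *)
  have [[m [mn gm]]|no] := EM (exists m, is_next alpha (uptoT l) m l /\ g m != 0%N).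
    have [[_ am] ml] := is_next_omega mn i0l; have ml' := omega_gt ml.
    have one i : g i != 0%N -> is_next alpha (uptoT l) i l -> i = m.
      by move=> gi nil; apply: (h3 m l) => //; case: (is_next_omega mn i0l).
    have dm : deg_at m = deg_at i0.
      have [le|/ltW le] := leP m i0.
        have [t ht] := omega_between ml le (omega_gt i0l).
        apply/esym/(dg_plus (t := t)) => [|s j h _|//]; last exact: am h.
        exact: good_le (ltW (omega_gt i0l)) gl.
      have [t ht] := omega_between i0l le ml'.
      apply: (dg_plus (t := t)) => [|s j h _|//]; last exact: a1 h.
      exact: good_le (ltW ml') gl.
    apply: leq_trans (restrict m ml' _ _) _.
    + move=> i im gi; rewrite ltNge; apply/negP => mi.
      have [s is'] := omega_between ml mi (lt _ gi).
      by case/eqP: im; apply: one gi (shift _ _ _ mn is').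
    + move=> i k im gi ii ik; case: (cls m i k ml ii ik) => // kl.
      by case/eqP: im; apply: one gi _; apply: nx => //; rewrite -kl.
    + rewrite dm -mulSn; apply: leq_trans el; rewrite leq_mul2r.
      by rewrite (h2 m l) ?orbT.
  have none i : g i != 0%N -> is_next alpha (uptoT l) i l -> False.
    by move=> gi ni; apply: no; exists i.
  apply: leq_trans (restrict i0 (omega_gt i0l) _ _) _.
  + move=> i _ gi; rewrite ltNge; apply/negP => mi.
    have [s is'] := omega_between i0l mi (lt _ gi).
    exact: none gi (shift _ _ _ i0n is').
  + move=> i k _ gi ii ik; case: (cls i0 i k i0l ii ik) => // kl.
    by case: (none i gi); apply: nx => //; rewrite -kl.
  + have -> : g i0 = 0%N by apply/eqP; apply: contrapT => /negP gi; apply: none gi i0n.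
    rewrite mul0n addn0; apply: leq_trans el.
    by rewrite leq_pmull //; apply: apos.
Qed.

Lemma free_size l E : good l -> free l E -> (size (ev E) < size (Q l))%N.
Proof.
move=> gl [hE _]; have [_ sl _ _] := gl l (lexx l).
apply: (@leq_ltn_trans (size (Q l)).-1); last by case: (size (Q l)) sl.
apply: leq_trans (size_sum _ _ _) _; apply/bigmax_leqP_seq => g gE _.
apply: leq_trans (size_scale_leq _ _) _; apply: leq_trans (size_mono _) _.
by have [hg g0] := hE g gE; apply: wt_small.
Qed.

Lemma free_up p l E : (p <= l)%O -> good l -> free p E -> free l E.
Proof.
move=> pl gl [hE h]; split=> // g gE; have [hg gp] := hE g gE.
have hl := std_up pl (good_alpha gl) hg gp; split=> //.
apply/eqP; apply: contrapT => /negP gl0; have := std_supp hg gl0.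
rewrite leNgt lt_neqAle pl andbT negbK => /eqP e.
by move: gl0; rewrite -e gp.
Qed.

Definition expandable l f : Prop := exists2 E, free l E & ev E = f.

Lemma expandable0 l : expandable l 0.
Proof.
exists [fsfun]; last by rewrite /Defs.ev finsupp0 big_nil.
by split=> [g|]; rewrite finsupp0 // eqxx.
Qed.

Lemma expandable_up p l f : (p <= l)%O -> good l -> expandable p f -> expandable l f.
Proof. by move=> pl gl [E hE e]; exists E => //; apply: free_up hE. Qed.

Definition seq_expansion (r : seq (exponent W)) (a : exponent W -> K) : expansion K W :=
  [fsfun g in seq_fset tt r => a g].

Lemma seq_expansionE r a g : seq_expansion r a g = if g \in r then a g else 0.
Proof. by rewrite /seq_expansion fsfun_fun seq_fsetE. Qed.

Lemma ev_seq_expansion r a : uniq r ->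
  ev (seq_expansion r a) = \sum_(g <- r) a g *: mono g.
Proof.
move=> ur; rewrite /Defs.ev /Defs.term [RHS](bigID (fun g => a g != 0)) /= [X in _ + X]big1 ?addr0.
  rewrite -[RHS]big_filter; have pe : perm_eq (finsupp (seq_expansion r a)) [seq g <- r | a g != 0].
    apply: uniq_perm; rewrite ?filter_uniq ?fset_uniq // => g.
    rewrite mem_filter mem_finsupp seq_expansionE; case: ifP; rewrite ?andbT //.
    by rewrite eqxx andbF.
  rewrite (perm_big _ pe); apply: eq_big_seq => g; rewrite mem_filter => /andP[_ gr].
  by rewrite seq_expansionE gr.
by move=> g; rewrite negbK => /eqP ->; rewrite scale0r.
Qed.

Lemma good_neq0 l i : good l -> (i <= l)%O -> Q i != 0.
Proof. by move=> gl /gl [/monic_neq0]. Qed.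

Lemma free_mono_neq0 l E g : good l -> free l E -> g \in finsupp E -> mono g != 0.
Proof.
move=> gl [h _] /h [hg _]; apply: mono_neq0 => i gi.
by apply: good_neq0 gl _; apply: std_supp hg gi.
Qed.

(** Passes expansions from [p] to [l = p+]: the expansions of the coefficients are merged, the power
    of [Q p] becoming one more exponent. The value condition on the [c j] is what exactness at [Q p]
    provides. *)
Lemma expandable_combine p l n f (c : nat -> {poly K}) : good l -> (p < l)%O ->
  is_next alpha (uptoT l) p l -> (n <= alpha l)%N -> f != 0 ->
  f = \sum_(j < n) c j * Q p ^+ j ->
  (forall j, (j < n)%N -> expandable p (c j)) ->
  (forall j, (j < n)%N -> pge (v f - beta p *+ j) (c j)) -> expandable l f.
Proof.
move=> gl pl nx na f0 ef hc hv.
have gp : good p := good_le (ltW pl) gl.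
have /choice [E hE] : forall j, exists E, (j < n)%N -> free p E /\ ev E = c j.
  move=> j; case: (ltnP j n) => [/hc [E e1 e2]|_]; first by exists E.
  by exists [fsfun].
have Ep j g : (j < n)%N -> g \in finsupp (E j) -> g p = 0%N.
  by move=> /hE [[h _] _] /h [].
pose up (j : nat) g : exponent W := [fsfun g with p |-> j].
have up0 g j : g p = 0%N -> up 0%N (up j g) = g.
  move=> g0; apply/fsfunP => i; rewrite /up !fsfun_withE.
  by have [->|//] := eqVneq i p.
have upp j g : up j g p = j by rewrite /up fsfun_withE eqxx.
pose r := [seq up j g | j <- iota 0 n, g <- enum_fset (finsupp (E j))].
have rP g : g \in r -> exists j g', [/\ (j < n)%N, g' \in finsupp (E j) & g = up j g'].
  move=> /allpairsPdep [j [g' [jn g'E ->]]]; exists j, g'; split=> //.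
  by move: jn; rewrite mem_iota.
(* The exponent at [p] tells which coefficient a monomial comes from; erasing it inverts [up]. *)
pose a g : K := E (g p) (up 0%N g).
have ur : uniq r.
  apply: allpairs_uniq_dep; [exact: iota_uniq|by move=> j _; apply: fset_uniq|].
  move=> x y /allpairsPdep [j1 [g1 [h1 h2 ->]]] /allpairsPdep [j2 [g2 [h3 h4 ->]]] /= e.
  have ej : j1 = j2 by have := congr1 (fun g : exponent W => g p) e; rewrite !upp.
  move: h1 h3; rewrite !mem_iota /= !add0n => h1 h3.
  have eg : g1 = g2.
    by have := congr1 (up 0%N) e; rewrite (up0 _ _ (Ep _ _ h1 h2)) (up0 _ _ (Ep _ _ h3 h4)).
  by rewrite ej eg.
pose E' := seq_expansion r a.
have tE j g : (j < n)%N -> g \in finsupp (E j) ->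
    a (up j g) *: mono (up j g) = term (E j) g * Q p ^+ j.
  move=> jn gE; rewrite /a upp up0 ?(Ep _ _ jn gE) // /up mono_with ?(Ep _ _ jn gE) //.
  by rewrite scalerAl.
have evE' : ev E' = f.
  rewrite /E' ev_seq_expansion // big_allpairs_dep ef big_seq.
  rewrite [RHS](_ : _ = \sum_(j <- iota 0 n | j \in iota 0 n) c j * Q p ^+ j).
    apply: eq_bigr => j; rewrite mem_iota /= add0n => jn.
    have [_ <-] := hE j jn; rewrite /Defs.ev mulr_suml big_seq [RHS]big_seq.
    by apply: eq_bigr => g gE; rewrite tE.
  rewrite -big_seq -(big_mkord xpredT (fun j => c j * Q p ^+ j)) /index_iota subn0 //.
have E'P g : g \in finsupp E' -> exists j g', [/\ (j < n)%N, g' \in finsupp (E j),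
    g = up j g', term E' g = term (E j) g' * Q p ^+ j & pge (v f) (term E' g)].
  rewrite mem_finsupp seq_expansionE; case: ifP => [gr a0|]; last by rewrite eqxx.
  have [j [g' [jn g'E eg]]] := rP g gr.
  have te : term E' g = term (E j) g' * Q p ^+ j.
    by rewrite /Defs.term seq_expansionE gr eg tE.
  exists j, g'; split=> //; rewrite te -(subrK (beta p *+ j) (v f)).
  apply: pgeM; last exact/pgeX/pge_val.
  have [fj ej] := hE j jn; apply: pgeW (free_pge fj g'E).
  have [c0 _] : ev (E j) != 0 /\ True.
    by split=> //; case: fj => _ /(_ _)[]//; apply/fset0Pn; exists g'.
  by apply/(pgeP _ _ c0); rewrite ej; apply: hv.
exists E' => //; split=> [g /E'P [j [g' [jn g'E -> _ _]]]|ne].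
  have [[fj _] ej] := hE j jn; have [hg' g'p] := fj g' g'E; split.
    exact: (std_add (ltW pl) (good_alpha gl) nx hg' g'p (leq_trans jn na)).
  rewrite /up fsfun_withE; have [e|_] := eqVneq l p; first by move: pl; rewrite e ltxx.
  apply/eqP; apply: contrapT => /negP /(std_supp hg').
  by rewrite leNgt pl.
rewrite evE'; split=> //; split; last first.
  move=> b [g gE ->]; have [j [g' [jn g'E eg te /pgeP]]] := E'P g gE; apply.
  have [fj _] := hE j jn; rewrite te mulf_neq0 ?expf_neq0 ?(good_neq0 gp) //.
  rewrite /Defs.term scaler_eq0 negb_or (free_mono_neq0 gp fj) // andbT.
  by rewrite -mem_finsupp.
(* If no monomial had value [v f], all of them would be larger, and so would their sum [f]. *)
apply: contrapT => no; have /eqP := f0; apply; apply: (@pgt_val _ _ nu).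
rewrite -{2}evE' /Defs.ev big_seq; apply: pgt_sum => g gE.
have [_ [_ [_ _ _ _ ge]]] := E'P g gE.
have [->|t0] := eqVneq (term E' g) 0; first exact: pgt0.
apply/(pgtP _ _ t0); move/(pgeP _ _ t0): ge; rewrite le_eqVlt => /orP[/eqP e|//].
by case: no; exists g.
Qed.

(** By [free_size] the coefficients are reduced modulo [Q l], so a standard expansion is grouped
    exactly like the division expansion. *)
Lemma standard_expansion_dig l f n C : good l ->
  standard_expansion nu alpha Q setT l f n C ->
  forall j, dig (Q l) f j = if (j < n)%N then ev (C j) else 0.
Proof.
move=> gl [hC ->] j; apply: (dig_unique (c := fun i : nat => ev (C i))) => [|i /hC].
  exact: good_neq0 gl _.
exact: free_size.
Qed.

Definition expandable_below l : Prop := forall c, (size c < size (Q l))%N -> expandable l c.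

Lemma standard_expansion_ex l f n : good l -> expandable_below l ->
  f = \sum_(j < n) dig (Q l) f j * Q l ^+ j ->
  exists C, standard_expansion nu alpha Q setT l f n C.
Proof.
move=> gl fe ef; have /choice [C hC] : forall j, exists E, free l E /\ ev E = dig (Q l) f j.
  move=> j; have [|E] := fe (dig (Q l) f j); last by exists E.
  by apply: size_dig; apply: good_neq0 gl _.
exists C; split=> [j _|]; first by have [] := hC j.
by rewrite {1}ef; apply: eq_bigr => j _; have [_ ->] := hC j.
Qed.

Lemma jumpsP l f : good l -> expandable_below l -> skey nu (Q l) (beta l) ->
  jumps nu alpha Q setT l f <-> ~ exact_at (Q l) f.
Proof.
move=> gl fe sk; have q0 := skey_neq0 sk; split=> [[[n [C hC]] h] hn|hn].
  have dE := standard_expansion_dig gl hC.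
  have [m [[j [jn c0 em]] _] lt] := h n C hC.
  have d0 : dig (Q l) f j != 0 by rewrite dE jn.
  have f0 : f != 0 by apply: contra_neq d0 => ->; rewrite dig0.
  have := hn _ (pge_val nu f) j; rewrite dE jn /= => /(pgeP _ _ c0) le.
  move: lt; rewrite em vM ?expf_neq0 // vX // => lt; suff /(le_lt_trans le) : v (ev (C j)) < v f - v (Q l) *+ j.
    by rewrite ltxx.
  by apply: (og_shift_lt lt); zring.
split.
  have [n [ef _]] := dig_expand_ex f (skey_size sk).
  by exists n; apply: standard_expansion_ex.
move=> n C hC; have dE := standard_expansion_dig gl hC.
have f0 : f != 0 by apply: contra_notN hn => /eqP ->; apply: exact_at0.
have [m [hm nm]] := wexact_ex sk f0; exists m; last first.
  exact/(pgtP _ _ f0)/(Nexact_at_val sk hm nm hn).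
split=> [|b [j [jn c0 ->]]].
  have /existsNP [j nj'] := nm; have [d0 vd] := v_exact (hm j) nj'.
  have jn : (j < n)%N by rewrite ltnNge; apply: contra d0 => le; rewrite dE ltnNge le.
  move: d0 vd; rewrite dE jn => d0 vd; exists j; split=> //.
  by rewrite vM ?expf_neq0 // vX // vd subrK.
have := hm j; rewrite dE jn /= => /(pgeP _ _ c0) le.
by rewrite vM ?expf_neq0 // vX //; apply: (og_shift_le le); zring.
Qed.

Lemma is_expansion_dig l f D : Q l != 0 -> is_expansion Q l f D ->
  forall j, D`_j = dig (Q l) f j.
Proof.
move=> q0 [-> sD] j; rewrite horner_coef (dig_unique (c := fun i : nat => D`_i)) //.
by case: ltnP => // /(nth_default 0).
Qed.

Lemma is_expansion_ex l f : (1 < size (Q l))%N -> exists D, is_expansion Q l f D.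
Proof.
move=> sq; have q0 : Q l != 0 by rewrite -size_poly_gt0; apply: ltnW.
have [n [ef _]] := dig_expand_ex f sq; exists (\poly_(j < n) dig (Q l) f j); split.
  by rewrite horner_poly -ef.
move=> j; rewrite coef_poly; case: ifP => _; first exact: size_dig.
by rewrite size_poly0 ltnW.
Qed.

Lemma truncation_jump l f : skey nu (Q l) (beta l) ->
  (exists2 m, truncation nu Q l f m & m < v f) <-> ~ exact_at (Q l) f.
Proof.
move=> sk; have q0 := skey_neq0 sk; split=> [[m [D hD [[j d0 em] _]] lt] hn|hn].
  have e := is_expansion_dig q0 hD; rewrite e in d0 em.
  have := hn _ (pge_val nu f) j => /(pgeP _ _ d0) le; move: lt; rewrite em => lt.
  suff /(le_lt_trans le) : v (dig (Q l) f j) < v f - v (Q l) *+ j by rewrite ltxx.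
  by apply: (og_shift_lt lt); zring.
have f0 : f != 0 by apply: contra_notN hn => /eqP ->; apply: exact_at0.
have [m [hm nm]] := wexact_ex sk f0; exists m; last first.
  exact/(pgtP _ _ f0)/(Nexact_at_val sk hm nm hn).
have [D hD] := is_expansion_ex f (skey_size sk); have e := is_expansion_dig q0 hD.
exists D => //; split=> [|b [j]].
  have /existsNP [j nj'] := nm; have [d0 vd] := v_exact (hm j) nj'.
  by exists j; rewrite e ?vd ?subrK.
rewrite e => d0 ->; have := hm j => /(pgeP _ _ d0) le.
by apply: (og_shift_le le); zring.
Qed.

Lemma limit_jumpP l f :
  (forall t j, (0 < t)%N -> is_plus l t j -> skey nu (Q j) (beta j)) ->
  limit_jump nu Q l f <->
  f \is monic /\ forall t j, (0 < t)%N -> is_plus l t j -> ~ exact_at (Q j) f.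
Proof.
move=> sk; split=> -[fm h]; split=> // t j t0 lj; have := h t j t0 lj.
  by move=> /(truncation_jump _ (sk t j t0 lj)).
by move=> /(truncation_jump _ (sk t j t0 lj)).
Qed.

Lemma good_dg_mono i j : good j -> (i <= j)%O -> (deg_at i <= deg_at j)%N.
Proof.
elim/(well_founded_ind W_wf): j => j IH gj; rewrite le_eqVlt => /orP[/eqP->//|ij].
have [_ _ aj [e|[p pj e]|[i0 [i0j a1 le]]]] := gj j (lexx j).
- by move: ij; rewrite e ltx0.
- have [pj' _] := pj; apply: leq_trans (IH p pj' (good_le (ltW pj') gj) (is_succ_le pj ij)) _.
  by rewrite e leq_pmull.
have [t [k [ik kj dk]]] : exists t k, [/\ (i <= k)%O, (k < j)%O & is_plus i0 t k].
  have [lt|le'] := ltP i i0; first by exists 0%N, i0; rewrite ltW // (omega_gt i0j).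
  by have [t it] := omega_between i0j le' ij; exists t, i.
apply: leq_trans (IH k kj (good_le (ltW kj) gj) ik) _.
rewrite (dg_plus (good_le (ltW kj) gj) _ dk) => [|s m h _]; last exact: a1 h.
by apply: leq_trans le; rewrite leq_pmull.
Qed.

(** * The procedure *)

Definition succ_data p i : Prop :=
  [/\ is_succ p i, key_successor nu alpha Q setT p i, deg_at i = (alpha i * deg_at p)%N
    & alpha i = 1%N -> beta p < beta i].

Definition lim_data i : Prop := exists l,
  [/\ is_plus_omega l i,
      forall t j, (0 < t)%N -> is_plus l t j -> alpha j = 1%N,
      limit_jump nu Q l (Q i),
      forall f, limit_jump nu Q l f -> (degree (Q i) <= degree f)%N
    & forall t j D, (0 < t)%N -> is_plus l t j ->
        is_expansion Q j (Q i) D -> alpha i = degree D].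

Definition cofinal_degree (L : set W) (n : nat) : Prop :=
  forall f, f \is monic -> degree f = n ->
    exists2 i, L i /\ degree (Q i) = n & v f <= beta i.

(** Remembers that an infinite block was added because no maximum was attained: it excludes a limit
    polynomial of the same degree as the block. *)
Definition tail_block (L : set W) l : Prop :=
  [/\ L l, forall i, L i -> (l < i)%O -> exists t, is_plus l t i,
      forall t j, (0 < t)%N -> is_plus l t j -> alpha j = 1%N
    & forall f, f \is monic -> size f = size (Q l) ->
        exists t j, [/\ is_plus l t j, L j & v f <= beta j]].

(* Expansions are claimed only when [beta i] lies in the divisible hull: at a
   limit index whose predecessors have unbounded values, [degree (Q i)] need not
   be a multiple of the degree of the predecessors. *)
Record key_invariant (L : set W) : Prop := KeyInvariant {
  inv_seg : initial_segment L;
  inv_monic : forall i, L i -> Q i \is monic;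
  inv_alpha : forall i, L i -> (0 < alpha i)%N;
  inv_skey : forall i, L i -> skey nu (Q i) (beta i);
  inv_kind : forall i, L i -> [\/ i = \bot%O, exists p, succ_data p i | lim_data i];
  inv_hull : forall i, L i -> ~ is_max L i -> hull (beta i);
  inv_expandable : forall i, L i -> hull (beta i) -> expandable_below i;
  inv_cof : forall n, finite_set [set i | L i /\ degree (Q i) = n] \/ cofinal_degree L n;
  inv_tail : ~ (exists l, is_max L l) ->
    (exists n, forall i, L i -> (deg_at i <= n)%N) -> exists l, tail_block L l }.

Lemma expansion_degree l f D : (1 < size (Q l))%N -> f != 0 -> is_expansion Q l f D ->
  (degree D * deg_at l < size f)%N /\ (size f <= (degree D).+1 * deg_at l)%N.
Proof.
move=> sq f0 hD; have q0 : Q l != 0 by rewrite -size_poly_gt0 ltnW.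
have e := is_expansion_dig q0 hD; have D0 : D != 0.
  by apply: contra_neq f0 => D0; have [-> _] := hD; rewrite D0 horner0.
split.
  apply: dig_neq0_size => //; rewrite -e -lead_coefE.
  by rewrite lead_coef_eq0.
have [-> sD] := hD; rewrite horner_coef.
have -> : (degree D).+1 = size D by rewrite /degree prednK // size_poly_gt0.
exact: (size_low (c := fun n => D`_n)) (ltnW sq) _.
Qed.

Lemma inv_size L i : key_invariant L -> L i -> (1 < size (Q i))%N.
Proof. by move=> iL Li; apply: skey_size (inv_skey iL Li). Qed.

Lemma inv_good L l : key_invariant L -> L l -> good l.
Proof.
move=> iL Ll i il; have [_ seg] := inv_seg iL; have Li := seg _ _ Ll il.
split; [exact: inv_monic iL _ Li|exact: inv_size iL Li|exact: inv_alpha iL _ Li|].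
case: (inv_kind iL Li) => [->|[p [pi _ e _]]|[l' [l'i a1 [im _] _ al]]].
- exact: Or31.
- by apply: Or32; exists p.
(* The block is entered one index later, because [alpha l'] itself may exceed 1. *)
have [k l'k] := omega_ex l'i 1; apply: Or33; exists k.
have ki := omega_lt l'i l'k; have Lk := seg _ _ Li (ltW ki).
split; first exact: omega_shift l'k.
  by move=> t j kj; apply: (a1 (1 + t)%N) => //; apply: is_plusD kj.
have sk := inv_size iL Lk.
have [D hD] := is_expansion_ex (Q i) sk; rewrite (al 1%N k D) //.
have [h _] := expansion_degree sk (monic_neq0 im) hD.
by move: h; rewrite -{1}(prednK (ltnW (inv_size iL Li))) ltnS.
Qed.

Lemma upto_inv L l : key_invariant L -> L l -> upto L l = uptoT l.
Proof. by move=> /inv_seg; apply: upto_initial. Qed.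

Lemma free_inv L l E : key_invariant L -> L l -> free_expansion nu alpha Q L l E <-> free l E.
Proof.
by move=> iL Ll; rewrite /free_expansion /standard_exponent (upto_inv iL Ll).
Qed.

Lemma free_before l E g i : free l E -> g \in finsupp E -> g i != 0%N ->
  before setT l i.
Proof.
move=> [h _] /h [hg gl] gi; split=> //; rewrite lt_neqAle (std_supp hg gi) andbT.
by apply: contra_neq gi => ->.
Qed.

Lemma hull_ev l E : (forall i, (i < l)%O -> Q i != 0 /\ hull (beta i)) -> free l E ->
  ev E != 0 -> hull (v (ev E)).
Proof.
move=> h fE e0; have ne : finsupp E != fset0.
  by apply: contra_neq e0 => e; rewrite /Defs.ev e big_nil.
have [_ /(_ ne) [_ [[g gE ->] _]]] := fE.
apply: (hull_term (@value_group_K0 _ _ nu) (@value_group_KB _ _ nu) _ gE).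
  by move=> a a0; exists a.
by move=> i gi; apply: h; have [_] := free_before fE gE gi.
Qed.

Lemma adjoin_small l c : expandable_below l -> (size c < size (Q l))%N ->
  adjoin Q (before setT l) (inp nu c).
Proof.
move=> fe /fe [E fE <-]; rewrite inp_cls; apply: adjoin_ev => g gE; split.
  exact: free_pge fE _ gE.
by move=> i; apply: free_before fE gE.
Qed.

Lemma inv_hull_below L l i : key_invariant L -> L l -> (i < l)%O -> Q i != 0 /\ hull (beta i).
Proof.
move=> iL Ll il; have [_ seg] := inv_seg iL; have Li := seg _ _ Ll (ltW il).
split; first exact: skey_neq0 (inv_skey iL Li).
by apply: (inv_hull iL) => // -[_ /(_ l Ll)]; rewrite leNgt il.
Qed.

(** * Steps from a maximal index *)

Section StepFromMax.
Variables (L : set W) (l : W) (a : nat) (E : nat -> expansion K W).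
Hypothesis iL : key_invariant L.
Hypothesis lmax : is_max L l.
Hypothesis hE : forall j : nat, (j < a)%N -> homogeneous_expansion nu alpha Q L l (E j).
Hypothesis mp : minimal_polynomial (adjoin Q (before L l)) (inp nu (Q l))
  (initial_relation nu Q a E).

Let Ll : L l. Proof. by case: lmax. Qed.
Let sk : skey nu (Q l) (beta l) := inv_skey iL Ll.
Let q0 : Q l != 0 := skey_neq0 sk.
Let A := adjoin (nu := nu) Q (before setT l).

Lemma step_free (j : nat) : (j < a)%N -> free l (E j).
Proof. by move=> /hE [/(free_inv _ iL Ll)]. Qed.

Lemma step_adjoin (j : nat) : (j < a)%N -> A (inp nu (ev (E j))).
Proof.
move=> ja; rewrite inp_cls; apply: adjoin_ev => g gE; split.
  exact: (free_pge (step_free ja) gE).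
by move=> i; apply: free_before (step_free ja) gE.
Qed.

Let mp' : minimal_polynomial A (inp nu (Q l)) ('X^a + \poly_(j < a) inp nu (ev (E j))).
Proof.
rewrite /A -(before_initial (inv_seg iL) Ll) -(initial_relationE (Q := Q) (E := E)) //.
by move=> j /hE; apply: homogeneous_coef.
Qed.

Let A0 : A 0 := subring_gen0 _.

(** Homogeneity of the relation gives [beta l *+ (a - j) = v (ev (E j))] for a nonzero coefficient,
    which involves only earlier key polynomials, all of value in the hull. *)
Lemma step_hull : hull (beta l).
Proof.
have [j ja c0] := relation_nontrivial sk A0 mp' step_adjoin.
have e := relation_value sk A0 mp' step_adjoin ja c0.
apply: (@hull_div _ _ _ (a - j)); first by rewrite subn_gt0.
have -> : beta l *+ (a - j) = v (ev (E j)).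
  by apply: (@addIr _ (v (Q l) *+ j)); rewrite e -mulrnDr subnK // ltnW.
by apply: hull_ev (step_free ja) c0 => i; apply: inv_hull_below iL Ll.
Qed.

Let fel : expandable_below l := inv_expandable iL Ll step_hull.

Lemma step_exact_at f : (size f <= a * deg_at l)%N -> exact_at (Q l) f.
Proof.
apply: (relation_exact_at sk A0 mp') => c; exact: adjoin_small.
Qed.

Lemma step_lift : pgt (beta l *+ a) (Q l ^+ a + \sum_(j < a) ev (E j) * Q l ^+ j).
Proof. exact: (relation_lift sk A0 mp' step_adjoin). Qed.

Lemma step_minimal : minimal_polynomial (gstar A) (inp nu (Q l)) (initial_relation nu Q a E).
Proof.
apply: minimal_polynomial_gstar; [exact: subring_gen1|exact: subring_gen_mul|].
by rewrite /A -(before_initial (inv_seg iL) Ll).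
Qed.

Lemma step_term (j : nat) g : (j < a)%N -> g \in finsupp (E j) ->
  v (term (E j) g * Q l ^+ j) = v (Q l ^+ a).
Proof.
move=> ja gE; have fj := step_free ja.
have t0 : term (E j) g != 0.
  rewrite /Defs.term scaler_eq0 negb_or (free_mono_neq0 (inv_good iL Ll) fj gE) andbT.
  by rewrite -mem_finsupp.
rewrite vM ?expf_neq0 // !vX //; have [[_ h] [b hb]] := hE ja.
have [ne|[e0 [[g' g'E e] _]]] : finsupp (E j) = fset0 \/ (ev (E j) != 0 /\
   is_least [set b | exists2 g, g \in finsupp (E j) & b = v (term (E j) g)] (v (ev (E j)))).
  by have [->|/h] := eqVneq (finsupp (E j)) fset0; [left|right].
  by move: gE; rewrite ne.
by rewrite (hb g gE) -(hb g' g'E) -e; exact: (relation_value sk A0 mp' step_adjoin ja e0).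
Qed.

(* Excludes a relation of degree one once a maximum has been attained. *)
Lemma step_improve : a = 1%N ->
  exists2 f, same_degree Q l f & beta l < v f.
Proof.
move=> a1; have h := step_lift; rewrite a1 big_ord1 expr0 mulr1 expr1 mulr1n in h.
have sw : (size (ev (E 0%N)) < size (Q l))%N.
  by apply: (free_size (inv_good iL Ll)); apply: step_free; rewrite a1.
exists (Q l + ev (E 0%N)); first by exists (ev (E 0%N)).
apply/(pgtP _ _ _) => //; rewrite monic_neq0 //.
by case: (monicDl (inv_monic iL Ll) sw).
Qed.

Section Successor.
Variable k : W.
Hypothesis a1 : (1 < a)%N.
Hypothesis lk : is_succ l k.
Hypothesis ak : alpha k = a.
Hypothesis Qk : Q k = lift_relation Q l a E.

Let lk' : (l < k)%O. Proof. by case: lk. Qed.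

Lemma succ_size : Q k \is monic /\ size (Q k) = (a * deg_at l).+1.
Proof.
rewrite Qk; apply: (size_monic_plus (c := fun j : nat => ev (E j))) => [||j ja]; first exact: inv_monic iL _ Ll.
  exact: inv_size iL Ll.
exact: (free_size (inv_good iL Ll) (step_free ja)).
Qed.

(** The leading digit 1 keeps the truncation at [beta l *+ a] at most, while the lifted relation is
    worth strictly more. *)
Lemma succ_Nexact_at : ~ exact_at (Q l) (Q k).
Proof.
have [km sz] := succ_size; have h := step_lift.
move=> hn; have hQ : pgt (beta l *+ a) (Q k) by rewrite Qk.
have := @exact_at_cmp _ _ nu true _ _ _ hn hQ a.
rewrite /= subrr; have -> : dig (Q l) (Q k) a = 1; last first.
  by move=> /(pgtP _ _ (oner_neq0 _)); rewrite v1 ltxx.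
rewrite Qk /lift_relation digD [X in _ + X]dig_oversize ?addr0 //.
  rewrite -[_ ^+ a]mul1r dig_mulqX // leqnn subnn /dig /= modp_small //.
  by rewrite size_polyC oner_eq0 (inv_size iL Ll).
apply: (size_low (c := fun i : nat => ev (E i))) => [|i ia].
  exact: ltnW (inv_size iL Ll).
exact: (free_size (inv_good iL Ll) (step_free ia)).
Qed.

Lemma succ_skey : skey nu (Q k) (beta k).
Proof.
have [km sz] := succ_size; have [sl dl] : (1 < size (Q l))%N /\ (0 < deg_at l)%N.
  by have := inv_size iL Ll; split=> //; apply: good_dg (inv_good iL Ll).
have k0 := monic_neq0 km.
split=> //; [by rewrite sz ltnS muln_gt0 dl (ltnW a1)|exact: pge_val|].
move=> f h' c sf sg h.
have sm : (size ((f * h') %% Q k)%R < size (Q k))%N by rewrite ltn_modp.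
have sd := size_carry k0 sf sg.
by apply: (carry_of_jump sk km succ_Nexact_at) => //; apply: step_exact_at; rewrite -ltnS -sz.
Qed.

Lemma succ_next : is_next alpha (uptoT k) l k.
Proof.
split; first by split.
right; split=> // -[[m lm [_ mk]] _].
have := omega_lt lm (ex_intro2 _ _ l erefl lk : is_plus l 1 k).
by rewrite ltNge mk.
Qed.

Lemma succ_succ_data : succ_data l k.
Proof.
have [km sz] := succ_size; split=> //; last 2 first.
- by rewrite /deg_at sz ak.
- by rewrite ak => e; move: a1; rewrite e.
exists E; rewrite ak; split=> //.
- by move=> j /step_free.
- by move=> j g; apply: step_term.
- exact: step_minimal.
Qed.

Lemma succ_good : good k.
Proof.
move=> i; rewrite le_eqVlt => /orP[/eqP->|ik]; last first.
  exact: (inv_good iL Ll) (is_succ_le lk ik).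
have [km sz] := succ_size; split=> //; first exact: skey_size succ_skey.
  by rewrite ak ltnW.
by apply: Or32; exists l => //; rewrite /deg_at sz ak.
Qed.

(** Minimality of the relation makes [Q l] exact below the degree of [Q k], so a division by powers
    of [Q l] has the term values needed to assemble an expansion. *)
Lemma succ_expandable : expandable_below k.
Proof.
move=> f sf; have [->|f0] := eqVneq f 0; first exact: expandable0.
have [km sz] := succ_size.
have sf' : (size f <= a * deg_at l)%N by rewrite -ltnS -sz.
have ef := dig_expand q0 sf'; have n := step_exact_at sf'.
apply: (expandable_combine succ_good lk' succ_next _ f0 ef); rewrite ?ak //.
  by move=> j _; apply: fel; apply: size_dig.
by move=> j _; apply: n.
Qed.

Lemma step_successor_inv : key_invariant (L `|` [set k]).
Proof.
have [km sz] := succ_size; have [_ seg] := inv_seg iL.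
have new i : (L `|` [set k]) i -> L i \/ i = k by [].
split.
- split=> [|i j [Lj|->] ij]; first by left; case: (inv_seg iL).
    by left; apply: seg ij.
  move: ij; rewrite le_eqVlt => /orP[/eqP->|ik]; first by right.
  by left; apply: seg Ll _; apply: is_succ_le ik.
- by move=> i [/(inv_monic iL)|->].
- by move=> i [/(inv_alpha iL)//|->]; rewrite ak ltnW.
- by move=> i [/(inv_skey iL)//|->]; apply: succ_skey.
- move=> i [/(inv_kind iL)//|->]; apply: Or32; exists l; exact: succ_succ_data.
- move=> i [Li|->] nm; last first.
    case: nm; split=> [|j [Lj|->//]]; first by right.
    by apply: ltW; apply: le_lt_trans lk'; case: lmax => _; apply.
  have [e|ne] := eqVneq i l; first by rewrite e; apply: step_hull.
  apply: (inv_hull iL) => // -[_ im]; move/eqP: ne; apply; apply: le_anti.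
  by rewrite im // andbT; case: lmax => _; apply.
- move=> i [Li|->] hi; first exact: (inv_expandable iL Li hi).
  exact: succ_expandable.
- move=> n; have [fin|cof] := inv_cof iL n; [left|right].
    apply: (@sub_finite_set _ _ ([set i | L i /\ degree (Q i) = n] `|` [set k])).
      by move=> i [[Li|->] e]; [left|right].
    by rewrite finite_setU.
  by move=> f fm fn; have [i [Li e] h] := cof f fm fn; exists i => //; split=> //; left.
- move=> no; case: no; exists k; split; first by right.
  by move=> j [Lj|->//]; apply: ltW; apply: le_lt_trans lk'; case: lmax => _; apply.
Qed.

Lemma step_successor_dg : (deg_at l < deg_at k)%N.
Proof.
have [_ sz] := succ_size; rewrite {2}/deg_at sz /= -{1}(mul1n (deg_at l)) ltn_pmul2r //.
exact: good_dg (inv_good iL Ll).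
Qed.

End Successor.
End StepFromMax.

(** Applied with [r] a partial sum, [z] the next increment and [x] a far better approximation: [r]
    must cancel [z] to first order. *)
Lemma partial_value (x r z y : {poly K}) : z != 0 -> x = r + z + y ->
  pgt (v z) x -> pgt (v z) y -> r != 0 /\ v r = v z.
Proof.
move=> z0 ex hx hy; have -> : r = - z + (x - y) by rewrite ex; ring.
by apply: v_dom; rewrite ?oppr_eq0 ?vN //; apply: pgtB.
Qed.

(** * Blocks of key polynomials of equal degree, finite or infinite *)

Section Block.
Variables (L L' : set W) (l : W) (z : nat -> expansion K W) (P : nat -> Prop).
Hypothesis iL : key_invariant L.
Hypothesis lmax : is_max L l.
Hypothesis hl : hull (beta l).
Hypothesis P0 : forall t, P t -> (0 < t)%N.
Hypothesis Pd : forall s t, (0 < s)%N -> (s <= t)%N -> P t -> P s.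
Hypothesis add : add_partial_sums alpha Q L l z P L'.
Hypothesis hz : forall q, P q.+1 ->
  homogeneous_expansion nu alpha Q L l (z q) /\ ev (z q) != 0.

Let Ll : L l. Proof. by case: lmax. Qed.
Let sk : skey nu (Q l) (beta l) := inv_skey iL Ll.

Definition psum t : {poly K} := Q l + \sum_(q < t) ev (z q).
Notation R := psum.

Lemma psumS t : R t.+1 = R t + ev (z t).
Proof. by rewrite /psum big_ord_recr addrA. Qed.

Lemma psum0 : R 0%N = Q l.
Proof. by rewrite /psum big_ord0 addr0. Qed.

Hypothesis hv : forall q, P q.+1 -> v (R q) = v (ev (z q)).
Hypothesis hlt : forall q, P q.+1 -> v (R q) < v (R q.+1).

Lemma block_free q : P q.+1 -> free l (z q).
Proof. by move=> /hz [[/(free_inv _ iL Ll)]]. Qed.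

Lemma block_small q : P q.+1 -> (size (ev (z q)) < size (Q l))%N.
Proof. by move=> h; apply: (free_size (inv_good iL Ll) (block_free h)). Qed.

(** An increment has the value of the current partial sum, so [skey_shift] applies at that weight;
    the weight is then raised to the value of the new sum. *)
Lemma block_psum t : P t \/ t = 0%N ->
  [/\ R t \is monic, size (R t) = size (Q l) & skey nu (R t) (v (R t))].
Proof.
elim: t => [_|t IH [Pt|//]]; first by rewrite psum0; split=> //; apply: inv_monic iL _ Ll.
have [m s sR] : [/\ R t \is monic, size (R t) = size (Q l) & skey nu (R t) (v (R t))].
  by apply: IH; case: t Pt => [|t] Pt; [right|left; apply: Pd Pt].
have sz := block_small Pt; rewrite -s in sz.
have [m' s'] := monicDl m sz; rewrite psumS m' s' s; split=> //.
have sw : skey nu (R t + ev (z t)) (v (R t)).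
  by apply: skey_shift sR sz _; rewrite hv //; apply: pge_val.
apply: skey_weight sw _ (pge_val _ _); rewrite -psumS; exact/ltW/hlt.
Qed.

Lemma block_new t : P t -> exists k, [/\ is_plus l t k, alpha k = 1%N & Q k = R t].
Proof. by case: add => h _ /h. Qed.

Lemma block_newE t k : P t -> is_plus l t k -> alpha k = 1%N /\ Q k = R t.
Proof. by move=> /block_new [k' [lk' a q]] /(is_plus_uniq lk') <-. Qed.

Lemma block_QE t k : P t \/ t = 0%N -> is_plus l t k -> Q k = R t.
Proof. by case=> [Pt /(block_newE Pt)[]//|-> /= ->]; rewrite psum0. Qed.

Lemma block_mem k : L' k <-> L k \/ exists2 t, P t & is_plus l t k.
Proof. by case: add => _ ->. Qed.

Lemma block_size t k : P t \/ t = 0%N -> is_plus l t k -> size (Q k) = size (Q l).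
Proof. by move=> Pt lk; rewrite (block_QE Pt lk); case: (block_psum Pt). Qed.

Lemma block_prev t : P t.+1 -> P t \/ t = 0%N.
Proof. by case: t => [|t] Pt; [right|left; apply: Pd Pt]. Qed.

Lemma block_good t k : P t \/ t = 0%N -> is_plus l t k -> good k.
Proof.
move=> Pt lk i ik; have [il|li] := leP i l; first exact: (inv_good iL Ll il).
have [[|s] st ls] := is_plus_between lk (ltW li) ik.
  by move: li; rewrite (ls : i = l) ltxx.
have Ps : P s.+1 by case: Pt => [|t0]; [apply: Pd|move: st; rewrite t0].
have [ai Qi] := block_newE Ps ls; have [m sz _] := block_psum (or_introl Ps).
split; rewrite ?Qi ?ai // ?sz ?(inv_size iL Ll) //.
apply: Or32; have [p lp pi] := ls; exists p => //.
by rewrite ai mul1n /deg_at (block_size (or_introl Ps) ls) (block_size (block_prev Ps) lp).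
Qed.

(** The relation has degree one: adding the increment raises the value, so the initial form of [Q p]
    is minus that of the increment. *)
Lemma block_succ t p k : P t.+1 -> is_plus l t p -> is_succ p k -> succ_data p k.
Proof.
move=> Pt lp pk; have lk : is_plus l t.+1 k by exists p.
have Pt' := block_prev Pt.
have Qp := block_QE Pt' lp; have [ak Qk] := block_newE Pt lk.
have [[h b'] e0] := hz Pt; have fz := block_free Pt.
have lep := is_plus_le lp; have gp := block_good Pt' lp.
have zp : free p (z t) := free_up lep gp fz.
have vp : v (Q p) = v (ev (z t)) by rewrite Qp hv.
have q0 : Q p != 0 by apply: good_neq0 gp _.
have QkE : Q k = Q p + ev (z t) by rewrite Qk psumS Qp.
have lt : v (Q p) < v (Q k) by rewrite Qp Qk; apply: hlt.
have k0 : Q k != 0.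
  by rewrite Qk monic_neq0 //; case: (block_psum (or_introl Pt)).
split=> //; last first.
  by rewrite ak mul1n /deg_at (block_size (or_introl Pt) lk) (block_size Pt' lp).
exists (fun=> z t); rewrite ak; split=> //.
- by rewrite /lift_relation big_ord1 expr0 mulr1 expr1.
- move=> [|//] g' _ gE; rewrite expr0 mulr1 expr1 vp.
  have ne : finsupp (z t) != fset0 by apply/fset0Pn; exists g'.
  have [b hb] := b'; have [_ /(_ ne) [_ [[g'' g''E e] _]]] := h.
  by rewrite e !hb.
apply: minimal_polynomial_gstar; [exact: subring_gen1|exact: subring_gen_mul|].
have hE (j : nat) : (j < 1)%N -> \sum_(g <- finsupp (z t)) inK nu ((fun=> z t) j g) *
    inp nu (mono g) = inp nu (ev (z t)).
  by move=> _; apply: (homogeneous_coef (alpha := alpha) (L := L) (l := l)).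
rewrite (initial_relationE (C := fun=> ev (z t)) hE).
apply: minimal_polynomial1 => //; [exact: subring_gen0|exact: subring_gen1| |].
  rewrite inp_cls; apply: adjoin_ev => g' gE; split; first exact: (free_pge fz gE).
  move=> i gi; have [_ il] := free_before fz gE gi; split=> //.
  exact: lt_le_trans il lep.
by apply: inp_opp_of_gt => //; rewrite -QkE; apply/(pgtP _ _ k0).
Qed.

Lemma block_lt t k i : P t -> is_plus l t k -> L i -> (i < k)%O.
Proof.
move=> Pt lk Li; apply: (@le_lt_trans _ _ l); first by case: lmax => _; apply.
by case: t Pt lk => [/P0//|t] _; apply: is_plus_lt0.
Qed.

Lemma block_inv :
  (forall n, finite_set [set i | L' i /\ degree (Q i) = n] \/ cofinal_degree L' n) ->
  (~ (exists l, is_max L' l) -> exists l, tail_block L' l) -> key_invariant L'.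
Proof.
move=> cof tail; have [_ seg] := inv_seg iL; split=> //.
- split=> [|i j]; first by apply/block_mem; left; case: (inv_seg iL).
  move=> /block_mem [Lj|[t Pt lj]] ij; apply/block_mem.
    by left; apply: seg Lj ij.
  have [il|li] := leP i l; first by left; apply: seg Ll il.
  have [[|s] st ls] := is_plus_between lj (ltW li) ij.
    by move: li; rewrite (ls : i = l) ltxx.
  by right; exists s.+1 => //; apply: Pd Pt.
- move=> i /block_mem [/(inv_monic iL)//|[t Pt li]].
  by rewrite (block_QE (or_introl Pt) li); case: (block_psum (or_introl Pt)).
- by move=> i /block_mem [/(inv_alpha iL)//|[t Pt li]]; case: (block_newE Pt li) => ->.
- move=> i /block_mem [/(inv_skey iL)//|[t Pt li]].
  by rewrite /Defs.beta (block_QE (or_introl Pt) li); case: (block_psum (or_introl Pt)).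
- move=> i /block_mem [/(inv_kind iL)//|[[/P0//|t] Pt [p lp pi]]].
  by apply: Or32; exists p; apply: block_succ Pt lp pi.
- move=> i Li nm; have [j L'j ij] : exists2 j, L' j & (i < j)%O.
    apply: contrapT => no; apply: nm; split=> // j L'j; rewrite leNgt; apply/negP => ij.
    by apply: no; exists j.
  move: Li => /block_mem [Li|[t Pt li]].
    have [->//|ne] := eqVneq i l; apply: (inv_hull iL) => // -[_ im].
    by move/eqP: ne; apply; apply: le_anti; rewrite im // andbT; case: lmax => _; apply.
  have [s Ps lj] : exists2 s, P s & is_plus l s j.
    move: L'j => /block_mem [Lj|[s Ps lj]]; last by exists s.
    by have := block_lt Pt li Lj; rewrite ltNge ltW.
  have Pt1 : P t.+1.
    apply: Pd Ps => //; rewrite ltnNge; apply/negP => le; move: ij; rewrite ltNge.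
    move/negP; apply; have [lt|eq] := ltnP s t; first exact/ltW/(is_plus_lt lj li).
    have e : s = t by apply/eqP; rewrite eqn_leq le eq.
    by move: lj; rewrite e => /(is_plus_uniq li) ->.
  (* A nonmaximal member of the block has the value of its next increment, a [Q l]-free
     expansion. *)
  rewrite /Defs.beta (block_QE (or_introl Pt) li) hv //.
  have [_ e0] := hz Pt1; apply: hull_ev (block_free Pt1) e0 => j' j'l.
  exact: inv_hull_below iL Ll j'l.
- move=> i /block_mem [Li|[t Pt li]] hi; first exact: (inv_expandable iL Li hi).
  move=> c; rewrite (block_size (or_introl Pt) li) => /(inv_expandable iL Ll hl).
  by apply: expandable_up; [apply: is_plus_le li|apply: block_good (or_introl Pt) li].
- by move=> no _; apply: tail.
Qed.

End Block.

Lemma psum_split l z m n : (m <= n)%N ->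
  psum l z n = psum l z m + \sum_(m <= q < n) ev (z q).
Proof.
move=> mn; rewrite /psum -!(big_mkord xpredT (fun q => ev (z q))) -addrA.
by rewrite -big_cat_nat.
Qed.

Lemma pge_tail L l E b : tail_ge nu alpha Q L l E b -> pge b (ev E).
Proof.
move=> [fE h]; rewrite /Defs.ev big_seq; apply: pge_sum => g gE.
by right; apply: h.
Qed.

Lemma increasing_lt (u : nat -> {poly K}) n q q' :
  (forall q, (q < n)%N -> v (u q) < v (u q.+1)) -> (q < q')%N -> (q' <= n)%N ->
  v (u q) < v (u q').
Proof.
move=> inc; elim: q' => // q' IH; rewrite ltnS leq_eqVlt => /orP[/eqP->|lt] le.
  exact: inc.
by apply: lt_trans (inc _ le); apply: IH (ltnW le).
Qed.

Lemma step_attained_inv L l L' : key_invariant L -> is_max L l -> hull (beta l) ->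
  step_attained nu alpha Q L l L' ->
  key_invariant L' /\ exists2 k, is_max L' k & forall f, same_degree Q k f -> v f <= beta k.
Proof.
move=> iL lmax hl [w [s [z [tl [[sw wmax] ew hz [z0 zinc zs tlge] add]]]]].
have Ll : L l by case: lmax.
pose P t := (0 < t <= s.+1)%N; pose x := Q l + w.
have ql0 : Q l != 0 := skey_neq0 (inv_skey iL Ll).
have P0 t : P t -> (0 < t)%N by case/andP.
have Pd m t : (0 < m)%N -> (m <= t)%N -> P t -> P m.
  by move=> m0 mt /andP[_ ts]; apply/andP; split=> //; apply: leq_trans ts.
have hz' q : P q.+1 -> homogeneous_expansion nu alpha Q L l (z q) /\ ev (z q) != 0.
  by move=> /andP[_]; rewrite ltnS => /hz.
have ht : pge (v x) (ev tl) := pge_tail tlge.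
have ex : x = psum l z s.+1 + ev tl by rewrite /x ew addrA.
have zx q : (q <= s)%N -> v (ev (z q)) < v x.
  rewrite leq_eqVlt => /orP[/eqP->//|lt]; apply: lt_trans zs.
  exact: (increasing_lt (u := fun q => ev (z q)) zinc lt (leqnn s)).
have val q : (q <= s)%N -> psum l z q != 0 /\ v (psum l z q) = v (ev (z q)).
  move=> qs; have [_ e0] := hz q qs.
  apply: (@partial_value x _ _ (\sum_(q.+1 <= r < s.+1) ev (z r) + ev tl)) => //.
  - by rewrite ex (@psum_split _ _ q.+1 s.+1) // psumS -!addrA.
  - by apply: pgt_ltW (zx q qs) _; apply: pge_val.
  apply: pgtD; last exact: pgt_ltW (zx q qs) ht.
  rewrite big_seq; apply: pgt_sum => r; rewrite mem_index_iota => /andP[qr rs].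
  apply: pgt_ltW (pge_val _ _).
  exact: (increasing_lt (u := fun q => ev (z q)) zinc qr _).
have hv q : P q.+1 -> v (psum l z q) = v (ev (z q)).
  by move=> /andP[_]; rewrite ltnS => /val[].
(* The discarded tail is worth at least the maximum [v x], so the last partial sum still attains
   it. *)
have big : pge (v x) (psum l z s.+1).
  by rewrite -(addrK (ev tl) (psum l z s.+1)) -ex; apply: pgeB => //; apply: pge_val.
have sz q : (q <= s)%N -> (size (ev (z q)) < size (Q l))%N.
  move=> qs; have [[/(free_inv _ iL Ll) fq _] _] := hz q qs.
  exact: (free_size (inv_good iL Ll) fq).
have small m : (m <= s.+1)%N -> (size (\sum_(q < m) ev (z q))%R < size (Q l))%N.
  move=> ms; apply: (@leq_ltn_trans (size (Q l)).-1).
    apply: leq_trans (size_sum _ _ _) _; apply/bigmax_leqP => q _.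
    by rewrite -ltnS (ltn_predK (inv_size iL Ll)) sz // -ltnS; apply: leq_trans ms.
  by rewrite (ltn_predK (inv_size iL Ll)).
have pm m : (m <= s.+1)%N -> psum l z m != 0.
  by move=> /small /(monicDl (inv_monic iL Ll)) [/monic_neq0].
have hlt q : P q.+1 -> v (psum l z q) < v (psum l z q.+1).
  move=> /andP[_]; rewrite ltnS leq_eqVlt => /orP[/eqP->|qs]; last first.
    by rewrite (val q (ltnW qs)).2 (val q.+1 qs).2; apply: zinc.
  rewrite (val s (leqnn s)).2; apply: lt_le_trans zs _.
  by apply/(pgeP _ _ (pm s.+1 (leqnn _))).
have new := block_mem add.
have Ps : P s.+1 by rewrite /P /=.
have [k [lk ak Qk]] := block_new add Ps.
have L'k : L' k by apply/new; right; exists s.+1.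
have kmax : is_max L' k.
  split=> // j /new [Lj|[t Pt lj]]; first exact/ltW/(block_lt lmax P0 Ps lk).
  have /andP[_] := Pt; rewrite leq_eqVlt => /orP[/eqP e|lt].
    by move: lj; rewrite e => /(is_plus_uniq lk) ->.
  exact/ltW/(is_plus_lt lj lk).
split; last first.
  exists k => // f [w' sw' ->]; have [_ sk] := monicDl (inv_monic iL Ll) (small _ (leqnn s.+1)).
  have sQk : size (Q k) = size (Q l) by rewrite Qk.
  apply: (@le_trans _ _ (v x)); last first.
    by rewrite /Defs.beta Qk; apply/(pgeP _ _ (pm _ (leqnn _))).
  apply: wmax; exists (\sum_(q < s.+1) ev (z q) + w').
    rewrite sQk in sw'; apply: leq_ltn_trans (size_polyD _ _) _.
    by rewrite gtn_max small.
  by rewrite Qk /psum addrA.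
apply: (block_inv iL lmax hl P0 Pd add hz' hv hlt) => [n|]; last by case; exists k.
have [fin|cof] := inv_cof iL n; [left|right].
  have /choice [sg hs] : forall t, exists k, P t -> is_plus l t k.
    move=> t; case: (EM (P t)) => [/(block_new add) [k' [h _ _]]|]; first by exists k'.
    by exists l.
  apply: (@sub_finite_set _ _ ([set i | L i /\ degree (Q i) = n] `|` (sg @` `I_s.+2))).
    move=> i [/new [Li|[t Pt li]] e]; first by left.
    right; exists t; first by rewrite /= ltnS; case/andP: Pt.
    by apply: is_plus_uniq (hs t Pt) li.
  by rewrite finite_setU; split=> //; apply: finite_image; apply: finite_II.
move=> f fm fn; have [i [Li e] h] := cof f fm fn; exists i => //; split=> //.
by apply/new; left.
Qed.

Lemma step_unattained_inv L l L' : key_invariant L -> is_max L l -> hull (beta l) ->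
  step_unattained nu alpha Q L l L' -> key_invariant L' /\ ~ exists k, is_max L' k.
Proof.
move=> iL lmax hl [wt [z [tl [n [_ [swt Qinc cof] [hz zinc nex] step add]]]]].
have Ll : L l by case: lmax.
pose P t := (0 < t)%N; pose x t := Q l + wt t.
have P0 t : P t -> (0 < t)%N by [].
have Pd m t : (0 < m)%N -> (m <= t)%N -> P t -> P m by [].
have hz' q : P q.+1 -> homogeneous_expansion nu alpha Q L l (z q) /\ ev (z q) != 0.
  by move=> _; apply: hz.
have ht t : pge (v (x t)) (ev (tl t)) by have [_ _ _ h] := step t; apply: pge_tail h.
have ex t : x t = psum l z (n t) + ev (tl t).
  have [le e _ _] := step t; rewrite /x -(subrK (\sum_(q < (if t is t'.+1 then n t' else 0%N)) ev (z q)) (wt t)).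
  rewrite e /psum -[RHS]addrA; congr (_ + _); rewrite addrAC; congr (_ + _).
  by rewrite addrC -!(big_mkord xpredT (fun q => ev (z q))) -big_cat_nat.
have zx t q : (q < n t)%N -> v (ev (z q)) < v (x t) by have [_ _ h _] := step t; apply: h.
have zlt q r : (q < r)%N -> v (ev (z q)) < v (ev (z r)).
  by move=> qr; apply: (increasing_lt (u := fun q => ev (z q)) (n := r)) qr (leqnn r).
have hv q : P q.+1 -> v (psum l z q) = v (ev (z q)).
  move=> _; have [t qt] := nex q; have [_ e0] := hz q.
  apply: (@partial_value (x t) _ _ (\sum_(q.+1 <= r < n t) ev (z r) + ev (tl t)) e0 _ _ _).2.
  - by rewrite ex (@psum_split _ _ q.+1 (n t)) // psumS -!addrA.
  - by apply: pgt_ltW (zx t q qt) _; apply: pge_val.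
  apply: pgtD; last exact: pgt_ltW (zx t q qt) (ht t).
  rewrite big_seq; apply: pgt_sum => r; rewrite mem_index_iota => /andP[qr _].
  by apply: pgt_ltW (pge_val _ _); apply: zlt.
have hlt q : P q.+1 -> v (psum l z q) < v (psum l z q.+1).
  by move=> Pq; rewrite !hv.
have new := block_mem add.
have blk t : exists k, [/\ is_plus l t k, L' k & Q k = psum l z t].
  case: t => [|t]; first by exists l; split=> //; [apply/new; left|rewrite psum0].
  have [k [lk _ Qk]] := block_new add (ltn0Sn t : P t.+1).
  by exists k; split=> //; apply/new; right; exists t.+1.
have cofl f : f \is monic -> size f = size (Q l) ->
    exists t k, [/\ is_plus l t k, L' k & v f <= beta k].
  move=> fm fs; have [|t le] := cof f.
    exists (f - Q l); last by rewrite addrC subrK.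
    by rewrite -fs; apply: size_subr_monic => //; apply: inv_monic iL _ Ll.
  have [k [lk L'k Qk]] := blk (n t); exists (n t), k; split=> //.
  apply: le_trans le _; rewrite /Defs.beta Qk.
  have [|pmon _ _] := block_psum iL lmax Pd hz' hv hlt (t := n t).
    by case: (n t); [right|left].
  apply/(pgeP _ _ (monic_neq0 pmon)); rewrite -(addrK (ev (tl t)) (psum l z (n t))) -ex.
  by apply: pgeB; [apply: pge_val|apply: ht].
have nomax : ~ exists k, is_max L' k.
  move=> [k [L'k kmax]]; have [t lk] : exists t, is_plus l t k.
    move: L'k => /new [Lk|[t _ lk]]; last by exists t.
    exists 0%N; apply: le_anti; rewrite kmax ?andbT; last by apply/new; left.
    by case: lmax => _; apply.
  have [j [lj L'j _]] := blk t.+1.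
  by have := kmax j L'j; rewrite leNgt (is_plus_lt lk lj).
split=> //.
apply: (block_inv iL lmax hl P0 Pd add hz' hv hlt) => [m|_].
  (* Only the degree of the block acquires new indices, infinitely many; there cofinality follows
     from the choice of the approximations. *)
  have [e|ne] := eqVneq m (degree (Q l)).
    right=> f fm fn; have sl := inv_size iL Ll.
    have [|t [k [lk L'k le]]] := cofl f fm.
      move: fn; rewrite e /degree; have := monic_neq0 fm; rewrite -size_poly_gt0.
      by case: (size f) => // a _ /= ->; rewrite (ltn_predK sl).
    exists k => //; split=> //; rewrite e /degree; congr _.-1.
    apply: (block_size iL lmax Pd add hz' hv hlt _ lk).
    by case: (t); [right|left].
  have sub : [set i | L' i /\ degree (Q i) = m] `<=` [set i | L i /\ degree (Q i) = m].
    move=> i [/new [Li|[t Pt li]] em]; first by split.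
    case/eqP: ne; rewrite -em /degree; congr _.-1.
    exact: (block_size iL lmax Pd add hz' hv hlt (or_introl Pt) li).
  have [fin|c] := inv_cof iL m; [left; apply: sub_finite_set fin; exact: sub|right].
  move=> f fm fn; have [i [Li em] h] := c f fm fn; exists i => //; split=> //.
  by apply/new; left.
exists l; split=> //.
- by apply/new; left.
- move=> i /new [Li|[t _ li]]; last by exists t.
  by rewrite ltNge; case: lmax => _ ->.
- by move=> t j t0 lj; have [] := block_newE add (t0 : P t) lj.
Qed.

Hypothesis nuK_rank : rank_one GK.

Let GK0 : GK 0 := @value_group_K0 _ _ nu.
Let GKB := @value_group_KB _ _ nu.

Lemma chain_of L l (s : nat -> W) : key_invariant L -> (forall t, is_plus l t (s t)) ->
  (forall t, L (s t)) -> (forall t, alpha (s t.+1) = 1%N) -> chain nu (fun t => Q (s t)).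
Proof.
move=> iL ls Ls a1; have st t : is_succ (s t) (s t.+1).
  by have [p lp ps] := ls t.+1; rewrite (is_plus_uniq (ls t) lp).
have step t : size (Q (s t.+1)) = size (Q (s t)) /\ beta (s t) < beta (s t.+1).
  case: (inv_kind iL (Ls t.+1)) => [e|[p [pi _ e lt]]|[l' [h _ _ _ _]]].
  - by have [lt _] := st t; move: lt; rewrite e ltx0.
  - have ep := is_succ_inj pi (st t); rewrite ep in e lt; split; last exact: lt.
    move: e; rewrite a1 mul1n /deg_at.
    by rewrite -{2}(ltn_predK (inv_size iL (Ls t))) => <-; rewrite (ltn_predK (inv_size iL (Ls _))).
  - by case: (omega_nsucc h (st t)).
have sz t : size (Q (s t)) = size (Q (s 0%N)).
  by elim: t => // t IH; rewrite (step t).1.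
split=> [t|t t'|t]; first exact: (inv_skey iL (Ls t)).
  by rewrite (sz t) (sz t').
exact: (step t).2.
Qed.

Lemma beta_plus L i t j : key_invariant L -> L j -> is_plus i t j ->
  (forall r m, is_plus i r m -> (0 < r <= t)%N -> alpha m = 1%N) -> beta i <= beta j.
Proof.
move=> iL; elim: t j => [|t IH] j Lj /=; first by move=> ->.
move=> [p ip pj] a1; have [_ seg] := inv_seg iL; have [pj' _] := pj.
have le : beta i <= beta p.
  apply: IH ip _ => [|r m h /andP[r0 rt]]; first exact: seg Lj (ltW pj').
  by apply: a1 h _; rewrite r0 leqW.
apply: (le_trans le); case: (inv_kind iL Lj) => [e|[p' [p'j _ _ lt]]|[l' [h _ _ _ _]]].
- by move: pj'; rewrite e ltx0.
- have e := is_succ_inj p'j pj; rewrite e in lt; apply/ltW/lt.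
  by apply: (a1 t.+1 j); rewrite ?leqnn //; exists p.
- by case: (omega_nsucc h pj).
Qed.

Lemma hull_small l c : (forall i, (i < l)%O -> Q i != 0 /\ hull (beta i)) -> expandable_below l ->
  (size c < size (Q l))%N -> c != 0 -> hull (v c).
Proof.
by move=> h fe sc c0; have [E fE e] := fe c sc; rewrite -e; apply: hull_ev h fE _; rewrite e.
Qed.

(** * Limit indices and their key polynomials *)

Section LimitFacts.
Variables (L : set W) (i i0 : W).
Hypothesis iL : key_invariant L.
Hypothesis i0i : is_plus_omega i0 i.
Hypothesis a1 : forall t j, (0 < t)%N -> is_plus i0 t j -> alpha j = 1%N.
Hypothesis LL : forall t j, is_plus i0 t j -> L j /\ hull (beta j).
Hypothesis ldi : lim_data i.

(** The base [l] in [lim_data] need not be [i0]. Both lie on one sequence starting at the smaller of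
    the two, and since exactness persists along it, jumps transfer between the bases. *)
Lemma limit_facts : exists s : nat -> W,
  [/\ forall t, is_plus i0 t (s t), chain nu (fun t => Q (s t)),
      forall t, ~ exact_at (Q (s t)) (Q i),
      forall f, f \is monic -> (forall t, ~ exact_at (Q (s t)) f) -> (size (Q i) <= size f)%N
    & Q i \is monic /\ (alpha i * deg_at i0 < size (Q i) <= (alpha i).+1 * deg_at i0)%N].
Proof.
have [l [li l1 lj lmin lal]] := ldi.
have [m0 [a [b [ma mb ml m1]]]] : exists m0 a b, [/\ is_plus m0 a i0, is_plus m0 b l,
    is_plus_omega m0 i & forall t j, (0 < t)%N -> is_plus m0 t j -> alpha j = 1%N].
  have [le|/ltW le] := leP i0 l.
    by have [b h] := omega_between i0i le (omega_gt li); exists i0, 0%N, b.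
  by have [a h] := omega_between li le (omega_gt i0i); exists l, a, 0%N.
have [g mg] := omega_seq ml.
have iag t : is_plus i0 t (g (a + t)%N).
  have [k mk ik] := is_plus_split (mg (a + t)%N).
  by rewrite (is_plus_uniq ma mk).
have lbg t : is_plus l t (g (b + t)%N).
  have [k mk ik] := is_plus_split (mg (b + t)%N).
  by rewrite (is_plus_uniq mb mk).
have Lg t : L (g t).
  have [Lk _] := LL (iag t); have [_ seg] := inv_seg iL; apply: seg Lk _.
  have [->//|] := eqVneq a 0%N; rewrite -lt0n => a0.
  by apply/ltW/(is_plus_lt (mg _) (mg _)); lia.
have ch := chain_of iL mg Lg (fun t => m1 _ _ (ltn0Sn t) (mg t.+1)).
have skl t j : (0 < t)%N -> is_plus l t j -> skey nu (Q j) (beta j).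
  by move=> _ /(is_plus_uniq (lbg t)) <-; apply: inv_skey iL _ (Lg _).
have [im hj] := (limit_jumpP _ skl).1 lj.
have jump t : ~ exact_at (Q (g t)) (Q i).
  move=> h; apply: (hj t.+1 (g (b + t.+1)%N) (ltn0Sn t) (lbg _)).
  by apply: (chain_exact_at ch (t := t)) => //; lia.
exists (fun t => g (a + t)%N); split=> //.
- split=> [t|t t'|t]; first exact: (chain_skey ch).
    exact: (chain_size ch).
  by rewrite addnS; apply: (chain_lt ch).
- move=> f fm fj; have : (degree (Q i) <= degree f)%N.
    apply: lmin; apply/(limit_jumpP _ skl); split=> // t j t0 /(is_plus_uniq (lbg t)) <- h.
    by apply: (fj (b + t)%N); apply: (chain_exact_at ch) h; lia.
  have := monic_neq0 fm; have := monic_neq0 im; rewrite -!size_poly_gt0 /degree.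
  by case: (size (Q i)) => // x _; case: (size f).
- split=> //; have sg := inv_size iL (Lg (b + 1)%N).
  have [D hD] := is_expansion_ex (Q i) sg.
  rewrite (lal 1%N _ D (ltn0Sn 0) (lbg 1%N) hD).
  have [h1 h2] := expansion_degree sg (monic_neq0 im) hD.
  have -> : deg_at i0 = deg_at (g (b + 1)%N).
    have := iag 0%N; rewrite addn0 /= => <-.
    by rewrite /deg_at (chain_size ch a (b + 1)).
  by rewrite h1.
Qed.

Lemma limit_below j : (j < i0)%O -> Q j != 0 /\ hull (beta j).
Proof.
move=> ji; have [Li0 _] := LL (erefl : is_plus i0 0 i0).
exact: inv_hull_below iL Li0 ji.
Qed.

(** The jump of [Q i] bounds all the values before it by [jump_bound]; the bound lies in the hull
    because the truncated value of [Q i] at [i0] does. *)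
Lemma limit_bounded : hull (beta i) -> exists2 B, hull B &
  forall t j, is_plus i0 t j -> beta j *+ 1 <= B.
Proof.
move=> hi; have [s [is' ch jump _ [im _]]] := limit_facts.
have [Li0 h0] := LL (erefl : is_plus i0 0 i0).
have fe : expandable_below i0 := inv_expandable iL Li0 h0.
have e0 : s 0%N = i0 := is' 0%N.
have [m [hm nm]] := wexact_ex (chain_skey ch 0) (monic_neq0 im).
have hullm : hull m.
  have /existsNP [j nj'] := nm; have [d0 vd] := v_exact (hm j) nj'.
  rewrite -(subrK (v (Q (s 0%N)) *+ j) m); apply: (hullD GK0 GKB).
    rewrite -vd e0; rewrite e0 in d0; apply: hull_small limit_below fe _ d0.
    by apply: size_dig; apply: skey_neq0 (inv_skey iL Li0).
  by rewrite e0; apply: (hullMn GK0 GKB).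
exists (beta i - m + beta i0).
  by apply: (hullD GK0 GKB) => //; apply: (hullB GK0 GKB).
move=> t j /(is_plus_uniq (is' t)) <-; rewrite mulr1n; apply: ltW.
have := jump_bound ch (@jump t) hm; by rewrite e0.
Qed.

Lemma limit_polynomial_facts (B : Gam) (n : nat) : hull B -> (0 < n)%N ->
  (forall t j, is_plus i0 t j -> beta j *+ n <= B) ->
  size (Q i) = (alpha i * deg_at i0).+1 /\
  forall t j, is_plus i0 t j ->
    [/\ dig (Q j) (Q i) (alpha i) = 1,
        wcmp false (Q j) (beta j) (beta j *+ alpha i) (Q i),
        dig (Q j) (Q i) 0 != 0 & v (dig (Q j) (Q i) 0) = beta j *+ alpha i].
Proof.
move=> hB n0 bB; have [s [is' ch jump smin [im /andP[s1 s2]]]] := limit_facts.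
have slow := bounded_slow GK0 GKB nuK_rank (fun t => chain_lt ch t)
  (fun t => (LL (is' t)).2) hB n0 (fun t => bB _ _ (is' t)).
have [d0 [sd h]] := limit_polynomial ch slow im jump smin.
have e0 : s 0%N = i0 := is' 0%N; rewrite e0 -/(deg_at i0) in sd.
have dpos : (0 < deg_at i0)%N.
  have [Li0 _] := LL (erefl : is_plus i0 0 i0); exact: good_dg (inv_good iL Li0).
(* The definition of [alpha i] leaves one possible multiple of [deg_at i0]. *)
have -> : alpha i = d0.
  apply/eqP; rewrite eqn_leq -(leq_pmul2r dpos) -ltnS -sd s1 /=.
  by rewrite -ltnS -(ltn_pmul2r dpos) -sd.
by split=> // t j /(is_plus_uniq (is' t)) <-; apply: h.
Qed.

End LimitFacts.

Lemma is_next_limit L i i0 : (forall j, (j <= i)%O -> L j) -> is_plus_omega i0 i ->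
  (forall t j, is_plus i0 t j -> alpha j = 1%N) -> is_next alpha L i0 i.
Proof.
by move=> Li ii a1; split; [apply: Li|left; split=> //; split=> //; exists i => //; apply: Li].
Qed.

Lemma exact_at_scale q f (a : K) : skey nu q (v q) -> a != 0 -> exact_at q (a *: f) -> exact_at q f.
Proof.
move=> sk a0 h; apply: contrapT => nf; rewrite -mul_polyC in h.
by apply: (Nexact_at_mul sk _ _ nf) h; rewrite ?polyC_eq0 // size_polyC a0 (skey_size sk).
Qed.

(** Minimality makes every polynomial of smaller degree exact somewhere in the chain, while [Q k]
    jumps throughout; this yields strictness of [Q k]. *)
Lemma step_union_inv L L' : key_invariant L -> step_from_union nu alpha Q L L' ->
  key_invariant L' /\ exists2 k, is_max L' k & exists2 l, L l & (forall i, L i -> deg_at i <= deg_at l)%N /\ (deg_at l < deg_at k)%N.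
Proof.
move=> iL [nomax [l [k [Ll labove l1 [lk hj hmin hal] ->]]]].
have [_ seg] := inv_seg iL.
have ex i : L i -> exists2 j, L j & (i < j)%O.
  move=> Li; apply: contrapT => no; apply: nomax; exists i; split=> // j Lj.
  by rewrite leNgt; apply/negP => ij; apply: no; exists j.
have hLi i : L i -> hull (beta i).
  by move=> Li; apply: (inv_hull iL Li) => im; apply: nomax; exists i.
have Lt t j : is_plus l t j -> L j.
  elim: t j => [|t IH] j /=; first by move=> ->.
  move=> [p /IH Lp [_ pj]]; have [j' Lj' pj'] := ex p Lp.
  by apply: seg Lj' _; apply: pj.
have LL t j : is_plus l t j -> L j /\ hull (beta j).
  by move=> /Lt Lj; split=> //; apply: hLi.
have below i : L i -> (i < k)%O.
  move=> Li; have [il|li] := leP i l; first exact: le_lt_trans il (omega_gt lk).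
  by have [t _ lt] := labove i Li li; exact: (omega_lt lk lt).
have upper i : (i < k)%O -> L i.
  move=> ik; have [il|li] := leP i l; first exact: seg Ll il.
  by have [t lt] := omega_between lk (ltW li) ik; apply: Lt lt.
have ldk : lim_data k.
  by exists l; split=> // t j D; apply: hal.
have [s [ls ch jump smin [km /andP[s1 s2]]]] := limit_facts iL lk l1 LL ldk.
have e0 : s 0%N = l := ls 0%N.
have Ls t : L (s t) := Lt _ _ (ls t).
have sl t : size (Q (s t)) = size (Q l) by rewrite (chain_size ch t 0) e0.
have mons t : Q (s t) \is monic := inv_monic iL (Ls t).
have dgs t : deg_at (s t) = deg_at l by rewrite /deg_at sl.
have dgL i : L i -> (deg_at i <= deg_at l)%N.
  move=> Li; have [il|li] := leP i l; first exact: (good_dg_mono (inv_good iL Ll) il).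
  by have [t _ /(is_plus_uniq (ls t)) <-] := labove i Li li; rewrite dgs.
(* A smaller degree would be exact at once. With equal degree, cofinality gives a chain member worth
   at least [Q k], so their difference is reduced with value at least [v (Q k)], and [Q k] would be
   exact there. *)
have big : (size (Q l) < size (Q k))%N.
  rewrite ltnNge leq_eqVlt; apply/negP => /orP[/eqP e|lt]; last first.
    by apply: (jump 0%N); apply: exact_at_small; rewrite e0.
  have [l' [Ll' labove' l1' cof]] :=
    inv_tail iL nomax (ex_intro _ (deg_at l) dgL).
  have el : size (Q l') = size (Q l).
    have [ll|ll|->//] := ltgtP l l'.
      by have [t _ /(is_plus_uniq (ls t)) <-] := labove l' Ll' ll; rewrite sl.
    have [t lt] := labove' l Ll ll.
    have e' : deg_at l = deg_at l'.
      by apply: (dg_plus (inv_good iL Ll) _ lt) => r j h /andP[r0 _]; apply: l1' h.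
    rewrite -(ltn_predK (inv_size iL Ll')) -(ltn_predK (inv_size iL Ll)).
    by congr _.+1; apply/esym/e'.
  have [t [j [lj Lj le]]] := cof (Q k) km (etrans e (esym el)).
  have [r [r0 bj]] : exists r, (0 < r)%N /\ beta j <= beta (s r).
    have [jl|lj'] := leP j l; last first.
      have [r r0 lr] := labove j Lj lj'; exists r; split=> //.
      by rewrite (is_plus_uniq lr (ls r)).
    exists 1%N; split=> //; have js : (j <= s 1%N)%O.
      by apply: le_trans jl _; apply/ltW/(is_plus_lt0 (ls 1%N)).
    have [|b lb] := labove' (s 1%N) (Ls 1%N).
      apply: le_lt_trans (is_plus_le lj) _; apply: le_lt_trans jl _.
      exact: (is_plus_lt0 (ls 1%N)).
    have [n eb] : exists n, b = (t + n)%N.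
      by exists (b - t)%N; rewrite subnKC // (is_plus_leq lj lb).
    move: lb; rewrite eb => /is_plus_split [j' /(is_plus_uniq lj) <- jb].
    apply: (beta_plus iL (Ls 1%N) jb) => m j'' h /andP[m0 _].
    by apply: (l1' (t + m)%N); [rewrite addn_gt0 m0 orbT|apply: is_plusD lj h].
  apply: (jump r); have sw : (size (Q k - Q (s r))%R < size (Q (s r)))%N.
    by rewrite sl -e; apply: size_subr_monic => //; rewrite e sl.
  move=> c hc; have bk : pge (v (Q k)) (Q (s r)).
    by apply/(pgeP _ _ (monic_neq0 (mons r))); apply: le_trans le bj.
  have k0 := monic_neq0 km.
  rewrite -(subrK (Q (s r)) (Q k)); apply: wcmpD; last first.
    apply: (wcmpW (c' := v (Q (s r)))); last exact: wge_q (chain_skey ch r).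
    by have /(pgeP _ _ k0) h := hc; apply: le_trans h (le_trans le bj).
  apply/(wcmp_small _ _ _ _ sw); apply: pgeB => //.
  by apply: pgeW bk; apply/(pgeP _ _ k0).
have nje f : (size f < size (Q k))%N -> exists t, exact_at (Q (s t)) f.
  move=> sf; have [->|f0] := eqVneq f 0; first by exists 0%N; apply: exact_at0.
  apply: contrapT => no; have lc : lead_coef f != 0 by rewrite lead_coef_eq0.
  suff : (size (Q k) <= size ((lead_coef f)^-1 *: f))%N.
    by rewrite size_scale ?invr_neq0 // leqNgt sf.
  apply: smin => [|t /(exact_at_scale (chain_skey ch t))]; first by rewrite monicE lead_coefZ mulVf.
  by rewrite invr_neq0 // => /(_ isT) h; apply: no; exists t.
have k0 := monic_neq0 km.
have skk : skey nu (Q k) (beta k).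
  split=> //; [exact: ltn_trans (inv_size iL Ll) big|exact: pge_val|].
  move=> f h c sf sh; have sr : (size ((f * h) %% Q k)%R < size (Q k))%N by rewrite ltn_modp.
  have [t1 n1] := nje f sf; have [t2 n2] := nje h sh.
  have [t3 n3] := nje _ (size_carry k0 sf sh); have [t4 n4] := nje _ sr.
  (* One index late enough for the two factors, the carry and the remainder. *)
  pose t := (t1 + t2 + t3 + t4)%N.
  apply: (carry_of_jump (chain_skey ch t) km (@jump t)).
  - by apply: (chain_exact_at ch) n1; rewrite /t; lia.
  - by apply: (chain_exact_at ch) n2; rewrite /t; lia.
  - by apply: (chain_exact_at ch) n3; rewrite /t; lia.
  - by apply: (chain_exact_at ch) n4; rewrite /t; lia.
have dlk : (deg_at l < deg_at k)%N.
  rewrite /deg_at -ltnS (ltn_predK (inv_size iL Ll)).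
  by rewrite (ltn_predK (ltn_trans (inv_size iL Ll) big)).
have dl : (0 < deg_at l)%N := good_dg (inv_good iL Ll).
have ak : (0 < alpha k)%N.
  rewrite lt0n; apply/eqP => e; move: s2; rewrite e mul1n => h.
  by move: (leq_trans big h); rewrite ltnNge /deg_at leq_pred.
have next t : is_next alpha (uptoT k) (s t.+1) k.
  have h := ls t.+1; apply: is_next_limit => [j jk||r j hj']; first by split.
  - exact: (omega_shift lk h).
  - by apply: (l1 (t.+1 + r)%N) => //; apply: is_plusD h hj'.
have gk : good k.
  move=> i; rewrite le_eqVlt => /orP[/eqP->|/upper Li]; last exact: (inv_good iL Li).
  split=> //; first exact: skey_size skk.
  apply: Or33; exists (s 1%N); split; first exact: (omega_shift lk (ls 1%N)).
    by move=> t j h; apply: (l1 (1 + t)%N) => //; apply: is_plusD (ls 1%N) h.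
  by rewrite dgs -ltnS (ltn_predK (ltn_trans (inv_size iL Ll) big)).
(* The hull condition gives the bound that makes the degree of [Q k] exactly [alpha k] times that of
   the chain; then [alpha k] digits suffice. *)
have fek : hull (beta k) -> expandable_below k.
  move=> hk f sf; have [->|f0] := eqVneq f 0; first exact: expandable0.
  have [B hB bB] := limit_bounded iL lk l1 LL ldk hk.
  have [sk _] := limit_polynomial_facts iL lk l1 LL ldk hB (ltn0Sn 0) bB.
  have [t nt] := nje f sf; have {}nt := chain_exact_at ch (leqW (leqnn t)) nt.
  have gs : (s t.+1 < k)%O := omega_lt lk (ls t.+1).
  have q0 : Q (s t.+1) != 0 := monic_neq0 (mons _).
  have ef := dig_expand q0 (n := alpha k) (f := f) _.
  apply: (expandable_combine gk gs (next t) (leqnn _) f0 (ef _)).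
  - by rewrite -/(deg_at (s t.+1)) dgs -ltnS -sk.
  - move=> j _; apply: (inv_expandable iL (Ls _) (hLi _ (Ls _))); exact: size_dig.
  - by move=> j _; apply: nt.
have kmax : is_max (L `|` [set k]) k.
  by split; [right|move=> j [/below/ltW|->]].
split; last by exists k => //; exists l.
split.
- split=> [|i j [Lj|->] ij]; first by left; case: (inv_seg iL).
    by left; apply: seg Lj ij.
  move: ij; rewrite le_eqVlt => /orP[/eqP->|ik]; first by right.
  by left; apply: upper.
- by move=> i [/(inv_monic iL)|->].
- by move=> i [/(inv_alpha iL)|->].
- by move=> i [/(inv_skey iL)//|->].
- by move=> i [/(inv_kind iL)//|->]; apply: Or33.
- by move=> i [/hLi//|-> /(_ kmax)].
- move=> i [Li|->] hi; first exact: (inv_expandable iL Li hi).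
  exact: fek.
- move=> n; have [fin|cof] := inv_cof iL n; [left|right].
    apply: (@sub_finite_set _ _ ([set i | L i /\ degree (Q i) = n] `|` [set k])).
      by move=> i [[Li|->] e]; [left|right].
    by rewrite finite_setU.
  by move=> f fm fn; have [i [Li e] h] := cof f fm fn; exists i => //; split=> //; left.
- by move=> no; case: no; exists k.
Qed.

Lemma zspanD (V : zmodType) (A : set V) x y : zspan A x -> zspan A y -> zspan A (x + y).
Proof.
move=> hx hy; have := zspan_sub (zspan0 A) hy; rewrite sub0r => /(zspan_sub hx).
by rewrite opprK.
Qed.

Lemma key_invariant_init : Q \bot%O = 'X -> alpha \bot%O = 1%N -> key_invariant [set \bot%O].
Proof.
move=> Q0 a0; have max0 : is_max [set (\bot%O : W)] \bot%O by split=> // j ->.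
have sX : size (Q \bot%O) = 2%N by rewrite Q0 size_polyX.
split.
- by split=> // i j -> ij; apply: le_anti; rewrite ij le0x.
- by move=> i ->; rewrite Q0 monicX.
- by move=> i ->; rewrite a0.
- move=> i ->; split; rewrite ?sX ?Q0 ?monicX //; first by rewrite /Defs.beta Q0; apply: pge_val.
  move=> f h c sf sh _; rewrite divp_small; first exact: pgt0.
  have aux (m n : nat) : (m < 2 -> n < 2 -> (m + n).-1 < 2)%N by lia.
  rewrite size_polyX in sf sh *; apply: leq_ltn_trans (size_polyMleq _ _) _; exact: aux.
- by move=> i ->; apply: Or31.
- by move=> i -> /(_ max0).
- move=> i -> _ c; rewrite sX ltnS => /size1_polyC ->.
  have [->|c0] := eqVneq (c`_0) 0; first exact: expandable0.
  pose E := seq_expansion [:: [fsfun] : exponent W] (fun=> c`_0).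
  have m1 : mono [fsfun] = 1 by rewrite /Defs.mono finsupp0 big_nil.
  have eE : ev E = (c`_0)%:P.
    by rewrite /E ev_seq_expansion // big_seq1 m1 alg_polyC.
  have g0 g : g \in finsupp E -> g = [fsfun].
    by rewrite mem_finsupp seq_expansionE inE; have [->//|_] := eqVneq g [fsfun]; rewrite eqxx.
  have z0 j : ([fsfun] : exponent W) j = 0%N by rewrite fsfun0E.
  have c0' : (c`_0)%:P != 0 by rewrite polyC_eq0.
  have tE : term E [fsfun] = (c`_0)%:P.
    by rewrite /Defs.term m1 seq_expansionE inE eqxx alg_polyC.
  exists E => //; split=> [g /g0 ->|_].
    split; last exact: z0.
    split=> [j|j k jb|j k m n _ _ _ _]; rewrite ?z0 ?eqxx //.
    by move: jb; rewrite ltx0.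
  rewrite eE; split=> //; split.
    exists [fsfun]; last by rewrite tE.
    by rewrite mem_finsupp seq_expansionE inE eqxx.
  by move=> b [g /g0 -> ->]; rewrite tE.
- by move=> n; left; apply: (@sub_finite_set _ _ [set \bot%O]) => // i [].
- by move=> no; case: no; exists \bot%O.
Qed.

(** * Preservation of the invariant and growth of degrees *)

Definition step (L L' : set W) : Prop :=
  step_from_max nu alpha Q L L' \/ step_from_union nu alpha Q L L'.

(** The indices added by one step lie on a single sequence of successors, which is what the bound on
    the order type uses. *)
Definition marked (L L' : set W) : Prop :=
  L `<=` L' /\ exists m, forall i, L' i -> ~ L i -> exists t, is_plus m t i.

Lemma step_invariant L L' : key_invariant L -> step L L' -> key_invariant L' /\ marked L L'.
Proof.
move=> iL [[l [a [E [lmax hE mp steps]]]]|un].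
  have hl := step_hull iL lmax hE mp.
  case: steps => [[a1 [k [lk ak Qk ->]]]|[_ [st|st]]].
  - split; first exact: (step_successor_inv iL lmax hE mp).
    split; first by move=> i; left.
    by exists k => i [//|-> _]; exists 0%N.
  - split; first by case: (step_attained_inv iL lmax hl st).
    have [w [s [z [tl [_ _ _ _ [_ ->]]]]]] := st; split; first by move=> i; left.
    by exists l => i [//|[t _ lt] _]; exists t.
  - split; first by case: (step_unattained_inv iL lmax hl st).
    have [wt [z [tl [n [_ _ _ _ [_ ->]]]]]] := st; split; first by move=> i; left.
    by exists l => i [//|[t _ lt] _]; exists t.
split; first by case: (step_union_inv iL un).
have [_ [l [k [_ _ _ _ ->]]]] := un; split; first by move=> i; left.
by exists k => i [//|-> _]; exists 0%N.
Qed.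

Lemma max_uniq (L : set W) k l : is_max L k -> is_max L l -> k = l.
Proof. by move=> [Lk hk] [Ll hl]; apply: le_anti; rewrite hk ?hl. Qed.

Lemma max_dg L l i : key_invariant L -> is_max L l -> L i -> (deg_at i <= deg_at l)%N.
Proof.
by move=> iL [Ll h] Li; apply: (good_dg_mono (inv_good iL Ll)); apply: h.
Qed.

(* Two consecutive steps raise the degree: after an attained maximum the next
   relation has degree at least two, and after an unattained one there is no
   maximal index, so that a limit key polynomial follows. *)
Lemma two_steps_dg L L' L'' : key_invariant L -> step L L' -> step L' L'' ->
  exists2 j, L'' j & forall i, L i -> (deg_at i < deg_at j)%N.
Proof.
move=> iL st st'; have [iL' [sub _]] := step_invariant iL st.
have [_ [sub' _]] := step_invariant iL' st'.
case: st => [[l [a [E [lmax hE mp steps]]]]|un]; last first.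
  have [_ [k [L'k _] [l Ll [le lt]]]] := step_union_inv iL un.
  by exists k => [|i /le h]; [apply: sub'|apply: leq_ltn_trans lt].
have hl := step_hull iL lmax hE mp.
case: steps => [[a1 [k [lk ak Qk eL]]]|[_ [st|st]]].
- exists k => [|i Li]; first by apply: sub'; rewrite eL; right.
  apply: leq_ltn_trans (max_dg iL lmax Li) _.
  exact: (step_successor_dg iL lmax hE a1 Qk).
- have [_ [k kmax best]] := step_attained_inv iL lmax hl st.
  case: st' => [[l' [a' [E' [lmax' hE' mp' steps']]]]|[nomax _]]; last first.
    by case: nomax; exists k.
  have e := max_uniq kmax lmax'; rewrite e in best.
  case: steps' => [[a1 [k' [lk ak Qk eL]]]|[a1 _]]; last first.
    have [f fT lt] := step_improve iL' lmax' hE' mp' a1.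
    by have := lt_le_trans lt (best f fT); rewrite ltxx.
  exists k' => [|i Li]; first by rewrite eL; right.
  apply: leq_ltn_trans (max_dg iL' lmax' (sub _ Li)) _.
  exact: (step_successor_dg iL' lmax' hE' a1 Qk).
- have [_ nomax] := step_unattained_inv iL lmax hl st.
  case: st' => [[l' [a' [E' [lmax' _ _ _]]]]|un]; first by case: nomax; exists l'.
  have [_ [k [L''k _] [l' Ll' [le lt]]]] := step_union_inv iL' un.
  by exists k => // i /sub /le h; apply: leq_ltn_trans lt.
Qed.

Lemma complete_unbounded L : key_invariant L -> (forall n, exists2 i, L i & (n <= deg_at i)%N) ->
  complete nu alpha Q L.
Proof.
move=> iL ub b; apply/funext => f; apply/propext; split=> [hf|].
  have [i Li ni] := ub (size f).
  (* An index of larger degree shows that [i] is not maximal, hence that [beta i] lies in the hull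
     as expansions require. *)
  have [j Lj nj'] := ub (deg_at i).+1.
  have hi : hull (beta i).
    apply: (inv_hull iL Li) => im; have := max_dg iL im Lj.
    by rewrite leqNgt nj'.
  have sf : (size f < size (Q i))%N.
    by apply: leq_ltn_trans ni _; rewrite /deg_at ltn_predL; apply: ltnW (inv_size iL Li).
  have [E fE e] := inv_expandable iL Li hi sf; rewrite -e in hf *.
  rewrite /Defs.ev big_seq; apply: (big_ind (zspan _)) => [|x y|g gE].
  - exact: zspan0.
  - exact: zspanD.
  apply: zspan_gen; exists (E g), g; have [std' _] := fE.1 g gE.
  have a0 : E g != 0 by rewrite -mem_finsupp.
  have q0 k : g k != 0%N -> Q k != 0.
    by move=> gk; apply: good_neq0 (inv_good iL Li) _; apply: std_supp std' gk.
  split=> //; last by exists i => //; rewrite /standard_exponent (upto_inv iL Li).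
  split=> //; have m0 := mono_neq0 q0; have := free_pge fE gE.
  have ev0 : ev E != 0.
    by case: fE => _ /(_ _)[]//; apply/fset0Pn; exists g.
  have /(pgeP _ _ ev0) le := hf.
  rewrite /Defs.term -mul_polyC => /pgeP; rewrite mulf_neq0 ?polyC_eq0 // => /(_ isT) le'.
  apply: le_trans (le_trans le le') _.
  by rewrite vM ?polyC_eq0 // v_mono // addrC.
elim=> [|x y _ hx _ hy|x [a [g [-> [a0 le] [l Ll st]]]]]; first exact: pge0.
  exact: pgeB.
have q0 k : g k != 0%N -> Q k != 0.
  move=> gk; have [_ seg] := inv_seg iL; apply: skey_neq0 (inv_skey iL _).
  by case: st => h _ _; case: (h k gk).
right; apply: le_trans le _; rewrite -mul_polyC -[X in _ <= X]/(v _).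
by rewrite vM ?polyC_eq0 ?mono_neq0 // v_mono // addrC.
Qed.

Lemma zspan_pge L b f : (forall i, L i -> Q i != 0) ->
  zspan [set f | exists (a : K) (g : exponent W),
    [/\ f = a *: mono g, monomial_ge nu Q b a g & forall i, g i != 0%N -> L i]] f ->
  pge b f.
Proof.
move=> q0; elim=> [|x y _ hx _ hy|x [a [g [-> [a0 le] st]]]]; first exact: pge0.
  exact: pgeB.
have q0' k : g k != 0%N -> Q k != 0 by move/st/q0.
right; apply: le_trans le _; rewrite -mul_polyC -[X in _ <= X]/(v _).
by rewrite vM ?polyC_eq0 ?mono_neq0 // v_mono // addrC.
Qed.

(** * From the invariant to sets of key polynomials *)

Section KeyPolynomials.
Variable L : set W.
Hypothesis iL : key_invariant L.

Let seg : forall i j, L j -> (i <= j)%O -> L i := (inv_seg iL).2.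

Lemma standard_expansion_inv l : L l ->
  standard_expansion nu alpha Q L l = standard_expansion nu alpha Q setT l.
Proof.
by move=> Ll; rewrite /standard_expansion /free_expansion /standard_exponent (upto_inv iL Ll).
Qed.

Lemma jumps_inv l : L l -> jumps nu alpha Q L l = jumps nu alpha Q setT l.
Proof. by move=> Ll; rewrite /jumps (standard_expansion_inv Ll). Qed.

Section LimitIndex.
Variables (i i0 : W).
Hypothesis Li : L i.
Hypothesis ldi : lim_data i.
Hypothesis nx : is_next alpha L i0 i.

Lemma limit_index : is_plus_omega i0 i /\ forall t j, is_plus i0 t j -> alpha j = 1%N.
Proof.
have [l [li _ _ _ _]] := ldi; case: nx => _ [[[_ a1] h]|[_ /(omega_nsucc li)//]].
by [].
Qed.

Let i0i : is_plus_omega i0 i. Proof. by case: limit_index. Qed.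
Let a1' : forall t j, is_plus i0 t j -> alpha j = 1%N. Proof. by case: limit_index. Qed.
Let a1 : forall t j, (0 < t)%N -> is_plus i0 t j -> alpha j = 1%N.
Proof. by move=> t j _; apply: a1'. Qed.

Let LL : forall t j, is_plus i0 t j -> L j /\ hull (beta j).
Proof.
move=> t j h; have ji := omega_lt i0i h; have Lj := seg Li (ltW ji); split=> //.
by apply: (inv_hull iL Lj) => -[_ /(_ i Li)]; rewrite leNgt ji.
Qed.

Let Li0 : L i0. Proof. by case: (LL (erefl : is_plus i0 0 i0)). Qed.
Let fe0 : expandable_below i0.
Proof. by have [_ h] := LL (erefl : is_plus i0 0 i0); exact: (inv_expandable iL Li0 h). Qed.
Let g0 : good i0 := inv_good iL Li0.
Let sk0 : skey nu (Q i0) (beta i0) := inv_skey iL Li0.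

Lemma limit_index_jumps :
  (exists C, standard_expansion nu alpha Q L i0 (Q i) (alpha i).+1 C) /\
  jumps nu alpha Q L i0 (Q i).
Proof.
have [s [is' ch jump smin [im /andP[s1 s2]]]] := limit_facts iL i0i a1 LL ldi.
have e0 : s 0%N = i0 := is' 0%N.
rewrite jumps_inv // standard_expansion_inv //; split.
  exact: (standard_expansion_ex g0 fe0 (dig_expand (skey_neq0 sk0) s2)).
by apply/jumpsP => //; rewrite -e0; apply: jump.
Qed.

(** Every index of the tail has [i] as its next index, so [f] jumps along the whole chain; dividing
    by its leading coefficient makes the minimality among monic polynomials applicable. *)
Lemma limit_index_minimal f : (forall i0, is_next alpha L i0 i -> jumps nu alpha Q L i0 f) ->
  (degree (Q i) <= degree f)%N.
Proof.
move=> hf; have [s [is' ch jump smin [im _]]] := limit_facts iL i0i a1 LL ldi.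
have hs t : ~ exact_at (Q (s t)) f.
  have [Ls hs] := LL (is' t); have nxs : is_next alpha L (s t) i.
    apply: is_next_limit => [j /(seg Li)//||r j h]; first exact: (omega_shift i0i (is' t)).
    by apply: (a1' (t := (t + r)%N)); apply: is_plusD (is' t) h.
  have := hf _ nxs; rewrite jumps_inv //.
  exact: (jumpsP _ (inv_good iL Ls) (inv_expandable iL Ls hs) (inv_skey iL Ls)).1.
have f0 : f != 0 by apply: contra_notN (hs 0%N) => /eqP ->; apply: exact_at0.
have lc : (lead_coef f)^-1 != 0 by rewrite invr_neq0 // lead_coef_eq0.
have := smin ((lead_coef f)^-1 *: f); rewrite size_scale // monicE lead_coefZ mulVf ?lead_coef_eq0 //.
move=> /(_ (eqxx _)) h; have : (size (Q i) <= size f)%N.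
  by apply: h => t /(exact_at_scale (chain_skey ch t) lc); apply: hs.
have := monic_neq0 im; rewrite -!size_poly_gt0 /degree.
by case: (size (Q i)) => // x _; case: (size f).
Qed.

Lemma limit_index_facts :
  bounded_in_hull GK [set beta i' | i' in before L i] \/ ~ is_max L i ->
  size (Q i) = (alpha i * deg_at i0).+1 /\
  forall t j, is_plus i0 t j ->
    [/\ dig (Q j) (Q i) (alpha i) = 1,
        wcmp false (Q j) (beta j) (beta j *+ alpha i) (Q i),
        dig (Q j) (Q i) 0 != 0 & v (dig (Q j) (Q i) 0) = beta j *+ alpha i].
Proof.
case=> [[B [n n0 [GB bB]]]|nm].
  apply: (limit_polynomial_facts iL i0i a1 LL ldi (hull_sub GB) n0) => t j h.
  apply: bB; exists j => //; have ji := omega_lt i0i h.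
  by split=> //; apply: seg Li (ltW ji).
have [B hB bB] := limit_bounded iL i0i a1 LL ldi (inv_hull iL Li nm).
exact: (limit_polynomial_facts iL i0i a1 LL ldi hB (ltn0Sn 0) bB).
Qed.

Lemma limit_index_expansion C :
  bounded_in_hull GK [set beta i' | i' in before L i] \/ ~ is_max L i ->
  standard_expansion nu alpha Q L i0 (Q i) (alpha i).+1 C ->
  [/\ ev (C (alpha i)) = 1,
      is_least (summand_values nu Q i0 (alpha i).+1 C) (beta i0 *+ alpha i),
      ev (C 0%N) != 0
    & v (ev (C 0%N)) = beta i0 *+ alpha i].
Proof.
move=> /limit_index_facts [_ /(_ 0%N i0 erefl) [d1 dw d0 dv]].
rewrite standard_expansion_inv // => /(standard_expansion_dig g0) e.
rewrite !e ltnSn ltnS leq0n in d1 d0 dv.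
split=> //; have q0 := skey_neq0 sk0; split.
  by exists (alpha i); rewrite ltnSn d1 oner_neq0 mul1r vX.
move=> b [j [ja c0 ->]]; have := dw j; rewrite e ja => /(pgeP _ _ c0) le.
by rewrite vM ?expf_neq0 // vX //; apply: (og_shift_le le); zring.
Qed.

End LimitIndex.

Lemma key_invariant_key_polynomials : countable L -> alpha \bot%O = 1%N -> Q \bot%O = 'X ->
  key_polynomials nu alpha Q L.
Proof.
move=> cL a0 Q0; split.
- split=> //; [exact: inv_seg iL|exact: inv_alpha iL|exact: inv_monic iL|].
  move=> i i0 Li ne nm nx; case: (inv_kind iL Li) => [e|[p [pi _ e _]]|ld].
  + by rewrite e eqxx in ne.
  + case: nx => _ [[_ /omega_nsucc h]|[_ i0i]]; first by case: (h p).
    by rewrite (is_succ_inj i0i pi).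
  + have [sz _] := limit_index_facts Li ld nx (or_intror nm).
    by rewrite /degree sz.
- by move=> i Li; exact: (inv_hull iL Li).
- move=> p i Li pi; have [pi' _] := pi; have Lp := seg Li (ltW pi').
  case: (inv_kind iL Li) => [e|[p' [p'i h _ _]]|[l [li _ _ _ _]]].
  + by move: pi'; rewrite e ltx0.
  + move: h; rewrite (is_succ_inj p'i pi) /key_successor /free_expansion /standard_exponent.
    by rewrite (upto_inv iL Lp) (before_initial (inv_seg iL) Lp).
  + by case: (omega_nsucc li pi).
- move=> i Li ne np; case: (inv_kind iL Li) => [e|[p [pi _ _ _]]|ld].
  + by rewrite e eqxx in ne.
  + by case: np; exists p.
  have ld' := ld; have [l [li l1 _ _ _]] := ld'; have [k lk] := omega_ex li 1.
  have nxk : is_next alpha L k i.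
    apply: is_next_limit => [j /(seg Li)//||r j h]; first exact: (omega_shift li lk).
    by apply: (l1 (1 + r)%N) => //; apply: is_plusD lk h.
  split; first by exists k.
  + by move=> i0 nx; exact: (limit_index_jumps Li ld nx).
  + by move=> f; exact: (limit_index_minimal Li ld nxk).
  + by move=> bd i0 C nx; exact: (limit_index_expansion Li ld nx bd).
- move=> n inf; by case: (inv_cof iL n).
Qed.

End KeyPolynomials.

Lemma fraction_clear (R : idomainType) (y : {fraction R}) :
  exists x h : R, h != 0 /\ y * h%:F = x%:F.
Proof.
elim/quotW: y => x; exists (\n_x), (\d_x); have d0 := denom_ratioP x; split=> //.
unlock FracField.tofrac; rewrite -[LHS]FracField.pi_mul; apply/eqmodP.
rewrite /= FracField.equivfE /FracField.mulf !numden_Ratio ?mulf_neq0 ?oner_eq0 //.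
by rewrite !mulr1 mulrC.
Qed.

(* Every degree of the graded algebra is reached by polynomials after clearing
   denominators, and [zspan] reduces polynomials to monomials. *)
Lemma adjoin_fractions (L : set W) : (forall i, L i -> Q i != 0) ->
  (forall b f, pge b f -> zspan [set f | exists (a : K) (g : exponent W),
    [/\ f = a *: mono g, monomial_ge nu Q b a g & forall i, g i != 0%N -> L i]] f) ->
  [set: gr nu] = gstar (adjoin Q L).
Proof.
move=> q0 gen; pose A := adjoin (nu := nu) Q L.
have polyA b f : pge b f -> A (cls nu b f%:F).
  move=> /gen; elim=> [|x y zx hx zy hy|x [a [g [ex age gL]]]].
  - by rewrite tofrac0 cls0; apply: subring_gen0.
  - have bx := zspan_pge q0 zx; have b_y := zspan_pge q0 zy.
    suff -> : cls nu b (x - y)%:F = cls nu b x%:F - cls nu b y%:F by apply: subring_gen_sub.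
    apply/eqP; rewrite eq_sym subr_eq -clsD //; last exact: (pgeB bx b_y).
    by rewrite -tofracD subrK.
  have xA : A (inp nu x).
    rewrite ex -mul_polyC inpM; apply: subring_gen_mul; last exact: adjoin_mono.
    by apply: subring_gen_gen; left; exists a.
  apply: adjoin_cls xA _; apply: (zspan_pge q0); apply: zspan_gen.
  by exists a, g.
apply/seteqP; split=> // z _.
have [s [hs ->]] := gr_components z.
suff [D D0 hD] : exists2 D : {poly K}, D != 0 & A ((\sum_(p <- s) cls nu p.1 p.2) * inp nu D).
  exists ((\sum_(p <- s) cls nu p.1 p.2) * inp nu D), (inp nu D); split=> //; split=> //.
  - by rewrite inp_cls; apply: polyA; apply: pge_val.
  - by rewrite inp_cls; apply: homogeneous_cls.
  - by rewrite inp_eq0.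
elim: s hs => [_|[b y] s IH hs].
  by exists 1; rewrite ?oner_neq0 // big_nil mul0r; apply: subring_gen0.
have [p ps|D D0 hD] := IH; first by apply: hs; rewrite inE ps orbT.
have hb : vge nu b y by apply: (hs (b, y)); rewrite mem_head.
have [x [h [h0 e]]] := fraction_clear y.
have inpA f : A (inp nu f) by rewrite inp_cls; apply: polyA; apply: pge_val.
exists (h * D); first by rewrite mulf_neq0.
rewrite big_cons mulrDl inpM; apply: subring_genD.
  rewrite mulrA; apply: subring_gen_mul; last exact: inpA.
  rewrite [inp nu h]inp_cls -clsM //; last exact: vge_refl.
  rewrite e; apply: polyA; rewrite /Defs.pge -e; apply: vgeM => //.
  exact: vge_refl.
by rewrite mulrCA; apply: subring_gen_mul => //; apply: inpA.
Qed.

(** * The whole run of the procedure *)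

Section Run.
Variable S : nat -> nat -> set W.
Hypothesis run : procedure nu alpha Q S.

Let S00 : S 0%N 0%N = [set \bot%O]. Proof. by case: run. Qed.

Lemma run_step a b : S a b.+1 = S a b \/ step (S a b) (S a b.+1).
Proof. by have [_ _ _ /(_ a b)[[_ ->]|[_]]] := run; [left|right]. Qed.

Lemma run_invariant b : key_invariant (S 0%N b).
Proof.
elim: b => [|b IH]; first by rewrite S00; apply: key_invariant_init; case: run.
by have [->|st] := run_step 0 b => //; have [] := step_invariant IH st.
Qed.

Lemma run_marked b : marked (S 0%N b) (S 0%N b.+1).
Proof.
have [->|st] := run_step 0 b; last by have [] := step_invariant (run_invariant b) st.
by split=> //; exists \bot%O.
Qed.

Lemma run_sub b (c : nat) : (b <= c)%N -> S 0%N b `<=` S 0%N c.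
Proof.
elim: c => [|c IH]; first by rewrite leqn0 => /eqP ->.
rewrite leq_eqVlt => /orP[/eqP->//|/IH sub] i /sub.
by have [h _] := run_marked c; apply: h.
Qed.

Definition run_union : set W := \bigcup_b S 0%N b.

Lemma run_unbounded : (forall b, ~ complete nu alpha Q (S 0%N b)) ->
  forall n, exists b, exists2 i, S 0%N b i & (n <= deg_at i)%N.
Proof.
move=> nc; have st b : step (S 0%N b) (S 0%N b.+1).
  by have [_ _ _ /(_ 0%N b)[[/nc]|[_]]] := run.
elim=> [|n [b [i Si ni]]].
  by exists 0%N, \bot%O; rewrite // S00.
have [j Sj lt] := two_steps_dg (run_invariant b) (st b) (st b.+1).
by exists b.+2, j => //; apply: leq_ltn_trans (lt i Si).
Qed.

Lemma run_stable b (c : nat) : complete nu alpha Q (S 0%N b) -> (b <= c)%N -> S 0%N c = S 0%N b.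
Proof.
move=> cb; elim: c => [|c IH]; first by rewrite leqn0 => /eqP ->.
rewrite leq_eqVlt => /orP[/eqP->//|/IH e]; rewrite -e.
by have [_ _ _ /(_ 0%N c)[[_ ->]//|[]]] := run; rewrite e.
Qed.

Lemma run_union_cases : (exists2 b, complete nu alpha Q (S 0%N b) & run_union = S 0%N b) \/
  forall n, exists b, exists2 i, S 0%N b i & (n <= deg_at i)%N.
Proof.
have [[b cb]|no] := EM (exists b, complete nu alpha Q (S 0%N b)); [left|right].
  exists b => //; apply/seteqP; split=> [i [c _ Sc]|i Si]; last by exists b.
  have [le|/ltnW le] := leqP b c; first by rewrite -(run_stable cb le).
  exact: run_sub le _ Sc.
by apply: run_unbounded => b cb; apply: no; exists b.
Qed.

Lemma run_union_invariant : key_invariant run_union.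
Proof.
have [[b _ ->]|ub] := run_union_cases; first exact: run_invariant.
split.
- split=> [|i j [b _ Sj] ij]; first by exists 0%N; rewrite // S00.
  by exists b => //; have [_ h] := inv_seg (run_invariant b); apply: h Sj ij.
- by move=> i [b _ /(inv_monic (run_invariant b))].
- by move=> i [b _ /(inv_alpha (run_invariant b))].
- by move=> i [b _ /(inv_skey (run_invariant b))].
- by move=> i [b _ /(inv_kind (run_invariant b))].
- move=> i [b _ Si] nm; have [j [c _ Sj] ij] : exists2 j, run_union j & (i < j)%O.
    apply: contrapT => no; apply: nm; split=> [|j Sj]; first by exists b.
    by rewrite leNgt; apply/negP => ij; apply: no; exists j.
  apply: (inv_hull (run_invariant (maxn b c))); first exact: run_sub (leq_maxl _ _) _ Si.
  by move=> [_ /(_ j (run_sub (leq_maxr _ _) Sj))]; rewrite leNgt ij.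
- by move=> i [b _ Si] hi; apply: (inv_expandable (run_invariant b) Si hi).
(* All indices of degree [n] lie below an index of larger degree, hence inside one finite stage,
   whose alternative is inherited. *)
- move=> n; have [b [i Si ni]] := ub n.+1.
  have [fin|cof] := inv_cof (run_invariant b) n; [left|right].
    apply: sub_finite_set fin => j [[c _ Sj] e]; split=> //.
    have [ij|/ltW ji] := leP i j; last by have [_ h] := inv_seg (run_invariant b); apply: h Si ji.
    have := good_dg_mono (inv_good (run_invariant c) Sj) ij.
    by rewrite /deg_at -[X in (_ <= X)%N]/(degree (Q j)) e leqNgt ni.
  move=> f fm fn; have [j [Sj e] h] := cof f fm fn; exists j => //; split=> //.
  by exists b.
- move=> _ [n hn]; have [b [i Si ni]] := ub n.+1.
  by have := hn i (ex_intro2 _ _ b I Si); rewrite leqNgt ni.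
Qed.

Lemma run_union_complete : complete nu alpha Q run_union.
Proof.
have [[b cb ->//]|ub] := run_union_cases.
apply: (complete_unbounded run_union_invariant) => n; have [b [i Si ni]] := ub n.
by exists i => //; exists b.
Qed.

(** The set at the first limit stage is complete, so the procedure leaves it unchanged for ever. *)
Lemma run_unionE : \bigcup_a \bigcup_b S a b = run_union.
Proof.
have [_ _ _ stop lim] := run.
have e a b : S a.+1 b = run_union.
  elim: a b => [|a IHa] b; (elim: b => [|b IHb]; last first).
  - have [[_ ->]//|[nc _]] := stop 1%N b; case: nc; rewrite IHb; exact: run_union_complete.
  - by rewrite lim.
  - have [[_ ->]//|[nc _]] := stop a.+2 b; case: nc; rewrite IHb; exact: run_union_complete.
  - by rewrite lim; apply/seteqP; split=> [i [c _]|i Si]; [|exists 0%N => //]; rewrite IHa.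
apply/seteqP; split=> [i [[|a] _ [b _]]|i [b _ Si]].
- by move=> Si; exists b.
- by rewrite e.
- by exists 0%N => //; exists b.
Qed.

(** An index is located by the step at which it first appears and by its distance from the base of
    that step. The second coordinate is needed because a single step may add infinitely many
    indices. *)
Lemma run_rank : exists phi : W -> nat * nat, forall i j, run_union i -> run_union j ->
  (i < j)%O -> ((phi i).1 < (phi j).1)%N \/ ((phi i).1 = (phi j).1 /\ ((phi i).2 < (phi j).2)%N).
Proof.
have /choice [m hm] : forall b, exists m, forall i, S 0%N b.+1 i -> ~ S 0%N b i ->
    exists t, is_plus m t i.
  by move=> b; case: (run_marked b).
pose good_pos i (p : nat * nat) := [/\ S 0%N p.1 i, forall b, S 0%N b i -> (p.1 <= b)%N
  & forall b, p.1 = b.+1 -> is_plus (m b) p.2 i].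
have /choice [phi hphi] : forall i, exists x, run_union i -> good_pos i x.
  move=> i; have [[b0 _ Sb0]|no] := EM (run_union i); last by exists (0%N, 0%N) => /no.
  have ex : exists b, `[< S 0%N b i >] by exists b0; apply/asboolP.
  case: (ex_minnP ex) => b /asboolP Sb minb.
  have minb' (c : nat) : S 0%N c i -> (b <= c)%N by move=> Sc; apply: minb; apply/asboolP.
  case: b Sb minb' {minb} => [|b] Sb minb; first by exists (0%N, 0%N).
  have [t ht] := hm b i Sb (fun h => ltac:(by have := minb b h; rewrite ltnn)).
  by exists (b.+1, t) => _; split=> // c [<-].
exists phi => i j Ui Uj ij; have [Si mi ti] := hphi i Ui; have [Sj mj tj] := hphi j Uj.
have le : ((phi i).1 <= (phi j).1)%N.
  by apply: mi; have [_ h] := inv_seg (run_invariant (phi j).1); apply: h Sj (ltW ij).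
move: le; rewrite leq_eqVlt => /orP[/eqP e|lt]; [right|by left]; split=> //.
case eb : (phi i).1 => [|b].
  move: Si Sj ij; rewrite -e eb S00 => -> ->; by rewrite ltxx.
have hi := ti b eb; rewrite e in eb; have hj := tj b eb.
rewrite ltnNge; apply/negP => le; move: ij; rewrite ltNge => /negP; apply.
move: le; rewrite leq_eqVlt => /orP[/eqP e2|lt]; last exact/ltW/(is_plus_lt hj hi).
by move: hj; rewrite e2 => /(is_plus_uniq hi) ->.
Qed.

End Run.

End Construction.

Theorem theorem6p2 (K : fieldType) (Gam : ordGroupType)
    (nu : valuation {fraction {poly K}} Gam)
    (nu_x : 0 < nu ('X)%:F) (nuK_rank : rank_one (value_group_K nu))
    (d : Order.disp_t) (W : bOrderType d)
    (W_wf : well_founded (fun i j : W => (i < j)%O))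
    (alpha : W -> nat) (Q : W -> {poly K}) (S : nat -> nat -> set W)
    (run : procedure nu alpha Q S) :
  let L := \bigcup_a \bigcup_b S a b in
  [/\ order_type_le_omega2 L,
      key_polynomials nu alpha Q L /\ complete nu alpha Q L,
      forall b : Gam, pge nu b =
        zspan [set f | exists (a : K) (g : exponent W),
                 [/\ f = a *: mono Q g, monomial_ge nu Q b a g
                   & forall i, g i != 0%N -> L i]]
    & [set: gr nu] = gstar (adjoin Q L)].
Proof.
move=> L; rewrite /L (run_unionE W_wf nuK_rank run).
have iU := run_union_invariant W_wf nuK_rank run; have cU := run_union_complete W_wf nuK_rank run.
have q0 i : run_union S i -> Q i != 0 by move=> /(inv_skey iU) /skey_neq0.
have [phi hphi] := run_rank W_wf nuK_rank run.
have [_ Q0 a0 _ _] := run.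
have gen b f : pge nu b f -> zspan [set f | exists (a : K) (g : exponent W),
    [/\ f = a *: mono Q g, monomial_ge nu Q b a g & forall i, g i != 0%N -> run_union S i]] f.
  rewrite cU; elim=> [|x y _ hx _ hy|x [a [g [-> ge [l _ [h _ _]]]]]].
  - exact: zspan0.
  - exact: zspan_sub.
  - by apply: zspan_gen; exists a, g; split=> // i /h [].
split.
- exists phi => i j Ui Uj ij; rewrite ltEprodlexi.
  have [lt|[-> lt]] := hphi i j Ui Uj ij; rewrite !leEnat ?ltEnat /=.
    by rewrite ltnW //= implybE -ltnNge lt.
  by rewrite leqnn.
- split=> //; apply: key_invariant_key_polynomials => //.
  (* The strictly increasing rank is injective on the index set, which gives countability. *)
  apply/countable_injP; exists (fun i => choice.pickle (phi i)) => i j.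
  rewrite !inE => Ui Uj /(pcan_inj choice.pickleK) e; apply: le_anti; apply/andP; split.
    rewrite leNgt; apply/negP => ji; have := hphi j i Uj Ui ji.
    by rewrite e !ltnn; case=> [|[]].
  rewrite leNgt; apply/negP => ij; have := hphi i j Ui Uj ij.
  by rewrite e !ltnn; case=> [|[]].
- move=> b; apply/funext => f; apply/propext; split; first exact: gen.
  exact: zspan_pge.
- exact: adjoin_fractions.
Qed.
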